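(* Let $k\ge 3$, and for each $i\in\{1,\dots,k\}$ let $X_{i1},\dots,X_{in_i}$ be $p$-variate i.i.d. random sample vectors from the $i$-th group, with mean vector $\mu_i$ and covariance matrix $\Sigma_i$, the samples of different groups being independent. Put $n=\sum_{i=1}^k n_i$. Assume: (a) $X_{ij}=\Gamma_i Z_{ij}+\mu_i$ for $i=1,\dots,k$, $j=1,\dots,n_i$, where $\Gamma_i$ is a $p\times m$ matrix for some $m\ge p$ such that $\Gamma_i\Gamma_i'=\Sigma_i$, and $\{Z_{ij}\}_{j=1}^{n_i}$ are $m$-variate i.i.d. random vectors satisfying $E(Z_{ij})=0$ and $\mathrm{Var}(Z_{ij})=I_m$; (b) $Z_{ij}=(z_{ij1},\dots,z_{ijm})'$, with $E(z_{ijl_1}^{\alpha_1}z_{ijl_2}^{\alpha_2}\cdots z_{ijl_q}^{\alpha_q})=E(z_{ijl_1}^{\alpha_1})E(z_{ijl_2}^{\alpha_2})\cdots E(z_{ijl_q}^{\alpha_q})$ whenever $q$ is a positive integer, $\alpha_1,\dots,\alpha_q$ are positive integers with $\sum_{l=1}^q\alpha_l\le 8$, and the indices $l_1,\dots,l_q$ are pairwise distinct; and $E(z_{ijl}^4)<\infty$; (c) $n_i/n\to k_i\in(0,1)$ as $n\to\infty$, for $i=1,\dots,k$; (d) $\mathrm{tr}(\Sigma_l\Sigma_d\Sigma_l\Sigma_h)=o[\mathrm{tr}(\Sigma_l\Sigma_d)\,\mathrm{tr}(\Sigma_l\Sigma_h)]$ for $d,l,h\in\{1,\dots,k\}$; (e)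 $(\mu_d-\mu_l)'\Sigma_d(\mu_d-\mu_h)=o\big[n^{-1}\mathrm{tr}\{(\sum_{i=1}^k\Sigma_i)^2\}\big]$ for $d,l,h\in\{1,\dots,k\}$. Define $$T_n^{(k)}=\sum_{1\le i<j\le k}(\bar X_i-\bar X_j)'(\bar X_i-\bar X_j)-(k-1)\sum_{i=1}^k n_i^{-1}\,\mathrm{tr}\,S_i .$$ Then, as $p\to\infty$ and $n\to\infty$, $$\frac{T_n^{(k)}-\sum_{1\le i<j\le k}\|\mu_i-\mu_j\|^2}{\sqrt{\mathrm{Var}(T_n^{(k)})}}\ \stackrel{d}{\to}\ N(0,1).$$
   Context: Prime denotes transpose, $\mathrm{tr}$ the trace, $\|\cdot\|$ the Euclidean norm, $I_m$ the $m\times m$ identity matrix, and $\stackrel{d}{\to}$ convergence in distribution. All random variables and parameters depend on $n$ (the subscript $n$ is omitted); the number of groups $k$ is fixed. The symbols $o$ refer to the limit $p\to\infty$, $n\to\infty$. The sample mean and sample covariance matrix of group $i$ are $$\bar X_i=\frac1{n_i}\sum_{j=1}^{n_i}X_{ij},\qquad S_i=\frac{1}{n_i-1}\sum_{j=1}^{n_i}(X_{ij}-\bar X_i)(X_{ij}-\bar X_i)'.$$ $\mathrm{Var}(T_n^{(k)})$ is the variance of the random variable $T_n^{(k)}$, understood to be positive so that the ratio is defined.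
   Formalization: The condition E(z_{ijl}^4) < ∞ is taken as a bound uniform in i, j, l and n; with mere finiteness for each n the claim fails (entries that are nonzero only with very small probability make T_n vanish with probability tending to 1). *)

(* Defs.v *)
From HB Require Import structures.
From mathcomp Require Import all_boot all_order all_algebra.
From mathcomp Require Import all_classical all_reals all_analysis.

Set Implicit Arguments.
Unset Strict Implicit.
Unset Printing Implicit Defensive.

Import Order.TTheory GRing.Theory Num.Theory.
Import numFieldNormedType.Exports.

Local Open Scope classical_set_scope.
Local Open Scope ring_scope.

(* A random vector is a random variable with values in [q.-tuple R], which the
   library equips with the product of the Borel sigma-algebras; [colv] is the
   same vector as a column, for matrix algebra. *)
Definition colv (R : realType) (q : nat) (v : q.-tuple R) : 'cV[R]_q :=
  \col_l tnth v l.

Definition mutually_independent (R : realType) (d : measure_display)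
    (T : measurableType d) (P : probability T R) (I : finType)
    (d' : measure_display) (U : I -> measurableType d')
    (X : forall i, T -> U i) : Prop :=
  forall (J : {set I}) (A : forall i, set (U i)),
    (forall i, measurable (A i)) ->
    P (\bigcap_(i in [set` J]) X i @^-1` A i)
    = (\prod_(i in J) P (X i @^-1` A i))%E.

(* A measure of the library is unconstrained outside the measurable sets, hence
   the restriction to measurable [A]. *)
Definition identically_distributed (R : realType) (d : measure_display)
    (T : measurableType d) (P : probability T R) (I : finType)
    (d' : measure_display) (U : measurableType d')
    (X : I -> {RV P >-> U}) : Prop :=
  forall (i j : I) (A : set U),
    measurable A -> distribution P (X i) A = distribution P (X j) A.

Definition iid (R : realType) (d : measure_display)
    (T : measurableType d) (P : probability T R) (I : finType)
    (d' : measure_display) (U : measurableType d')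
    (X : I -> {RV P >-> U}) : Prop :=
  mutually_independent P (fun i => X i : T -> U) /\ identically_distributed X.

(* The expectation and the covariance below are extended reals, so that both
   predicates also say that the moments involved are finite. *)
Definition has_mean (R : realType) (d : measure_display)
    (T : measurableType d) (P : probability T R) (q : nat)
    (X : T -> q.-tuple R) (mu : 'cV[R]_q) : Prop :=
  forall l : 'I_q, 'E_P[fun w => tnth (X w) l]%E = (mu l 0)%:E.

Definition has_covariance (R : realType) (d : measure_display)
    (T : measurableType d) (P : probability T R) (q : nat)
    (X : T -> q.-tuple R) (Sigma : 'M[R]_q) : Prop :=
  forall l1 l2 : 'I_q,
    covariance P (fun w => tnth (X w) l1) (fun w => tnth (X w) l2)
    = (Sigma l1 l2)%:E.

(* The product rule is required for the exponents whose one-coordinate moments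
   exist: the library's integral is total, and its value on a non-integrable
   function of varying sign is meaningless. *)
Definition product_moments (R : realType) (d : measure_display)
    (T : measurableType d) (P : probability T R) (q : nat)
    (Z : T -> q.-tuple R) (D : nat) : Prop :=
  forall (s : nat) (l : 'I_s -> 'I_q) (alpha : 'I_s -> nat),
    (0 < s)%N -> injective l -> (forall a, (0 < alpha a)%N) ->
    (\sum_(a < s) alpha a <= D)%N ->
    (forall a, P.-integrable setT
       (fun w => (tnth (Z w) (l a) ^+ alpha a)%:E)) ->
    'E_P[fun w => (\prod_(a < s) tnth (Z w) (l a) ^+ alpha a)%R]%E
    = (\prod_(a < s) 'E_P[fun w => (tnth (Z w) (l a) ^+ alpha a)%R])%E.

Definition sample_mean (R : realType) (p n : nat) (x : 'I_n -> 'cV[R]_p) :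
    'cV[R]_p :=
  n%:R^-1 *: \sum_(j < n) x j.

Definition sample_cov (R : realType) (p n : nat) (x : 'I_n -> 'cV[R]_p) :
    'M[R]_p :=
  (n%:R - 1)^-1 *:
    \sum_(j < n) (x j - sample_mean x) *m (x j - sample_mean x)^T.

(* The norm [`|v|] of the library on matrices is the sup norm. *)
Definition euclidean_norm (R : realType) (p : nat) (v : 'cV[R]_p) : R :=
  Num.sqrt (\sum_(l < p) v l 0 ^+ 2).

Definition T_stat (R : realType) (k p : nat) (N : 'I_k -> nat)
    (x : forall i, 'I_(N i) -> 'cV[R]_p) : R :=
  \sum_(i < k) \sum_(j < k | (i < j)%N)
    ((sample_mean (x i) - sample_mean (x j))^T
       *m (sample_mean (x i) - sample_mean (x j))) 0 0
  - (k%:R - 1) * \sum_(i < k) (N i)%:R^-1 * \tr (sample_cov (x i)).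

(* Pointwise convergence of the distribution functions at the continuity points
   of the limit one; the variables may live on different spaces. *)
Definition cvg_in_distribution (R : realType) (d : nat -> measure_display)
    (T : forall r, measurableType (d r)) (P : forall r, probability (T r) R)
    (W : forall r, T r -> R)
    (Q : probability (measurableTypeR R) R) : Prop :=
  forall x : R, {for x, continuous (fun y : R => Q `]-oo, y]%classic)} ->
    (P r (W r @^-1` `]-oo, x]%classic) @[r --> \oo] --> Q `]-oo, x]%classic)%E.

(* Main.v *)
(* The index (i, j) runs over all observations, Y = X - mu, and the centered
   statistic splits as T0 + L, where T0 = (1/2) sum_{a,b} c_ab Y_a . Y_b has
   c_aa = 0 (the correction by tr S_i removes exactly the diagonal terms) and L
   is linear in the Y_a, negligible by (e).  Let s^2 = Var T.  The normal limit
   of W = T0 / s comes from Stein's method.  With G_a = sum_b c_ab Y_b / s and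
   W_a = Y_a . G_a, the rest W - W_a does not involve Y_a, so that
     E[W f(W)] = (1/2) sum_a E[W_a (f(W) - f(W - W_a))]
   is close to (1/2) sum_a E[q_a f'(W)] for q_a = G_a' Sigma_a G_a, and
   (1/2) sum_a q_a concentrates at 1: its off-diagonal part has a small variance
   by (d), its diagonal part because no observation has much weight, by (c). *)
Require Import Defs.
From mathcomp Require Import all_boot all_order all_algebra.
From mathcomp Require Import all_classical all_reals all_analysis.
From mathcomp Require Import measurable_realfun.
From mathcomp Require Import ring lra.

Set Implicit Arguments.
Unset Strict Implicit.
Unset Printing Implicit Defensive.

Import Order.TTheory GRing.Theory Num.Theory.
Import numFieldNormedType.Exports.

Local Open Scope classical_set_scope.
Local Open Scope ring_scope.

(** * Stein's equation for the standard normal law *)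

(** What is bounded uniformly in the index is the fourth moment of the coordinates of Z, while p and
    m vary freely. So everything rests on comparing E(Y_a . g)^4 with the square of a second moment:
    linear forms in Z_a satisfy this with the constant 3 C, whatever m is, and it passes to W_a,
    which is linear in Y_a once G_a is frozen. The cubic remainders of Stein's identity are split by
    a weight lam: |W_a|^3 and |W_a q_a| cost lam times second moments, which sum to O(1), plus 1 /
    lam times fourth-order moments, which sum to O(1/n). A fixed small lam suffices once lam^2 n >=
    1. In the variance of the sum of the q_a, Cauchy-Schwarz over the n observations is affordable
    off the diagonal, where (d) supplies a small factor and the squares of E q_a sum to O(1/n); on
    the diagonal, Minkowski's inequality avoids the factor n. As no rate is asked for, indicators
    are replaced by ramps, whose Stein solutions have bounded Lipschitz derivatives; the constants
    depend on the ramp only, so the ramp is fixed before the index grows. *)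

Section standard_normal.
Context {R : realType}.
Notation mu := (@lebesgue_measure R).

Definition std_pdf : R -> R := normal_pdf 0 1.

Definition std_cdf (x : R) : R := \int[mu]_(t in `]-oo, x]) std_pdf t.

Lemma std_pdfE x : std_pdf x = normal_peak 1 * expR (- x ^+ 2 / 2).
Proof. by rewrite /std_pdf normal_pdfE// /normal_fun subr0 expr1n. Qed.

Lemma std_pdf_gt0 x : 0 < std_pdf x.
Proof. by rewrite std_pdfE mulr_gt0 ?expR_gt0// normal_peak_gt0. Qed.

Lemma is_derive_std_pdf (x : R) : is_derive x 1 std_pdf (- x * std_pdf x).
Proof.
have -> : std_pdf = fun x : R => normal_peak 1 * expR (- x ^+ 2 / 2).
  by apply/funext => y; exact: std_pdfE.
apply: is_derive_eq.
rewrite /GRing.scale /=; by field.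
Qed.

Lemma continuous_std_pdf : continuous std_pdf.
Proof. exact: continuous_normal_pdf. Qed.

Lemma integrable_weighted_std_pdf (g : R -> R) :
  measurable_fun setT g -> (forall x, `|g x| <= 1) ->
  mu.-integrable setT (EFin \o (fun x => g x * std_pdf x)).
Proof.
move=> mg g1; apply: (le_integrable _ _ _ (integrable_normal_pdf 0 1)) => //.
  apply/measurable_EFinP/measurable_funM => //; exact: measurable_normal_pdf.
move=> x _ /=; rewrite lee_fin normrM.
by rewrite ler_piMl.
Qed.

(** The weight serves twice: [g = 1] gives the derivative of [std_cdf], and a test function [h]
    gives that of the numerator of the Stein solution. *)
Lemma is_derive_weighted_cdf (g : R -> R) (x : R) :
  continuous g -> (forall x, `|g x| <= 1) ->
  is_derive x 1 (fun y => \int[mu]_(t in `]-oo, y]) (g t * std_pdf t))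
    (g x * std_pdf x).
Proof.
move=> cg g1.
have ig : mu.-integrable setT (EFin \o (fun x => g x * std_pdf x)).
  apply: integrable_weighted_std_pdf => //; exact: continuous_measurable_fun.
have xx1 : x < x + 1 by rewrite ltrDl.
have ig1 : mu.-integrable `]-oo, x + 1] (EFin \o (fun x => g x * std_pdf x)).
  exact: integrableS ig.
have cgp : {for x, continuous (fun x => g x * std_pdf x)}.
  by apply: cvgM; [exact: cg|exact: continuous_std_pdf].
have [dF F'] := continuous_FTC1 xx1 ig1 (ltNyr _) cgp.
rewrite derive1E in F'; exact: DeriveDef.
Qed.

Lemma is_derive_std_cdf (x : R) : is_derive x 1 std_cdf (std_pdf x).
Proof.
have := @is_derive_weighted_cdf (cst 1) x.
rewrite /= mul1r; under eq_fun do under eq_Rintegral do rewrite mul1r.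
by apply => [y|y]; [exact: cvg_cst|rewrite normr1].
Qed.

Lemma std_cdf_prob x : normal_prob 0 1 `]-oo, x] = (std_cdf x)%:E.
Proof.
rewrite /std_cdf /Rintegral fineK//.
apply: integrable_fin_num => //.
apply: integrableS (integrable_normal_pdf 0 1) => //.
Qed.

Lemma std_cdf_ge0 x : 0 <= std_cdf x.
Proof. by rewrite -lee_fin -std_cdf_prob. Qed.

Lemma std_cdf_le1 x : std_cdf x <= 1.
Proof. by rewrite -lee_fin -std_cdf_prob probability_le1. Qed.

(** The identity is a random variable on the line under the normal law, and [std_cdf] is its
    distribution function, so the general limits of distribution functions apply. *)
Lemma cvg_std_cdfy : std_cdf x @[x --> +oo] --> (1 : R).
Proof.
have mid : measurable_fun setT (idfun : measurableTypeR R -> R).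
  exact: measurable_id.
pose X : {RV (normal_prob (0 : R) 1) >-> R} :=
  MeasurableFun.Pack (MeasurableFun.Class (isMeasurableFun.Build _ _ _ _ _ mid)).
have := cvg_cdfy1 X.
rewrite (_ : cdf _ = EFin \o std_cdf); last first.
  by apply/funext => x /=; rewrite -std_cdf_prob.
by move/fine_cvgP => [].
Qed.

Lemma cvg_std_cdfNy : std_cdf x @[x --> -oo] --> (0 : R).
Proof.
have mid : measurable_fun setT (idfun : measurableTypeR R -> R).
  exact: measurable_id.
pose X : {RV (normal_prob (0 : R) 1) >-> R} :=
  MeasurableFun.Pack (MeasurableFun.Class (isMeasurableFun.Build _ _ _ _ _ mid)).
have := cvg_cdfNy0 X.
rewrite (_ : cdf _ = EFin \o std_cdf); last first.
  by apply/funext => x /=; rewrite -std_cdf_prob.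
by move/fine_cvgP => [].
Qed.

Lemma continuous_std_cdf : continuous std_cdf.
Proof.
move=> x; apply/differentiable_continuous/derivable1_diffP.
by have := is_derive_std_cdf x => -[].
Qed.

(** The sum of the values at y and - y has zero derivative, hence is constant, and it tends to 1 at
    infinity. *)
Lemma std_cdfN (x : R) : std_cdf (- x) = 1 - std_cdf x.
Proof.
pose S := fun y => std_cdf y + std_cdf (- y).
have dS (y : R) : is_derive y 1 S 0.
  have := is_derive_std_cdf (- y); have := is_derive_std_cdf y => d1 d2.
  have d3 := @is_derive1_comp _ std_cdf -%R y _ _ d2 (is_deriveNid _ _).
  apply: is_derive_eq.
  by rewrite !std_pdfE sqrrN mulrN1 subrr.
have SE y : S y = S x by exact: is_derive_0_is_cst.
have S1 : S y @[y --> +oo] --> (1 + 0 : R).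
  apply: cvgD; first exact: cvg_std_cdfy.
  have := cvg_std_cdfNy.
  by rewrite cvgNy_compNP.
have : S y @[y --> +oo] --> S x.
  by under eq_fun do rewrite SE; exact: cvg_cst.
move=> /(cvg_unique _ S1); rewrite addr0 => /(_ (@Rhausdorff _)) ->.
by rewrite /S addrC addKr.
Qed.

(** Each Mills ratio bound below compares two functions that vanish at infinity; this reduces it to
    the sign of a derivative. *)
Lemma ge0_of_derive_le0_cvg0 (g dg : R -> R) (a : R) :
  (forall x, a <= x -> is_derive x 1 g (dg x)) ->
  (forall x, a <= x -> dg x <= 0) ->
  g x @[x --> +oo] --> (0 : R) -> forall x, a <= x -> 0 <= g x.
Proof.
move=> dgE dg0 g0 x ax.
have gx y : x <= y -> g y <= g x.
  apply: (@ler0_derive1_nincry _ g a) => //.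
  - by move=> z; rewrite in_itv/= andbT => /ltW /dgE[].
  - move=> z; rewrite in_itv/= andbT => /ltW az.
    by have [_ dE] := dgE _ az; rewrite derive1E dE dg0.
  - apply: continuous_in_subspaceT => z; rewrite inE/= in_itv/= andbT => az.
    by apply/differentiable_continuous/derivable1_diffP; have [] := dgE _ az.
rewrite -(cvg_lim (@Rhausdorff _) g0); apply: limr_le.
  by apply/cvg_ex; exists 0.
by near=> y; apply: gx; near: y; apply: nbhs_pinfty_ge; exact: num_real.
Unshelve. all: by end_near. Qed.

Lemma cvg_std_pdf_div : std_pdf x / x @[x --> +oo] --> (0 : R).
Proof.
apply: (@squeeze_cvgr _ _ _ _ (cst 0) (fun y => normal_peak 1 * y^-1)); last 2 first.
- exact: cvg_cst.
- rewrite -(mulr0 (normal_peak 1)); apply: cvgMr.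
  apply/gtr0_cvgV0; last exact: cvg_id.
  by apply: nbhs_pinfty_gt; exact: num_real.
near=> y; have y0 : 0 < y by near: y; apply: nbhs_pinfty_gt; exact: num_real.
rewrite /= divr_ge0 ?(ltW (std_pdf_gt0 _)) ?(ltW y0)//=.
by rewrite ler_pM2r ?invr_gt0// normal_pdf_ub.
Unshelve. all: by end_near. Qed.

Lemma mills_ub (x : R) : 0 < x -> x * (1 - std_cdf x) <= std_pdf x.
Proof.
move=> x0; rewrite mulrC -ler_pdivlMr// -subr_ge0.
pose dg (y : R) := - (std_pdf y / y ^+ 2).
apply: (@ge0_of_derive_le0_cvg0 (fun y => std_pdf y / y - (1 - std_cdf y)) dg x) => //.
- move=> y xy; have y0 : y != 0 by rewrite gt_eqF// (lt_le_trans x0).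
  have d1 := is_derive_std_pdf y; have d2 := is_derive_std_cdf y.
  have d3 : is_derive y 1 (fun y : R => y^-1) (- y ^- 2 *: 1) by apply: is_deriveV.
  apply: is_derive_eq; rewrite /dg /GRing.scale /=; field.
  exact: y0.
- by move=> y xy; rewrite oppr_le0 divr_ge0 ?sqr_ge0// ltW// std_pdf_gt0.
- rewrite -[X in _ --> X]subr0; apply: cvgB; first exact: cvg_std_pdf_div.
  rewrite -(subrr 1); apply: cvgB; [exact: cvg_cst|exact: cvg_std_cdfy].
Qed.

(** Needed for the second-order behaviour of the Stein solution f: in the tails, the derivative of x
    f(x) is, up to sign and a factor in [0, 1], the quantity [(1 + y ^+ 2) * mills y - y], which
    this bound shows to be nonnegative. *)
Lemma mills_lb (x : R) : 0 < x -> x * std_pdf x <= (1 + x ^+ 2) * (1 - std_cdf x).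
Proof.
move=> x0.
have p (y : R) : 0 < 1 + y ^+ 2 by rewrite ltr_pwDl ?sqr_ge0.
rewrite [leRHS]mulrC -ler_pdivrMr// -subr_ge0.
pose dg (y : R) := - (2 * std_pdf y / (1 + y ^+ 2) ^+ 2).
apply: (@ge0_of_derive_le0_cvg0 (fun y => 1 - std_cdf y - y * std_pdf y / (1 + y ^+ 2)) dg x) => //.
- move=> y xy; have y0 : y != 0 by rewrite gt_eqF// (lt_le_trans x0).
  have d1 := is_derive_std_pdf y; have d2 := is_derive_std_cdf y.
  have d3 : is_derive y 1 (fun y : R => (1 + y ^+ 2)^-1) (- (1 + y ^+ 2) ^- 2 *: (2 * y)).
    apply: is_deriveV; first by rewrite gt_eqF.
    by apply: is_derive_eq; rewrite /GRing.scale /=; ring.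
  apply: is_derive_eq; rewrite /dg /GRing.scale /=; field.
  by rewrite gt_eqF.
- by move=> y xy; rewrite oppr_le0 divr_ge0 ?sqr_ge0// mulr_ge0// ltW// std_pdf_gt0.
- rewrite -[X in _ --> X]subr0; apply: cvgB.
    rewrite -(subrr 1); apply: cvgB; [exact: cvg_cst|exact: cvg_std_cdfy].
  apply: (@squeeze_cvgr _ _ _ _ (cst 0) (fun y => std_pdf y / y)); last 2 first.
  + exact: cvg_cst.
  + exact: cvg_std_pdf_div.
  + near=> y; have y0 : 0 < y by near: y; apply: nbhs_pinfty_gt; exact: num_real.
    have py := ltW (std_pdf_gt0 y).
    rewrite /= divr_ge0 ?mulr_ge0 ?(ltW (p y)) ?(ltW y0)//=.
    rewrite ler_pdivrMr// mulrAC ler_pdivlMr// -mulrA mulrCA ler_wpM2l//.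
    by rewrite -expr2 lerDr.
Unshelve. all: by end_near. Qed.

Lemma bounded_of_tails (u : R -> R) (A B : R) : continuous u ->
  (forall x, A < `|x| -> `|u x| <= B) -> exists2 K, 0 <= K & forall x, `|u x| <= K.
Proof.
move=> cu uB.
have cu' : {within `[- `|A|, `|A|], continuous (fun x => `|u x|)}.
  apply: continuous_subspaceT => x.
  by apply: cvg_norm; exact: cu.
have AA : - `|A| <= `|A| by rewrite (le_trans _ (normr_ge0 A))// oppr_le0.
have [c _ uc] := EVT_max AA cu'.
exists (`|u c| + `|B|) => [|x]; first by rewrite addr_ge0.
have [xA|Ax] := leP `|x| `|A|.
  by rewrite (le_trans (uc x _)) ?lerDl// in_itv/= -ler_norml.
rewrite (le_trans (uB x _)) ?(le_lt_trans (ler_norm _) Ax)//.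
by rewrite (le_trans (ler_norm _))// lerDr.
Qed.

Lemma lipschitz_of_derive_bounded (u du : R -> R) (K : R) :
  (forall x : R, is_derive x 1 u (du x)) -> (forall x, `|du x| <= K) ->
  forall x y, `|u x - u y| <= K * `|x - y|.
Proof.
move=> du1 duK x y; wlog yx : x y / y <= x.
  by move=> H; have [/H//|/ltW/H] := leP y x; rewrite distrC (distrC x).
have cu : {within `[y, x], continuous u}.
  apply: continuous_subspaceT => z.
  by apply/differentiable_continuous/derivable1_diffP; have [] := du1 z.
have [c _ ->] := MVT_segment yx (fun z _ => du1 z) cu.
by rewrite normrM ler_wpM2r.
Qed.

Lemma lipschitz_continuous (u : R -> R) (L : R) :
  (forall x y, `|u x - u y| <= L * `|x - y|) -> continuous u.
Proof.
move=> uL x; apply/cvgrPdist_lt => e e0.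
have d0 : 0 < e / (`|L| + 1) by rewrite divr_gt0// ltr_wpDl.
near=> y; rewrite (le_lt_trans (uL x y))//.
have : `|x - y| < e / (`|L| + 1).
  by near: y; exists (e / (`|L| + 1)).
rewrite ltr_pdivlMr ?ltr_wpDl// => /(le_lt_trans _); apply.
by rewrite mulrC ler_wpM2l// (le_trans (ler_norm L))// lerDl.
Unshelve. all: by end_near. Qed.

(** The test functions are only Lipschitz, so the derivative of a Stein solution is Lipschitz but
    need not be differentiable. The mean value theorem gives the constant K, which is good
    enough. *)
Lemma taylor_lipschitz (u du : R -> R) (K : R) :
  (forall x : R, is_derive x 1 u (du x)) ->
  (forall x y, `|du x - du y| <= K * `|x - y|) ->
  forall x y, `|u y - u x - (y - x) * du x| <= K * (y - x) ^+ 2.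
Proof.
move=> du1 duK x y.
have cu a b : {within `[a, b], continuous u}.
  apply: continuous_subspaceT => z.
  by apply/differentiable_continuous/derivable1_diffP; have [] := du1 z.
have [z zxy ->] : exists2 z, `|z - x| <= `|y - x| & u y - u x = du z * (y - x).
  have [xy|/ltW yx] := leP x y.
    have [z /[!in_itv]/= /andP[xz zy] ->] := MVT_segment xy (fun z _ => du1 z) (cu _ _).
    by exists z => //; rewrite !ger0_norm ?subr_ge0// lerB.
  have [z /[!in_itv]/= /andP[yz zx] E] := MVT_segment yx (fun z _ => du1 z) (cu _ _).
  exists z; last by rewrite -opprB E; ring.
  by rewrite distrC (distrC y) !ger0_norm ?subr_ge0// lerB.
have -> : du z * (y - x) - (y - x) * du x = (du z - du x) * (y - x) by ring.
rewrite normrM -(real_normK (num_real (y - x))) expr2 mulrA ler_wpM2r//.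
have K0 : 0 <= K by have := le_trans (normr_ge0 _) (duK 0 1); rewrite sub0r normrN1 mulr1.
by rewrite (le_trans (duK _ _))// ler_wpM2l.
Qed.

Section stein_equation.
Variables (h : R -> R) (L a b : R).
Hypotheses (ab : a <= b) (h01 : forall x, 0 <= h x <= 1)
  (hL : forall x y, `|h x - h y| <= L * `|x - y|)
  (h1 : forall x, x <= a -> h x = 1) (h0 : forall x, b <= x -> h x = 0).

Let continuous_h : continuous h.
Proof.
exact: lipschitz_continuous hL.
Qed.

Let h_le1 x : `|h x| <= 1.
Proof. by have /andP[hx0 hx1] := h01 x; rewrite ger0_norm. Qed.

Let H x := \int[mu]_(t in `]-oo, x]) (h t * std_pdf t).

Let integrable_h D : measurable D -> mu.-integrable D (EFin \o (fun x => h x * std_pdf x)).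
Proof.
move=> mD; apply: (@integrableS _ _ _ mu setT) => //.
apply: integrable_weighted_std_pdf h_le1.
apply: continuous_measurable_fun; exact: continuous_h.
Qed.

Let HB x y : x <= y -> H y = H x + \int[mu]_(t in `]x, y]) (h t * std_pdf t).
Proof.
move=> xy; have iy : mu.-integrable `]-oo, y] (EFin \o (fun x => h x * std_pdf x)).
  exact: integrable_h.
have E := Rintegral_itvB iy (isT : (-oo <= BRight x)%O) (xy : (BRight x <= BRight y)%O).
by rewrite -E [RHS]addrC subrK.
Qed.

Let c := H b.

Let Ha x : x <= a -> H x = std_cdf x.
Proof.
move=> xa; apply: eq_Rintegral => t; rewrite inE/= in_itv/= => tx.
by rewrite h1 ?mul1r// (le_trans tx).
Qed.

Let Hb x : b <= x -> H x = c.
Proof.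
move=> bx; rewrite (HB bx) (_ : Rintegral _ _ _ = 0) ?addr0//.
rewrite (@eq_Rintegral _ _ _ mu _ (cst 0)) ?Rintegral_cst ?mul0r// => t.
by rewrite inE/= in_itv/= => /andP[bt _]; rewrite h0 ?mul0r// ltW.
Qed.

Let c_bounds : std_cdf a <= c <= std_cdf b.
Proof.
apply/andP; split.
  rewrite -Ha// /c (HB ab) lerDl; apply: Rintegral_ge0 => t _.
  by rewrite mulr_ge0 ?(ltW (std_pdf_gt0 _))//; have /andP[] := h01 t.
apply: le_Rintegral => //.
- exact: integrable_h.
- exact: integrableS (integrable_normal_pdf 0 1).
- move=> t _; rewrite ler_piMl ?(ltW (std_pdf_gt0 _))//; by have /andP[] := h01 t.
Qed.

(** The classical solution of f'(x) - x f(x) = h(x) - c: the integral of (h - c) times the density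
    up to x, divided by the density at x. *)
Let f x := (H x - c * std_cdf x) / std_pdf x.

Let f' x := x * f x + (h x - c).

Let is_derive_f (x : R) : is_derive x 1 f (f' x).
Proof.
have d1 := is_derive_std_pdf x; have d2 := is_derive_std_cdf x.
have d0 : is_derive x 1 H (h x * std_pdf x) by exact: (is_derive_weighted_cdf x continuous_h h_le1).
have p0 : std_pdf x != 0 by rewrite gt_eqF// std_pdf_gt0.
have d3 : is_derive x 1 (fun y => (std_pdf y)^-1) (- (std_pdf x) ^- 2 *: (- x * std_pdf x)) by apply: is_deriveV.
apply: is_derive_eq; rewrite /f' /f /GRing.scale /=; field.
exact: p0.
Qed.

Let f_right x : b <= x -> f x = c * ((1 - std_cdf x) / std_pdf x).
Proof. by move=> bx; rewrite /f Hb// mulrA mulrBr mulr1. Qed.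

Let f_left x : x <= a -> f x = (1 - c) * ((1 - std_cdf (- x)) / std_pdf (- x)).
Proof.
have pN : std_pdf (- x) = std_pdf x by rewrite !std_pdfE sqrrN.
by move=> xa; rewrite /f Ha// std_cdfN pN; ring.
Qed.

Let mills x := (1 - std_cdf x) / std_pdf x.

Let mills_bounds x : 1 <= x ->
  [/\ 0 <= mills x, mills x <= 1, x * mills x <= 1 & 0 <= (1 + x ^+ 2) * mills x - x <= 1].
Proof.
move=> x1; have x0 : 0 < x by rewrite (lt_le_trans ltr01).
have p0 := std_pdf_gt0 x.
have M0 : 0 <= mills x by rewrite divr_ge0 ?(ltW p0)// subr_ge0 std_cdf_le1.
have M1 : x * mills x <= 1 by rewrite mulrA ler_pdivrMr// mul1r mills_ub.
have M2 : x <= (1 + x ^+ 2) * mills x by rewrite mulrA ler_pdivlMr// mills_lb.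
by split; nra.
Qed.

(* [c] is the mean of [h] under the normal law; outside [a, b] the solution is a
   multiple of the Mills ratio, whence the bounds. *)
Lemma stein_solution : exists (f : R -> R) (c K : R), 0 <= K /\
  [/\ std_cdf a <= c <= std_cdf b,
    forall x : R, is_derive x 1 f (x * f x + (h x - c)),
    forall x, `|f x| <= K,
    forall x, `|x * f x + (h x - c)| <= K &
    forall x y, `|x * f x + (h x - c) - (y * f y + (h y - c))| <= K * `|x - y|].
Proof.
have c0 : 0 <= c by have /andP[+ _] := c_bounds; apply: le_trans; exact: std_cdf_ge0.
have c1 : c <= 1 by have /andP[_ /le_trans] := c_bounds; apply; exact: std_cdf_le1.
have cf : continuous f.
  by move=> x; apply/differentiable_continuous/derivable1_diffP; have [] := is_derive_f x.
have cid : continuous (@id R) by move=> x; exact: cvg_id.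
have cxf : continuous (fun x : R => x * f x) by move=> x; apply: cvgM; [exact: cid|exact: cf].
have cf' : continuous f'.
  move=> x; apply: cvgD; first exact: cxf.
  by apply: cvgB; [exact: continuous_h|exact: cvg_cst].
have dxf (x : R) : is_derive x 1 (fun x : R => x * f x) (f x + x * f' x).
  have := is_derive_f x => d; apply: is_derive_eq; rewrite /GRing.scale /=; ring.
pose A := 1 + `|a| + `|b|.
(* Reflection treats both tails at once: y is the absolute value of x, and e is c on the right and 1
   - c on the left. *)
have tail x : A < `|x| -> exists y e, [/\ 1 <= y, 0 <= e, e <= 1 &
   [/\ f x = e * mills y, `|x * f x| = e * (y * mills y) &
    `|f x + x * f' x| = e * ((1 + y ^+ 2) * mills y - y)]].
  rewrite /A => Ax; have := ler_norm b; have := lerNnormlW (lexx `|a|) => aA bA.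
  have a0 := normr_ge0 a; have b0 := normr_ge0 b.
  have [x0|x0] := leP 0 x.
    move: Ax; rewrite (ger0_norm x0) => Ax; exists x, c.
    have x1 : 1 <= x by lra.
    have [M0 M1 M2 /andP[M3 M4]] := mills_bounds x1.
    have fE : f x = c * mills x by rewrite f_right//; lra.
    have h00 : h x = 0 by apply: h0; lra.
    have xM0 := mulr_ge0 x0 M0.
    split => //; split => //; first by rewrite fE mulrCA ger0_norm// mulr_ge0.
    rewrite /f' h00 fE (_ : _ + _ = c * ((1 + x ^+ 2) * mills x - x)); last by ring.
    by rewrite ger0_norm// mulr_ge0.
  move: Ax; rewrite (ltr0_norm x0) => Ax; exists (- x), (1 - c).
  have x1 : 1 <= - x by lra.
  have [M0 M1 M2 /andP[M3 M4]] := mills_bounds x1.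
  have fE : f x = (1 - c) * mills (- x) by rewrite f_left//; lra.
  have h11 : h x = 1 by apply: h1; lra.
  have c10 : 0 <= 1 - c by lra.
  split => //; [by lra|split => //].
    have xM0 : 0 <= - x * mills (- x) by rewrite mulr_ge0// (le_trans _ x1).
    by rewrite fE -normrN -mulNr mulrCA ger0_norm// mulr_ge0.
  have -> : f x + x * f' x = (1 - c) * ((1 + (- x) ^+ 2) * mills (- x) - - x).
    by rewrite /f' h11 fE; move: (mills _) => M; ring.
  by rewrite ger0_norm// mulr_ge0.
have [K1 K10 fK1] : exists2 K, 0 <= K & forall x, `|f x| <= K.
  apply: (@bounded_of_tails _ A 1) => // x /tail[y [e [y1 e0 e1 [-> _ _]]]].
  have [M0 M1 M2 /andP[M3 M4]] := mills_bounds y1.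
  by rewrite ger0_norm ?(mulr_ge0 e0 M0)// mulr_ile1.
have [K2 K20 fK2] : exists2 K, 0 <= K & forall x, `|x * f x| <= K.
  apply: (@bounded_of_tails _ A 1) => // x /tail[y [e [y1 e0 e1 [_ -> _]]]].
  have [M0 M1 M2 /andP[M3 M4]] := mills_bounds y1.
  by rewrite mulr_ile1 // mulr_ge0// (le_trans _ y1).
(* Since f' = x f + h - c and h is Lipschitz, it is enough to bound the derivative of x f(x); no
   second derivative of f is taken. *)
have [K3 K30 fK3] : exists2 K, 0 <= K & forall x, `|f x + x * f' x| <= K.
  apply: (@bounded_of_tails _ A 1).
    move=> x; apply: cvgD; first exact: cf.
    by apply: cvgM; [exact: cid|exact: cf'].
  move=> x /tail[y [e [y1 e0 e1 [_ _ ->]]]].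
  have [M0 M1 M2 /andP[M3 M4]] := mills_bounds y1.
  by rewrite mulr_ile1.
have L0 : 0 <= L by have := le_trans (normr_ge0 _) (hL 0 1); rewrite sub0r normrN1 mulr1.
exists f, c, (K1 + (K2 + 1) + (K3 + L)); split; first by rewrite !addr_ge0.
split => //.
- by move=> x; rewrite (le_trans (fK1 x))//; lra.
- move=> x; rewrite (le_trans (ler_normD _ _))//.
  have := fK2 x; suff : `|h x - c| <= 1 by lra.
  by have /andP[? ?] := h01 x; rewrite ler_norml; lra.
- move=> x y; rewrite (_ : _ - _ = (x * f x - y * f y) + (h x - h y)); last by ring.
  rewrite (le_trans (ler_normD _ _))//.
  have := lipschitz_of_derive_bounded dxf fK3 x y; have := hL x y.
  have := normr_ge0 (x - y); nra.
Qed.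

End stein_equation.

End standard_normal.

(** * Independence and expectations of products *)

Section independence.
Context d (T : measurableType d) (R : realType) (P : probability T R).

(** Measurability for the sigma-algebra generated by G. It expresses that a variable is a function
    of one observation, or of all the others. *)
Definition sub_measurable (G : set (set T)) (f : T -> R) :=
  measurable_fun [set: g_sigma_algebraType G] (f : g_sigma_algebraType G -> R).

Lemma g_sigma_measurable (G : set (set T)) A :
  G `<=` measurable -> <<s G >> A -> measurable A.
Proof. by move=> Gm; apply: smallest_sub => //; exact: sigma_algebra_measurable. Qed.

(** For fixed A, both sides are finite measures in B that agree on a pi-system generating the
    sigma-algebra, hence everywhere on it. *)
Lemma indep_g_sigma (G : set (set T)) (A : set T) :
  G `<=` measurable -> setI_closed G -> G setT -> measurable A ->
  (forall B, G B -> P (A `&` B) = P A * P B)%E ->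
  forall B, <<s G >> B -> (P (A `&` B) = P A * P B)%E.
Proof.
move=> Gm GI GT mA PAB B GB.
have PAfin : P A \is a fin_num by rewrite fin_num_measure.
pose r : {nonneg R} := NngNum (fine_ge0 (measure_ge0 P A)).
have cover : \bigcup_(k : nat) [set: T] = setT.
  by rewrite -subTset => x _; exists 0%N.
have := @g_sigma_algebra_measure_unique _ R T G Gm (fun=> setT) (fun=> GT)
  cover (mrestr P mA) (mscale r P) GI.
rewrite /= /mrestr /mscale /= fineK// => H.
rewrite setIC; apply: H => //.
- by move=> C GC; rewrite setIC PAB.
- by move=> _; rewrite setTI -ge0_fin_numE.
Qed.

Section product_rule.
Variables G1 G2 : set (set T).
Hypotheses (G1m : G1 `<=` measurable) (G2m : G2 `<=` measurable).
Hypotheses (G1I : setI_closed G1) (G2I : setI_closed G2).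
Hypotheses (G1T : G1 setT) (G2T : G2 setT).
Hypothesis PG : forall A B, G1 A -> G2 B -> (P (A `&` B) = P A * P B)%E.

Let T1 := g_sigma_algebraType G1.
Let T2 := g_sigma_algebraType G2.

Let PG' A B : <<s G1 >> A -> <<s G2 >> B -> (P (A `&` B) = P A * P B)%E.
Proof.
move=> GA GB; apply: (indep_g_sigma G2m) GB => //; first exact: g_sigma_measurable GA.
move=> C GC; rewrite setIC muleC; apply: (indep_g_sigma G1m) GA => //; first exact: G2m.
by move=> A' GA'; rewrite setIC muleC PG.
Qed.

Let m1 : measurable_fun setT (idfun : T -> T1).
Proof. by move=> _ A mA; rewrite setTI; exact: g_sigma_measurable mA. Qed.

Let m2 : measurable_fun setT (idfun : T -> T2).
Proof. by move=> _ A mA; rewrite setTI; exact: g_sigma_measurable mA. Qed.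

Let m12 : measurable_fun setT (fun x : T => (x : T1, x : T2)).
Proof. exact: measurable_fun_pair m1 m2. Qed.

Let X1 : {mfun T >-> T1} := MeasurableFun.Pack (MeasurableFun.Class (isMeasurableFun.Build _ _ _ _ _ m1)).
Let X2 : {mfun T >-> T2} := MeasurableFun.Pack (MeasurableFun.Class (isMeasurableFun.Build _ _ _ _ _ m2)).
Let X12 : {mfun T >-> (T1 * T2)%type} := MeasurableFun.Pack (MeasurableFun.Class (isMeasurableFun.Build _ _ _ _ _ m12)).

(** [X12] is the diagonal map into the product of the two sigma-algebras. Independence says that its
    law is the product measure, which reduces the product rule for U and V to Fubini's theorem. *)
Let joint_law A : measurable A ->
  (distribution P X1 \x distribution P X2)%E A = distribution P X12 A.
Proof.
apply: product_measure_unique => B C mB mC.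
by rewrite /distribution /pushforward /=; exact: PG'.
Qed.

Variables U V : T -> R.
Hypotheses (mU : sub_measurable G1 U) (mV : sub_measurable G2 V).

Let mUV : measurable_fun setT (fun z : T1 * T2 => (U z.1 * V z.2)%:E).
Proof.
apply/measurable_EFinP/measurable_funM.
  exact: measurableT_comp mU measurable_fst.
exact: measurableT_comp mV measurable_snd.
Qed.

Let integral_joint (f : T1 * T2 -> \bar R) : measurable_fun setT f ->
  (forall z, 0 <= f z)%E ->
  (\int[distribution P X1 \x distribution P X2]_z f z = \int[P]_x f (x, x))%E.
Proof.
move=> mf f0.
rewrite (eq_measure_integral (distribution P X12)); last by move=> A mA _; exact: joint_law.
by rewrite ge0_integral_distribution.
Qed.

Let integral_abs :
  (\int[P]_x `|(U x * V x)%:E| = \int[P]_x `|(U x)%:E| * \int[P]_x `|(V x)%:E|)%E.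
Proof.
have mabs : measurable_fun setT (fun z : T1 * T2 => `|(U z.1 * V z.2)%:E|)%E.
  exact: measurableT_comp.
rewrite -(integral_joint (f := fun z => `|(U z.1 * V z.2)%:E|)%E) //.
rewrite fubini_tonelli1//=.
rewrite /fubini_F /=.
have mV' : measurable_fun setT (fun y : T2 => `|(V y)%:E|)%E.
  by apply: measurableT_comp => //; exact/measurable_EFinP.
have mU' : measurable_fun setT (fun y : T1 => `|(U y)%:E|)%E.
  by apply: measurableT_comp => //; exact/measurable_EFinP.
have step x : (\int[distribution P X2]_y `|U x * V y|%:E =
    `|(U x)%:E| * \int[distribution P X2]_y `|(V y)%:E|)%E.
  under eq_integral do rewrite normrM EFinM.
  by rewrite -ge0_integralZl.
under eq_integral do rewrite step.
rewrite ge0_integralZr//=; last exact: integral_ge0.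
congr (_ * _)%E.
- exact: (@ge0_integral_distribution _ _ _ _ _ P X1 (fun y : T1 => `|(U y)%:E|)%E).
- exact: (@ge0_integral_distribution _ _ _ _ _ P X2 (fun y : T2 => `|(V y)%:E|)%E).
Qed.

Hypotheses (iU : P.-integrable setT (EFin \o U)) (iV : P.-integrable setT (EFin \o V)).

Lemma indep_integrableM : P.-integrable setT (EFin \o (fun x => U x * V x)).
Proof.
move/integrableP : (iU) => [mUT iU']; move/integrableP : (iV) => [mVT iV'].
apply/integrableP; split.
  by apply/measurable_EFinP/measurable_funM; exact/measurable_EFinP.
rewrite /= integral_abs lte_mul_pinfty//; first exact: integral_ge0.
by rewrite ge0_fin_numE// integral_ge0.
Qed.

Lemma indep_expectationM :
  \int[P]_x (U x * V x) = (\int[P]_x U x) * (\int[P]_x V x).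
Proof.
have iUV : (distribution P X1 \x distribution P X2)%E.-integrable setT
    (fun z : T1 * T2 => (U z.1 * V z.2)%:E).
  apply/integrableP; split => //.
  rewrite integral_joint//; last exact: measurableT_comp.
  by have /integrableP[] := indep_integrableM.
rewrite /Rintegral.
have -> : (\int[P]_x (U x * V x)%:E = \int[distribution P X1 \x distribution P X2]_z (U z.1 * V z.2)%:E)%E.
  rewrite (eq_measure_integral (distribution P X12)); last by move=> A mA _; exact: joint_law.
  rewrite integral_distribution//; exact: indep_integrableM.
rewrite -integral12_prod_meas1//= /fubini_F /=.
have iV2 : (distribution P X2).-integrable setT (EFin \o (V : T2 -> R)).
  by apply: integrable_pushforward => //; exact/measurable_EFinP.
have iU1 : (distribution P X1).-integrable setT (EFin \o (U : T1 -> R)).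
  by apply: integrable_pushforward => //; exact/measurable_EFinP.
have step x : (\int[distribution P X2]_y (U x * V y)%:E =
    (U x)%:E * \int[distribution P X2]_y (V y)%:E)%E.
  under eq_integral do rewrite EFinM.
  by rewrite -integralZl.
under eq_integral do rewrite step.
have -> : (\int[distribution P X2]_y (V y)%:E = \int[P]_y (V y)%:E)%E.
  by apply: (@integral_distribution _ _ _ _ _ P X2 (fun y : T2 => (V y)%:E)) => //; exact/measurable_EFinP.
have := integrable_fin_num measurableT iV; set v := (\int[P]_y (V y)%:E)%E => vfin.
rewrite -(fineK vfin) integralZr//= fineM//.
  congr (fine _ * _).
  by apply: (@integral_distribution _ _ _ _ _ P X1 (fun y : T1 => (U y)%:E)) => //; exact/measurable_EFinP.
exact: (integrable_fin_num _ iU1).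
Qed.

End product_rule.

Section family.
Context (I : finType) (d' : measure_display) (U : measurableType d') (X : I -> T -> U).
Hypothesis mX : forall a, measurable_fun setT (X a).
Hypothesis indepX : forall A : I -> set U, (forall a, measurable (A a)) ->
  P (\bigcap_(a in [set: I]) X a @^-1` A a) = (\prod_a P (X a @^-1` A a))%E.

Definition own_events (a : I) : set (set T) := [set X a @^-1` A | A in measurable].

(** Boxes rather than the full sigma-algebra: they form a pi-system on which the independence of the
    family can be applied directly. *)
Definition other_events (a : I) : set (set T) :=
  [set \bigcap_(b in [set b | b != a]) X b @^-1` B b | B in [set B | forall b, measurable (B b)]].

Let mpre b A : measurable A -> measurable (X b @^-1` A).
Proof. by move=> mA; rewrite -[_ @^-1` _]setTI; exact: mX. Qed.

Lemma own_events_measurable a : own_events a `<=` measurable.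
Proof. by move=> _ [A mA <-]; exact: mpre. Qed.

Lemma other_events_measurable a : other_events a `<=` measurable.
Proof.
move=> _ [B mB <-]; apply: fin_bigcap_measurable => [|b _]; last exact: mpre.
exact: finite_finset.
Qed.

Let own_setI a : setI_closed (own_events a).
Proof. by move=> _ _ [A mA <-] [B mB <-]; exists (A `&` B) => //; exact: measurableI. Qed.

Let other_setI a : setI_closed (other_events a).
Proof.
move=> _ _ [A mA <-] [B mB <-]; exists (fun b => A b `&` B b).
  by move=> b; apply: measurableI; [exact: mA|exact: mB].
by rewrite -bigcapI; apply: eq_bigcapr => b _; rewrite preimage_setI.
Qed.

Let own_setT a : own_events a setT.
Proof. by exists setT. Qed.

Let other_setT a : other_events a setT.
Proof.
exists (fun=> setT) => //; rewrite -subTset => x _ b _ //.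
Qed.

Let own_other a A B : own_events a A -> other_events a B ->
  (P (A `&` B) = P A * P B)%E.
Proof.
move=> [C mC <-] [D mD <-].
(* Filling the missing index a with C or with the whole space turns both events into boxes over all
   of I, where [indepX] applies. *)
pose E b := if b == a then C else D b.
pose F b := if b == a then setT else D b.
have mE b : measurable (E b) by rewrite /E; case: ifP.
have mF b : measurable (F b) by rewrite /F; case: ifP.
have -> : X a @^-1` C `&` \bigcap_(b in [set b | b != a]) X b @^-1` D b =
    \bigcap_(b in [set: I]) X b @^-1` E b.
  apply/seteqP; split => [x [xC xD] b _|x xE]; rewrite /E /=.
    by case: eqVneq => [->//|ba]; exact: xD.
  split; first by have := xE a Logic.I; rewrite /E /= eqxx.
  by move=> b /= ba; have := xE b Logic.I; rewrite /E /= (negbTE ba).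
have -> : \bigcap_(b in [set b | b != a]) X b @^-1` D b =
    \bigcap_(b in [set: I]) X b @^-1` F b.
  apply/seteqP; split => [x xD b _|x xE b /= ba]; rewrite /F /=.
    by case: eqVneq => // ba; exact: xD.
  by have := xE b Logic.I; rewrite /F /= (negbTE ba).
rewrite !indepX// (bigD1 a)//= [in RHS](bigD1 a)//= /E /F eqxx preimage_setT.
rewrite probability_setT mul1e; congr (_ * _)%E.
by apply: eq_bigr => b ba; rewrite (negbTE ba).
Qed.

Lemma own_sub_measurable a (f : U -> R) : measurable_fun setT f ->
  sub_measurable (own_events a) (f \o X a).
Proof.
move=> mf _ A mA; rewrite setTI; apply: sub_sigma_algebra.
exists (f @^-1` A) => //; rewrite -[_ @^-1` _]setTI; exact: mf.
Qed.

Lemma other_sub_measurable a b (f : U -> R) : b != a -> measurable_fun setT f ->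
  sub_measurable (other_events a) (f \o X b).
Proof.
move=> ba mf _ A mA; rewrite setTI; apply: sub_sigma_algebra.
exists (fun c => if c == b then f @^-1` A else setT).
  move=> c; case: ifP => // _; rewrite -[_ @^-1` _]setTI; exact: mf.
apply/seteqP; split => [x /(_ b ba)|x xA c _ /=]; first by rewrite /= eqxx.
by case: eqVneq => // ->.
Qed.

Lemma own_other_product (a : I) (V W : T -> R) :
  sub_measurable (own_events a) V -> sub_measurable (other_events a) W ->
  P.-integrable setT (EFin \o V) -> P.-integrable setT (EFin \o W) ->
  P.-integrable setT (EFin \o (fun x => V x * W x)) /\
  \int[P]_x (V x * W x) = (\int[P]_x V x) * (\int[P]_x W x).
Proof.
move=> mV mW iV iW.
have om := @own_events_measurable a; have tm := @other_events_measurable a.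
have PG A B := @own_other a A B.
split.
- exact: (indep_integrableM om tm (@own_setI a) (@other_setI a) (own_setT a) (other_setT a) PG mV mW).
- exact: (indep_expectationM om tm (@own_setI a) (@other_setI a) (own_setT a) (other_setT a) PG mV mW).
Qed.

End family.
End independence.

Section grouped_families.
Context (R : realType) (d : measure_display) (T : measurableType d) (P : probability T R).
Context (k : nat) (N : 'I_k -> nat) (d' : measure_display) (U : measurableType d').
Variable X : forall i, 'I_(N i) -> {RV P >-> U}.
Hypothesis within : forall i, mutually_independent P (fun j => X j : T -> U) (I := 'I_(N i)).
Hypothesis between : mutually_independent P
  (fun (i : 'I_k) (w : T) => [tuple (X j w) | j < N i]).

(** Independence of the groups, taken as tuples, splits the event into one box per group;
    independence within each group then splits every box. *)
Lemma grouped_independent (A : {i : 'I_k & 'I_(N i)} -> set U) :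
  (forall a, measurable (A a)) ->
  P (\bigcap_(a in [set: {i : 'I_k & 'I_(N i)}]) (X (tagged a) @^-1` A a)) =
  (\prod_a P (X (tagged a) @^-1` A a))%E.
Proof.
move=> mA.
pose B (i : 'I_k) : set ((N i).-tuple U) := [set t | forall j, A (Tagged (fun i => 'I_(N i)) j) (tnth t j)].
have mB i : measurable (B i).
  have -> : B i = \bigcap_(j in [set: 'I_(N i)]) ((@tnth _ _)^~ j @^-1` A (Tagged (fun i => 'I_(N i)) j)).
    by apply/seteqP; split => t /= tB j; [move=> _; exact: tB|exact: tB].
  apply: fin_bigcap_measurable => // j _; rewrite -[_ @^-1` _]setTI.
  exact: measurable_tnth.
have -> : \bigcap_(a in [set: {i : 'I_k & 'I_(N i)}]) (X (tagged a) @^-1` A a) =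
   \bigcap_(i in [set` [set: 'I_k]%SET]) ((fun w => [tuple (X j w) | j < N i]) @^-1` B i).
  apply/seteqP; split => [x xA i _ j /=|x xB [i j] _ /=].
    by rewrite tnth_mktuple; exact: (xA (Tagged (fun i => 'I_(N i)) j)).
  have iT : [set` [set: 'I_k]%SET] i by rewrite /= inE.
  by have := xB i iT j; rewrite /= tnth_mktuple.
rewrite between//.
rewrite (eq_bigr (fun i => \prod_(j < N i) P (X j @^-1` A (Tagged (fun i => 'I_(N i)) j)))%E); last first.
  move=> i _.
  have -> : (fun w => [tuple X j w | j < N i]) @^-1` B i =
      \bigcap_(j in [set` [set: 'I_(N i)]%SET]) (X j @^-1` A (Tagged (fun i => 'I_(N i)) j)).
    apply/seteqP; split => [x xB j _|x xA j].
      by have := xB j; rewrite /= tnth_mktuple.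
    have jT : [set` [set: 'I_(N i)]%SET] j by rewrite /= inE.
    by rewrite tnth_mktuple; exact: xA jT.
  have := @within i [set: 'I_(N i)]%SET (fun j => A (Tagged (fun i => 'I_(N i)) j)) (fun j => mA _).
  by move=> ->; apply: eq_bigl => j; rewrite finset.in_setT.
under eq_bigl do rewrite finset.in_setT.
rewrite sig_big_dep /=; apply: eq_bigr => -[i j] _ //.
Qed.

End grouped_families.

(** * Moments of random variables *)

(** Closure of a class of functions under finite sums, shared by integrability, the spaces [Lk] and
    [sub_measurable]. *)
Lemma fun_sum_ind (T : Type) (V : nmodType) (K : (T -> V) -> Prop) (I : finType)
    (p : pred I) (F : I -> T -> V) :
  K (fun=> 0) -> (forall f g, K f -> K g -> K (fun x => f x + g x)) ->
  (forall i, p i -> K (F i)) -> K (fun x => \sum_(i | p i) F i x).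
Proof.
move=> K0 KD KF.
have -> : (fun x => \sum_(i | p i) F i x) = (fun x => \sum_(i <- enum p) F i x).
  by apply/funext => x; rewrite big_enum.
have : forall i, i \in enum p -> K (F i) by move=> i; rewrite mem_enum => /KF.
elim: (enum p) => [_|i s ih KF'].
  by rewrite (_ : (fun _ => _) = fun=> 0)//; apply/funext => x; rewrite big_nil.
rewrite (_ : (fun _ => _) = fun x => F i x + \sum_(j <- s) F j x); last first.
  by apply/funext => x; rewrite big_cons.
apply: KD; first by apply: KF'; rewrite mem_head.
by apply: ih => j js; apply: KF'; rewrite in_cons js orbT.
Qed.

Section expectation.
Context d (T : measurableType d) (R : realType) (P : probability T R).
Implicit Types f g : T -> R.

Definition Ex f : R := \int[P]_x f x.
Definition intg f := P.-integrable setT (EFin \o f).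

Lemma intg_measurable f : intg f -> measurable_fun setT f.
Proof. by move=> /integrableP[/measurable_EFinP]. Qed.

Lemma intg_le f g : measurable_fun setT f -> (forall x, `|f x| <= g x) -> intg g -> intg f.
Proof.
move=> mf fg ig; apply: le_integrable ig => //; first exact/measurable_EFinP.
by move=> x _ /=; rewrite lee_fin (le_trans (fg x))// ler_norm.
Qed.

Lemma intg_cst c : intg (fun=> c).
Proof. exact: finite_measure_integrable_cst. Qed.

Lemma intgD f g : intg f -> intg g -> intg (fun x => f x + g x).
Proof. by move=> i j; exact: (integrableD measurableT i j). Qed.

Lemma intgZ c f : intg f -> intg (fun x => c * f x).
Proof. by move=> i; exact: (integrableZl measurableT c i). Qed.

Lemma intgB f g : intg f -> intg g -> intg (fun x => f x - g x).
Proof. by move=> i j; exact: (integrableB measurableT i j). Qed.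

Lemma intg_sum (I : finType) (p : pred I) (F : I -> T -> R) :
  (forall i, p i -> intg (F i)) -> intg (fun x => \sum_(i | p i) F i x).
Proof.
by move=> iF; apply: (fun_sum_ind (K := intg)) => //; [exact: intg_cst|exact: intgD].
Qed.

Lemma intg_norm f : intg f -> intg (fun x => `|f x|).
Proof. by move=> ?; exact: integrable_norm. Qed.

Lemma ExD f g : intg f -> intg g -> Ex (fun x => f x + g x) = Ex f + Ex g.
Proof. by move=> ? ?; exact: RintegralD. Qed.

Lemma ExB f g : intg f -> intg g -> Ex (fun x => f x - g x) = Ex f - Ex g.
Proof. by move=> ? ?; exact: RintegralB. Qed.

Lemma ExZ c f : intg f -> Ex (fun x => c * f x) = c * Ex f.
Proof. by move=> ?; exact: RintegralZl. Qed.

Lemma Ex_cst c : Ex (fun=> c) = c.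
Proof.
transitivity (c * fine (P setT)); first exact: Rintegral_cst.
by rewrite probability_setT mulr1.
Qed.

Lemma eq_Ex f g : f =1 g -> Ex f = Ex g.
Proof. by move=> fg; congr Ex; exact/funext. Qed.

Lemma Ex_sum (I : finType) (p : pred I) (F : I -> T -> R) :
  (forall i, p i -> intg (F i)) -> Ex (fun x => \sum_(i | p i) F i x) = \sum_(i | p i) Ex (F i).
Proof.
move=> iF.
have -> : (fun x => \sum_(i | p i) F i x) = (fun x => \sum_(i <- enum p) F i x).
  by apply/funext => x; rewrite big_enum.
rewrite -big_enum.
have : forall i, i \in enum p -> intg (F i) by move=> i; rewrite mem_enum => /iF.
elim: (enum p) => [_|i s ih iF'].
  by rewrite big_nil -[RHS]Ex_cst; apply: eq_Ex => x; rewrite big_nil.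
rewrite big_cons -ih; last by move=> j js; apply: iF'; rewrite in_cons js orbT.
rewrite /= -ExD; first by apply: eq_Ex => x; rewrite big_cons.
  by apply: iF'; rewrite mem_head.
have : forall j, j \in s -> intg (F j) by move=> j js; apply: iF'; rewrite in_cons js orbT.
move=> {ih iF'}; elim: s => [_|j s ih iF'].
  by under eq_fun do rewrite big_nil; exact: intg_cst.
under eq_fun do rewrite big_cons.
apply: intgD; first by apply: iF'; rewrite mem_head.
by apply: ih => l ls; apply: iF'; rewrite in_cons ls orbT.
Qed.

Lemma Ex_ge0 f : (forall x, 0 <= f x) -> 0 <= Ex f.
Proof. by move=> f0; exact: Rintegral_ge0. Qed.

Lemma Ex_le f g : intg f -> intg g -> (forall x, f x <= g x) -> Ex f <= Ex g.
Proof. by move=> ? ? fg; exact: le_Rintegral. Qed.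

Lemma Ex_norm f : intg f -> `|Ex f| <= Ex (fun x => `|f x|).
Proof. by move=> ?; exact: le_normr_Rintegral. Qed.

(** The space of exponent 2k, not k: [Lk P 2] means a finite fourth moment. The even exponent
    dispenses with absolute values. *)
Definition Lk (k : nat) f := measurable_fun setT f /\ intg (fun x => f x ^+ k.*2).

Lemma exprD_le (k : nat) (x y : R) : (x + y) ^+ k.*2 <= 4 ^+ k * (x ^+ k.*2 + y ^+ k.*2).
Proof.
rewrite -!muln2 ![(_ * 2)%N]mulnC !exprM.
have H (u v : R) : u ^+ 2 <= v ^+ 2 -> (u + v) ^+ 2 <= 4 * v ^+ 2.
  move=> uv; suff : 2 * (u * v) <= u ^+ 2 + v ^+ 2 by lra.
  by have := sqr_ge0 (u - v); lra.
have sk (u : R) : 0 <= (u ^+ 2) ^+ k by rewrite exprn_ge0// sqr_ge0.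
have [xy|/ltW yx] := leP (x ^+ 2) (y ^+ 2).
  apply: (@le_trans _ _ ((4 * y ^+ 2) ^+ k)).
    by rewrite lerXn2r ?nnegrE ?(sqr_ge0, mulr_ge0, H)//.
  by rewrite exprMn ler_wpM2l ?exprn_ge0// lerDr.
apply: (@le_trans _ _ ((4 * x ^+ 2) ^+ k)).
  by rewrite addrC lerXn2r ?nnegrE ?(sqr_ge0, mulr_ge0, H)//.
by rewrite exprMn ler_wpM2l ?exprn_ge0// lerDl.
Qed.

Lemma expr_double_ge0 k (x : R) : 0 <= x ^+ k.*2.
Proof. by rewrite -muln2 mulnC exprM exprn_ge0// sqr_ge0. Qed.

Lemma LkD k f g : Lk k f -> Lk k g -> Lk k (fun x => f x + g x).
Proof.
move=> [mf intf] [mg intg_]; split; first exact: measurable_funD.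
apply: (@intg_le _ (fun x => 4 ^+ k * (f x ^+ k.*2 + g x ^+ k.*2))).
- by apply: measurable_funX; exact: measurable_funD.
- by move=> x; rewrite ger0_norm ?expr_double_ge0// exprD_le.
- by apply: intgZ; exact: intgD.
Qed.

Lemma LkZ k c f : Lk k f -> Lk k (fun x => c * f x).
Proof.
move=> [mf intf]; split; first exact: measurable_funM.
have -> : (fun x => (c * f x) ^+ k.*2) = (fun x => c ^+ k.*2 * f x ^+ k.*2).
  by apply/funext => x; rewrite exprMn.
exact: intgZ.
Qed.

Lemma Lk_cst k c : Lk k (fun=> c).
Proof. split; [exact: measurable_cst|exact: intg_cst]. Qed.

Lemma LkB k f g : Lk k f -> Lk k g -> Lk k (fun x => f x - g x).
Proof.
move=> Lf Lg; have := LkD Lf (LkZ (-1) Lg).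
by congr Lk; apply/funext => x; rewrite mulN1r.
Qed.

Lemma Lk_sum k (I : finType) (p : pred I) (F : I -> T -> R) :
  (forall i, p i -> Lk k (F i)) -> Lk k (fun x => \sum_(i | p i) F i x).
Proof.
by move=> LF; apply: (fun_sum_ind (K := Lk k)) => //; [exact: Lk_cst|exact: LkD].
Qed.

Lemma Lk1 f : Lk 2 f -> Lk 1 f.
Proof.
move=> [mf intf]; split => //.
apply: (@intg_le _ (fun x => 1 + f x ^+ 4)); first exact: measurable_funX.
  move=> x; rewrite ger0_norm ?sqr_ge0// (_ : f x ^+ 4 = f x ^+ 2 * f x ^+ 2); last by ring.
  have := sqr_ge0 (f x); have := sqr_ge0 (f x ^+ 2 - 1); nra.
by apply: intgD; [exact: intg_cst|exact: intf].
Qed.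

Lemma Lk1M f g : Lk 1 f -> Lk 1 g -> intg (fun x => f x * g x).
Proof.
move=> [mf intf] [mg intg_].
apply: (@intg_le _ (fun x => f x ^+ 2 + g x ^+ 2)); first exact: measurable_funM.
  move=> x; rewrite ler_norml; have := sqr_ge0 (f x - g x); have := sqr_ge0 (f x + g x).
  have := sqr_ge0 (f x); have := sqr_ge0 (g x); nra.
exact: intgD.
Qed.

Lemma Lk2M f g : Lk 2 f -> Lk 2 g -> Lk 1 (fun x => f x * g x).
Proof.
move=> [mf intf] [mg intg_]; split; first exact: measurable_funM.
apply: (@intg_le _ (fun x => f x ^+ 4 + g x ^+ 4)).
- by apply: measurable_funX; exact: measurable_funM.
- move=> x; rewrite ger0_norm ?sqr_ge0// exprMn.
  rewrite (_ : f x ^+ 4 = (f x ^+ 2) ^+ 2); last by rewrite -exprM.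
  rewrite (_ : g x ^+ 4 = (g x ^+ 2) ^+ 2); last by rewrite -exprM.
  have := sqr_ge0 (f x); have := sqr_ge0 (g x); have := sqr_ge0 (f x ^+ 2 - g x ^+ 2); nra.
- exact: intgD.
Qed.

Lemma Lk1_intg f : Lk 1 f -> intg f.
Proof.
move=> Lf; have := Lk1M Lf (Lk_cst 1 1); congr intg; apply/funext => x; exact: mulr1.
Qed.

(** With one weight t common to all observations, summing these bounds involves only sums of second
    moments; Cauchy-Schwarz would leave square roots inside the sum. *)
Lemma Ex_amgm (t : R) f g : 0 < t -> Lk 1 f -> Lk 1 g ->
  Ex (fun x => `|f x * g x|) <= (t * Ex (fun x => f x ^+ 2) + t^-1 * Ex (fun x => g x ^+ 2)) / 2.
Proof.
move=> t0 Lf Lg; have [mf intf] := Lf; have [mg intg_] := Lg.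
rewrite -!ExZ// -ExD; try exact: intgZ.
rewrite mulrC -ExZ; last by apply: intgD; exact: intgZ.
apply: Ex_le.
- by apply: intg_norm; exact: Lk1M.
- by apply: intgZ; apply: intgD; exact: intgZ.
- move=> x; rewrite normrM -(real_normK (num_real (f x))) -(real_normK (num_real (g x))).
  move: (normr_ge0 (f x)) (normr_ge0 (g x)); move: `|f x| `|g x| => u v u0 v0.
  have -> : 2^-1 * (t * u ^+ 2 + t^-1 * v ^+ 2) = u * v + (t * u - v) ^+ 2 / (2 * t).
    field; lra.
  by rewrite lerDl divr_ge0 ?sqr_ge0// mulr_ge0// ltW.
Qed.

Lemma Ex_cauchy_schwarz f g : Lk 1 f -> Lk 1 g ->
  Ex (fun x => f x * g x) ^+ 2 <= Ex (fun x => f x ^+ 2) * Ex (fun x => g x ^+ 2).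
Proof.
move=> Lf Lg; have [_ if2] := Lf; have [_ ig2] := Lg; have ifg := Lk1M Lf Lg.
have pos t : 0 <= t ^+ 2 * Ex (fun x => f x ^+ 2) +
    (2 * t * Ex (fun x => f x * g x) + Ex (fun x => g x ^+ 2)).
  rewrite -[X in 0 <= X](_ : Ex (fun x => t ^+ 2 * f x ^+ 2 + (2 * t * (f x * g x) + g x ^+ 2)) = _).
    by apply: Ex_ge0 => x; rewrite (_ : _ + _ = (t * f x + g x) ^+ 2) ?sqr_ge0//; ring.
  rewrite ExD; [|exact: intgZ|by apply: intgD => //; exact: intgZ].
  rewrite ExD//; last exact: intgZ.
  by rewrite !ExZ.
have : 0 <= Ex (fun x => f x ^+ 2) by apply: Ex_ge0 => x; exact: sqr_ge0.
move: (Ex _) (Ex _) (Ex _) pos => c b a pos.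
rewrite le_eqVlt => /predU1P[a0|a0].
  rewrite -a0 mul0r exprn_even_le0//=; apply/eqP; apply: contrapT => /eqP b0.
  (* If a = 0 the quadratic polynomial in t is affine; were b nonzero, it would take the value - 1
     at this point. *)
  have := pos (- (c + 1) / (2 * b)); rewrite -a0 mulr0 add0r.
  by rewrite (_ : _ + c = - 1); [rewrite oppr_ge0 ler10|field].
have := pos (- b / a).
have -> : (- b / a) ^+ 2 * a + (2 * (- b / a) * b + c) = (a * c - b ^+ 2) / a.
  by field; rewrite gt_eqF.
by rewrite pmulr_lge0 ?invr_gt0// subr_ge0.
Qed.

(** Minkowski's inequality in squared form, for variables of L^2 norm at most sqrt(C) t_j. Unlike
    [sqr_sum_le], it costs no cardinality factor. *)
Lemma Ex_sq_sum_le (J : finType) (C : R) (w t : J -> R) (F : J -> T -> R) :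
  0 <= C -> (forall j, 0 <= w j) -> (forall j, 0 <= t j) ->
  (forall j, Lk 1 (F j)) -> (forall j, Ex (fun x => F j x ^+ 2) <= C * t j ^+ 2) ->
  Ex (fun x => (\sum_j w j * F j x) ^+ 2) <= C * (\sum_j w j * t j) ^+ 2.
Proof.
move=> C0 w0 t0 LF FC.
have -> : (fun x => (\sum_j w j * F j x) ^+ 2) =
    (fun x => \sum_i \sum_j w i * w j * (F i x * F j x)).
  apply/funext => x; rewrite expr2 big_distrlr /=.
  by apply: eq_bigr => i _; apply: eq_bigr => j _; rewrite mulrACA.
rewrite Ex_sum => [|i _]; last by apply: intg_sum => j _; apply: intgZ; exact: Lk1M.
rewrite expr2 big_distrlr /= mulr_sumr; apply: ler_sum => i _.
rewrite Ex_sum => [|j _]; last by apply: intgZ; exact: Lk1M.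
rewrite mulr_sumr; apply: ler_sum => j _; rewrite ExZ; last exact: Lk1M.
rewrite mulrACA [leRHS]mulrCA ler_wpM2l ?mulr_ge0//.
rewrite (le_trans (ler_norm _))// -ler_sqr ?nnegrE ?mulr_ge0//.
rewrite real_normK ?num_real// (le_trans (Ex_cauchy_schwarz (LF i) (LF j)))//.
rewrite (_ : (C * (t i * t j)) ^+ 2 = (C * t i ^+ 2) * (C * t j ^+ 2)); last by ring.
by rewrite ler_pM// Ex_ge0// => x; exact: sqr_ge0.
Qed.

Lemma sqr_sum_le (J : finType) (F : J -> R) :
  (\sum_j F j) ^+ 2 <= #|J|%:R * \sum_j F j ^+ 2.
Proof.
rewrite expr2 big_distrlr /=.
apply: (@le_trans _ _ (\sum_i \sum_j (F i ^+ 2 + F j ^+ 2) / 2)).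
  apply: ler_sum => i _; apply: ler_sum => j _.
  by have := sqr_ge0 (F i - F j); nra.
rewrite (eq_bigr (fun i => #|J|%:R * (F i ^+ 2 / 2) + (\sum_j F j ^+ 2) / 2)) => [|i _]; last first.
  under eq_bigr do rewrite mulrDl.
  by rewrite big_split /= sumr_const mulr_suml mulr_natl.
rewrite big_split /= -mulr_sumr -mulr_suml sumr_const -[X in _ + X]mulr_natl.
by rewrite (_ : _ + _ = #|J|%:R * \sum_j F j ^+ 2)//; field.
Qed.

End expectation.
Arguments Ex {d T R} P f.
Arguments intg {d T R} P f.
Arguments Lk {d T R} P k f.

Section sub_measurable_closure.
Context d (T : measurableType d) (R : realType) (G : set (set T)).
Implicit Types f g : T -> R.

Lemma sub_measurable_cst c : sub_measurable G (fun=> c : R).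
Proof. exact: measurable_cst. Qed.

Lemma sub_measurableD f g : sub_measurable G f -> sub_measurable G g ->
  sub_measurable G (fun x => f x + g x).
Proof. by move=> *; exact: measurable_funD. Qed.

Lemma sub_measurableM f g : sub_measurable G f -> sub_measurable G g ->
  sub_measurable G (fun x => f x * g x).
Proof. by move=> *; exact: measurable_funM. Qed.

Lemma sub_measurableZ c f : sub_measurable G f -> sub_measurable G (fun x => c * f x).
Proof. by move=> *; apply: sub_measurableM => //; exact: sub_measurable_cst. Qed.

Lemma sub_measurableX f n : sub_measurable G f -> sub_measurable G (fun x => f x ^+ n).
Proof. by move=> *; exact: measurable_funX. Qed.

Lemma sub_measurableB f g : sub_measurable G f -> sub_measurable G g ->
  sub_measurable G (fun x => f x - g x).
Proof. by move=> *; exact: measurable_funB. Qed.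

Lemma sub_measurable_comp (h : R -> R) f : measurable_fun setT h -> sub_measurable G f ->
  sub_measurable G (fun x => h (f x)).
Proof. by move=> mh mf; exact: measurableT_comp mh mf. Qed.

Lemma sub_measurable_sum (I : finType) (p : pred I) (F : I -> T -> R) :
  (forall i, p i -> sub_measurable G (F i)) -> sub_measurable G (fun x => \sum_(i | p i) F i x).
Proof.
by move=> mF; apply: (fun_sum_ind (K := sub_measurable G)) => //; [exact: sub_measurable_cst|exact: sub_measurableD].
Qed.

End sub_measurable_closure.

(** * Quadratic forms in independent random vectors *)

Section quadratic_forms.
Context d (T : measurableType d) (R : realType) (P : probability T R).
Variables (I : finType) (p : nat) (Y : I -> 'I_p -> T -> R).
Variables (H G : I -> set (set T)) (S : I -> 'M[R]_p) (C : R).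
(* [H a] and [G a] generate the sigma-algebras of observation [a] and of all the
   other observations; [product] is their independence. *)
Hypothesis mYown : forall a i, sub_measurable (H a) (Y a i).
Hypothesis mYother : forall a b i, b != a -> sub_measurable (G a) (Y b i).
Hypothesis product : forall a U V, sub_measurable (H a) U -> sub_measurable (G a) V ->
  intg P U -> intg P V ->
  intg P (fun x => U x * V x) /\ Ex P (fun x => U x * V x) = Ex P U * Ex P V.
Hypothesis Y4 : forall a i, Lk P 2 (Y a i).
Hypothesis EY : forall a i, Ex P (Y a i) = 0.
Hypothesis EYY : forall a i j, Ex P (fun x => Y a i x * Y a j x) = S a i j.
Hypothesis EY4 : forall a (v : 'I_p -> R),
  Ex P (fun x => (\sum_i v i * Y a i x) ^+ 4) <=
  C * (\sum_i \sum_j S a i j * (v i * v j)) ^+ 2.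

Local Notation E := (Ex P).

Definition dot a (g : 'I_p -> T -> R) x := \sum_i Y a i x * g i x.
Definition qf (A : 'M[R]_p) (g : 'I_p -> T -> R) x := \sum_i \sum_j A i j * (g i x * g j x).

(** Replaces conditioning on the observations other than a: a polynomial in the coordinates of Y_a,
    with coefficients that depend on the others, is a finite sum of such products. *)
Lemma Ex_sum_own_other a (J : finType) (A B : J -> T -> R) :
  (forall j, sub_measurable (H a) (A j)) -> (forall j, intg P (A j)) ->
  (forall j, sub_measurable (G a) (B j)) -> (forall j, intg P (B j)) ->
  intg P (fun x => \sum_j A j x * B j x) /\
  E (fun x => \sum_j A j x * B j x) = \sum_j E (A j) * E (B j).
Proof.
move=> mA iA mB iB; split.
  by apply: intg_sum => j _; have [] := product (mA j) (mB j) (iA j) (iB j).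
rewrite Ex_sum => [|j _]; last by have [] := product (mA j) (mB j) (iA j) (iB j).
by apply: eq_bigr => j _; have [] := product (mA j) (mB j) (iA j) (iB j).
Qed.

Lemma Y_intg a i : intg P (Y a i).
Proof. by apply: Lk1_intg; exact: Lk1. Qed.

Lemma Lk2_intgM (f g : T -> R) : Lk P 2 f -> Lk P 2 g -> intg P (fun x => f x * g x).
Proof. by move=> Lf Lg; apply: Lk1M; exact: Lk1. Qed.

Lemma Ex_dot a g (psi : T -> R) :
  (forall i, sub_measurable (G a) (g i)) -> sub_measurable (G a) psi ->
  (forall i, intg P (fun x => g i x * psi x)) ->
  intg P (fun x => dot a g x * psi x) /\ E (fun x => dot a g x * psi x) = 0.
Proof.
move=> mg mpsi ig.
have [] := @Ex_sum_own_other a _ (Y a) (fun i x => g i x * psi x).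
- exact: mYown.
- exact: Y_intg.
- by move=> i; exact: sub_measurableM.
- exact: ig.
have -> : (fun x => \sum_j Y a j x * (g j x * psi x)) = (fun x => dot a g x * psi x).
  by apply/funext => x; rewrite mulr_suml; apply: eq_bigr => i _; rewrite mulrA.
by move=> ? ->; split => //; rewrite big1// => i _; rewrite EY mul0r.
Qed.

Lemma dot_sqE a g x : dot a g x ^+ 2 =
  \sum_(u : 'I_p * 'I_p) Y a u.1 x * Y a u.2 x * (g u.1 x * g u.2 x).
Proof.
rewrite expr2 big_distrlr /= pair_bigA /=; apply: eq_bigr => u _.
by rewrite mulrACA.
Qed.

Lemma qfE A g x : qf A g x = \sum_(u : 'I_p * 'I_p) A u.1 u.2 * (g u.1 x * g u.2 x).
Proof. by rewrite /qf pair_bigA. Qed.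

Lemma Ex_dot_sq a g (psi : T -> R) :
  (forall i, sub_measurable (G a) (g i)) -> sub_measurable (G a) psi ->
  (forall i j, intg P (fun x => g i x * g j x * psi x)) ->
  intg P (fun x => dot a g x ^+ 2 * psi x) /\
  E (fun x => dot a g x ^+ 2 * psi x) = E (fun x => qf (S a) g x * psi x).
Proof.
move=> mg mpsi ig.
have [] := @Ex_sum_own_other a _ (fun u x => Y a u.1 x * Y a u.2 x) (fun u x => g u.1 x * g u.2 x * psi x).
- by move=> u; exact: sub_measurableM.
- by move=> u; exact: Lk2_intgM.
- by move=> u; apply: sub_measurableM => //; exact: sub_measurableM.
- by move=> u; exact: ig.
have -> : (fun x => \sum_u Y a u.1 x * Y a u.2 x * (g u.1 x * g u.2 x * psi x)) =
    (fun x => dot a g x ^+ 2 * psi x).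
  by apply/funext => x; rewrite dot_sqE mulr_suml; apply: eq_bigr => i _; rewrite mulrA.
move=> ? ->; split => //.
have -> : (fun x => qf (S a) g x * psi x) =
    (fun x => \sum_u S a u.1 u.2 * (g u.1 x * g u.2 x * psi x)).
  by apply/funext => x; rewrite qfE mulr_suml; apply: eq_bigr => u _; rewrite !mulrA.
rewrite Ex_sum => [|u _]; last by apply: intgZ; exact: ig.
by apply: eq_bigr => u _; rewrite EYY ExZ.
Qed.

(** Fourth powers of independent factors multiply to an integrable function; without independence,
    products of L^4 variables would only be in L^2. *)
Lemma Lk2_dot a g : (forall i, sub_measurable (G a) (g i)) -> (forall i, Lk P 2 (g i)) ->
  Lk P 2 (dot a g).
Proof.
move=> mg g4; apply: Lk_sum => i _.
have [mY iY] := Y4 a i; have [mg' ig] := g4 i.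
split; first exact: measurable_funM.
have [+ _] := product (sub_measurableX 4 (@mYown a i)) (sub_measurableX 4 (mg i)) iY ig.
by congr intg; apply/funext => x; rewrite exprMn.
Qed.

(** Freezing the other observations makes the left side an iterated expectation, in which [EY4]
    applies pointwise to the vector of the values [g i x]. *)
Lemma Ex_dot_4 a g : (forall i, sub_measurable (G a) (g i)) -> (forall i, Lk P 2 (g i)) ->
  E (fun x => dot a g x ^+ 4) <= C * E (fun x => qf (S a) g x ^+ 2).
Proof.
move=> mg g4.
pose YY (w : ('I_p * 'I_p) * ('I_p * 'I_p)) x := (Y a w.1.1 x * Y a w.1.2 x) * (Y a w.2.1 x * Y a w.2.2 x).
have dot4E h x : dot a h x ^+ 4 = \sum_w YY w x * ((h w.1.1 x * h w.1.2 x) * (h w.2.1 x * h w.2.2 x)).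
  rewrite (exprM _ 2 2) dot_sqE expr2 big_distrlr /= pair_bigA /=; apply: eq_bigr => w _.
  by rewrite mulrACA.
have iYY w : intg P (YY w) by apply: Lk1M; exact: Lk2M.
have igg w : intg P (fun x => (g w.1.1 x * g w.1.2 x) * (g w.2.1 x * g w.2.2 x)).
  by apply: Lk1M; exact: Lk2M.
have [] := @Ex_sum_own_other a _ YY (fun w x => (g w.1.1 x * g w.1.2 x) * (g w.2.1 x * g w.2.2 x)).
- by move=> w; do !apply: sub_measurableM.
- exact: iYY.
- by move=> w; do !apply: sub_measurableM.
- exact: igg.
move=> _ E4.
have mid x : E (fun y => (\sum_i g i x * Y a i y) ^+ 4) =
    \sum_w E (YY w) * (g w.1.1 x * g w.1.2 x * (g w.2.1 x * g w.2.2 x)).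
  transitivity (E (fun y => dot a (fun i _ => g i x) y ^+ 4)).
    by apply: eq_Ex => y; congr (_ ^+ 4); apply: eq_bigr => i _; rewrite mulrC.
  rewrite (eq_Ex _ (dot4E (fun i _ => g i x))) Ex_sum => [|w _].
    by apply: eq_bigr => w _; rewrite [RHS]mulrC -ExZ//; apply: eq_Ex => y; rewrite mulrC.
  by under eq_fun do rewrite mulrC; exact: intgZ.
have imid : intg P (fun x => E (fun y => (\sum_i g i x * Y a i y) ^+ 4)).
  by rewrite (funext mid); apply: intg_sum => w _; exact: intgZ.
have q2 : intg P (fun x => qf (S a) g x ^+ 2).
  have [] : Lk P 1 (qf (S a) g) by apply: Lk_sum => i _; apply: Lk_sum => j _; apply: LkZ; exact: Lk2M.
  by [].
rewrite (eq_Ex _ (dot4E g)) E4.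
apply: (@le_trans _ _ (E (fun x => E (fun y => (\sum_i g i x * Y a i y) ^+ 4)))).
  rewrite (eq_Ex _ mid) Ex_sum => [|w _]; last exact: intgZ.
  by apply: ler_sum => w _; rewrite ExZ.
by rewrite -ExZ//; apply: Ex_le => //; exact: intgZ.
Qed.

Lemma Lk1_qf A (g : 'I_p -> T -> R) : (forall i, Lk P 2 (g i)) -> Lk P 1 (qf A g).
Proof. by move=> g4; apply: Lk_sum => i _; apply: Lk_sum => j _; apply: LkZ; exact: Lk2M. Qed.

Lemma Ex_dot_sq1 a g : (forall i, sub_measurable (G a) (g i)) -> (forall i, Lk P 2 (g i)) ->
  E (fun x => dot a g x ^+ 2) = E (qf (S a) g).
Proof.
move=> mg g4.
have ig i j : intg P (fun x => g i x * g j x * 1).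
  by under eq_fun do rewrite mulr1; exact: Lk2_intgM.
have [_ E2] := @Ex_dot_sq a g (fun=> 1) mg (@sub_measurable_cst _ T R (G a) 1) ig.
rewrite (eq_Ex _ (g := fun x => dot a g x ^+ 2 * 1)) => [|x]; last by rewrite mulr1.
by rewrite E2; apply: eq_Ex => x; rewrite mulr1.
Qed.

Lemma EYY_cross a b i j : b != a -> E (fun x => Y a i x * Y b j x) = 0.
Proof.
move=> ba; have [_ ->] := product (@mYown a i) (mYother j ba) (Y_intg a i) (Y_intg b j).
by rewrite EY mul0r.
Qed.

Section off_diagonal.
Variable M : I -> I -> 'M[R]_p.
Hypothesis Msym : forall b c, M c b = (M b c)^T.

Definition partner b i x := \sum_(c | c != b) \sum_j M b c i j * Y c j x.

Definition off_form x := \sum_b dot b (partner b) x.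

Let rest b x := \sum_(c | c != b) \sum_i Y c i x *
  \sum_(e | (e != c) && (e != b)) \sum_j M c e i j * Y e j x.

Lemma partner_sub b i : sub_measurable (G b) (partner b i).
Proof.
apply: sub_measurable_sum => c cb; apply: sub_measurable_sum => j _.
by apply: sub_measurableZ; exact: mYother.
Qed.

Lemma partner_Lk2 b i : Lk P 2 (partner b i).
Proof. by apply: Lk_sum => c _; apply: Lk_sum => j _; exact: LkZ. Qed.

Lemma Lk2_partner_dot b : Lk P 2 (dot b (partner b)).
Proof. by apply: Lk2_dot; [exact: partner_sub|exact: partner_Lk2]. Qed.

Lemma Lk2_off_form : Lk P 2 off_form.
Proof. by apply: Lk_sum => b _; exact: Lk2_partner_dot. Qed.

Let rest_sub b : sub_measurable (G b) (rest b).
Proof.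
apply: sub_measurable_sum => c cb; apply: sub_measurable_sum => j _.
apply: sub_measurableM; first exact: mYother.
apply: sub_measurable_sum => e /andP[_ eb]; apply: sub_measurable_sum => l _.
by apply: sub_measurableZ; exact: mYother.
Qed.

Let off_restE b x : off_form x = 2 * dot b (partner b) x + rest b x.
Proof.
rewrite /off_form (bigD1 b)//= mulr_natl mulr2n -addrA; congr (_ + _).
have -> : dot b (partner b) x = \sum_(c | c != b) \sum_i Y c i x * \sum_j M c b i j * Y b j x.
  rewrite /dot /partner; under eq_bigr do rewrite mulr_sumr.
  rewrite exchange_big; apply: eq_bigr => c _ /=.
  under eq_bigr do rewrite mulr_sumr.
  rewrite exchange_big; apply: eq_bigr => i _ /=; rewrite mulr_sumr.
  by apply: eq_bigr => j _; rewrite Msym mxE mulrCA mulrA mulrC mulrA.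
rewrite /rest -big_split /=; apply: eq_bigr => c cb.
rewrite /dot -big_split /=; apply: eq_bigr => i _.
rewrite -mulrDr; congr (_ * _); rewrite /partner (bigD1 b)//= 1?eq_sym//.
Qed.

(** By the symmetry of M, the terms that involve observation b occur once with b on the left and
    once with b on the right, hence the factor 2; r collects the terms free of b. *)
Lemma off_split b : exists2 r, sub_measurable (G b) r /\ Lk P 2 r &
  forall x, off_form x = 2 * dot b (partner b) x + r x.
Proof.
exists (rest b); last exact: off_restE.
split; first exact: rest_sub.
have -> : rest b = fun x => off_form x - 2 * dot b (partner b) x.
  by apply/funext => x; rewrite (off_restE b) addrC addKr.
by apply: LkB; [exact: Lk2_off_form|apply: LkZ; exact: Lk2_partner_dot].
Qed.

Lemma Ex_partnerM b i j : E (fun x => partner b i x * partner b j x) =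
  \sum_(c | c != b) (M b c *m S c *m (M b c)^T) i j.
Proof.
have -> : (fun x => partner b i x * partner b j x) =
   (fun x => \sum_(c | c != b) \sum_(e | e != b) \sum_u \sum_v
      M b c i u * M b e j v * (Y c u x * Y e v x)).
  apply/funext => x; rewrite big_distrlr /=; apply: eq_bigr => c _; apply: eq_bigr => e _.
  rewrite big_distrlr /=; apply: eq_bigr => u _; apply: eq_bigr => v _.
  by rewrite mulrACA.
have iY c e u v k : intg P (fun x => k * (Y c u x * Y e v x)).
  by apply: intgZ; exact: Lk2_intgM.
rewrite Ex_sum => [|c _]; last first.
  by apply: intg_sum => e _; apply: intg_sum => u _; apply: intg_sum => v _.
apply: eq_bigr => c cb.
rewrite Ex_sum => [|e _]; last by apply: intg_sum => u _; apply: intg_sum => v _.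
have EE e : E (fun x => \sum_u \sum_v M b c i u * M b e j v * (Y c u x * Y e v x)) =
    \sum_u \sum_v M b c i u * M b e j v * E (fun x => Y c u x * Y e v x).
  rewrite Ex_sum => [|u _]; last by apply: intg_sum => v _.
  apply: eq_bigr => u _; rewrite Ex_sum//.
  by apply: eq_bigr => v _; rewrite ExZ//; exact: Lk2_intgM.
rewrite (bigD1 c)//= EE [X in _ + X]big1 ?addr0 => [|e /andP[_ ec]]; last first.
  by rewrite EE big1// => u _; rewrite big1// => v _; rewrite EYY_cross// mulr0.
rewrite !mxE exchange_big /=; apply: eq_bigr => v _; rewrite !mxE mulr_suml.
by apply: eq_bigr => u _; rewrite EYY mulrAC.
Qed.

Lemma Ex_qf_partner A b :
  E (qf A (partner b)) = \sum_(c | c != b) \tr (A *m (M b c *m S c *m (M b c)^T)^T).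
Proof.
have ip i j : intg P (fun x => A i j * (partner b i x * partner b j x)).
  by apply: intgZ; apply: Lk2_intgM; exact: partner_Lk2.
rewrite Ex_sum => [|i _]; last by apply: intg_sum.
under eq_bigr => i _.
  rewrite Ex_sum//; under eq_bigr => j _.
    rewrite ExZ; last by apply: Lk2_intgM; exact: partner_Lk2.
    rewrite Ex_partnerM mulr_sumr; over.
  rewrite exchange_big; over.
rewrite exchange_big /=; apply: eq_bigr => c _.
rewrite /mxtrace; apply: eq_bigr => i _; rewrite mxE; apply: eq_bigr => j _.
by rewrite [in RHS]mxE.
Qed.

(** One factor is written as the sum of the terms D_b = Y_b . [partner b], the other as 2 D_b + r.
    The product D_b r has mean zero because it is linear in Y_b, with coefficients depending on the
    other observations. *)
Lemma Ex_off_sq : E (fun x => off_form x ^+ 2) = 2 * \sum_b E (qf (S b) (partner b)).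
Proof.
have -> : (fun x => off_form x ^+ 2) = (fun x => \sum_b dot b (partner b) x * off_form x).
  by apply/funext => x; rewrite expr2 {1}/off_form mulr_suml.
rewrite Ex_sum => [|b _]; last by apply: Lk2_intgM; [exact: Lk2_partner_dot|exact: Lk2_off_form].
rewrite mulr_sumr; apply: eq_bigr => b _.
have [r [mr r4] offE] := off_split b.
have -> : (fun x => dot b (partner b) x * off_form x) =
    (fun x => 2 * (dot b (partner b) x ^+ 2) + dot b (partner b) x * r x).
  by apply/funext => x; rewrite offE; ring.
have [ir r0] := @Ex_dot b (partner b) r (@partner_sub b) mr (fun i => Lk2_intgM (partner_Lk2 b i) r4).
have [_ i2] := Lk1 (Lk2_partner_dot b).
rewrite ExD//; last exact: intgZ.
by rewrite ExZ// (Ex_dot_sq1 (@partner_sub b) (partner_Lk2 b)) r0 addr0.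
Qed.

Definition diag_form b := qf (M b b) (Y b).

Definition centered_diag b x := diag_form b x - E (diag_form b).

Lemma Lk1_diag_form b : Lk P 1 (diag_form b).
Proof. exact: Lk1_qf. Qed.

Lemma Lk1_centered_diag b : Lk P 1 (centered_diag b).
Proof. by apply: LkB; [exact: Lk1_diag_form|exact: Lk_cst]. Qed.

Let diag_own b : sub_measurable (H b) (centered_diag b).
Proof.
apply: sub_measurableB; last exact: sub_measurable_cst.
apply: sub_measurable_sum => i _; apply: sub_measurable_sum => j _.
by apply: sub_measurableZ; exact: sub_measurableM.
Qed.

Let diag_other b c : c != b -> sub_measurable (G b) (centered_diag c).
Proof.
move=> cb; apply: sub_measurableB; last exact: sub_measurable_cst.
apply: sub_measurable_sum => i _; apply: sub_measurable_sum => j _.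
by apply: sub_measurableZ; apply: sub_measurableM; exact: mYother.
Qed.

Let diag_mean b : E (centered_diag b) = 0.
Proof.
rewrite ExB ?Ex_cst ?subrr//; last exact: intg_cst.
by apply: Lk1_intg; exact: Lk1_diag_form.
Qed.

Let diag_orth b c : c != b -> E (fun x => centered_diag b x * centered_diag c x) = 0.
Proof.
move=> cb; have ic e := Lk1_intg (Lk1_centered_diag e).
by have [_ ->] := product (@diag_own b) (diag_other cb) (ic _) (ic _); rewrite diag_mean mul0r.
Qed.

(** Here Y_b does not kill the expectation, since its product with the centered diagonal term is a
    third-order moment of Y_b. The factor [partner b], a centered function of the other
    observations, does. *)
Let diag_off_orth b : E (fun x => centered_diag b x * off_form x) = 0.
Proof.
have [r [mr r4] offE] := off_split b.
have Lc := Lk1_centered_diag b; have ic := Lk1_intg Lc.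
have -> : (fun x => centered_diag b x * off_form x) =
    (fun x => 2 * (\sum_i (centered_diag b x * Y b i x) * partner b i x) + centered_diag b x * r x).
  apply/funext => x; rewrite offE mulrDr mulrCA; congr (2 * _ + _).
  by rewrite /dot mulr_sumr; apply: eq_bigr => i _; rewrite mulrA.
have [_ r0] := product (@diag_own b) mr ic (Lk1_intg (Lk1 r4)).
have [||||i0 E0] := @Ex_sum_own_other b _ (fun i x => centered_diag b x * Y b i x) (partner b).
- by move=> i; exact: sub_measurableM.
- by move=> i; apply: Lk1M => //; exact: Lk1.
- exact: partner_sub.
- by move=> i; apply: Lk1_intg; apply: Lk1; exact: partner_Lk2.
rewrite ExD; [|exact: intgZ|by apply: Lk1M => //; exact: Lk1].
rewrite ExZ// E0 r0 diag_mean mul0r addr0 big1 ?mulr0// => i _.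
rewrite (_ : E (partner b i) = 0) ?mulr0//.
rewrite Ex_sum => [|c _]; last by apply: intg_sum => j _; apply: intgZ; exact: Y_intg.
rewrite big1// => c _; rewrite Ex_sum => [|j _]; last by apply: intgZ; exact: Y_intg.
by rewrite big1// => j _; rewrite ExZ ?EY ?mulr0//; exact: Y_intg.
Qed.

Definition full_form x := \sum_b diag_form b x + off_form x.

(** The centered diagonal terms are orthogonal to one another and to the off-diagonal form, so the
    variance splits; each diagonal variance is then bounded by a second moment. *)
Lemma full_variance :
  E (fun x => (full_form x - \sum_b E (diag_form b)) ^+ 2) <=
  \sum_b E (fun x => diag_form b x ^+ 2) + E (fun x => off_form x ^+ 2).
Proof.
pose D x := \sum_b centered_diag b x.
have LD : Lk P 1 D by apply: Lk_sum => b _; exact: Lk1_centered_diag.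
have LO := Lk1 Lk2_off_form.
have -> : (fun x => (full_form x - \sum_b E (diag_form b)) ^+ 2) =
    (fun x => \sum_b centered_diag b x * D x + (2 * (\sum_b centered_diag b x * off_form x) + off_form x ^+ 2)).
  apply/funext => x; rewrite -!mulr_suml -/(D x).
  have -> : full_form x - \sum_b E (diag_form b) = D x + off_form x.
    by rewrite /full_form /D /centered_diag sumrB; ring.
  ring.
have iD b : intg P (fun x => centered_diag b x * D x) by apply: Lk1M => //; exact: Lk1_centered_diag.
have iO b : intg P (fun x => centered_diag b x * off_form x) by apply: Lk1M => //; exact: Lk1_centered_diag.
have [_ iO2] := LO.
have iOs : intg P (fun x => \sum_b centered_diag b x * off_form x) by apply: intg_sum => b _.
rewrite ExD; [|by apply: intg_sum|by apply: intgD => //; exact: intgZ].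
rewrite ExD//; last exact: intgZ.
rewrite ExZ// !Ex_sum// [X in 2 * X]big1 ?mulr0 ?add0r => [|b _]; last exact: diag_off_orth.
rewrite lerD2r; apply: ler_sum => b _.
have -> : E (fun x => centered_diag b x * D x) = E (fun x => centered_diag b x ^+ 2).
  rewrite (eq_Ex _ (g := fun x => \sum_c centered_diag b x * centered_diag c x)) => [|x]; last by rewrite /D mulr_sumr.
  rewrite Ex_sum => [|c _]; last by apply: Lk1M; exact: Lk1_centered_diag.
  by rewrite (bigD1 b)//= big1 ?addr0// => c; exact: diag_orth.
have [_ id2] := Lk1_diag_form b; have id1 := Lk1_intg (Lk1_diag_form b).
rewrite (eq_Ex _ (g := fun x => diag_form b x ^+ 2 - (2 * E (diag_form b) * diag_form b x - E (diag_form b) ^+ 2))).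
  rewrite ExB//; last by apply: intgB; [exact: intgZ|exact: intg_cst].
  rewrite gerBl (ExB (intgZ _ id1) (intg_cst P _)) ExZ// Ex_cst.
  by rewrite (_ : _ - _ = E (diag_form b) ^+ 2) ?sqr_ge0//; ring.
by move=> x; rewrite /centered_diag; ring.
Qed.

Lemma Ex_full_form : intg P full_form /\ E full_form = \sum_b E (diag_form b).
Proof.
have id b := Lk1_intg (Lk1_diag_form b).
have iO : intg P off_form by apply: Lk1_intg; apply: Lk1; exact: Lk2_off_form.
have iD : intg P (fun x => \sum_b diag_form b x) by apply: intg_sum.
split; first exact: intgD.
rewrite ExD// Ex_sum// [X in _ + X](_ : _ = 0) ?addr0//.
rewrite Ex_sum => [|b _]; last by apply: Lk1_intg; apply: Lk1; exact: Lk2_partner_dot.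
rewrite big1// => b _.
have [|||_ E0] := @Ex_dot b (partner b) (fun=> 1).
- exact: partner_sub.
- exact: sub_measurable_cst.
- by move=> i; under eq_fun do rewrite mulr1; apply: Lk1_intg; apply: Lk1; exact: partner_Lk2.
- by rewrite -E0; apply: eq_Ex => x; rewrite mulr1.
Qed.

End off_diagonal.

End quadratic_forms.

(** * Stein's bound for a quadratic form without diagonal *)

Section stein_bound.
Context d (T : measurableType d) (R : realType) (P : probability T R).
Variables (I : finType) (p : nat) (Y : I -> 'I_p -> T -> R).
Variables (H G : I -> set (set T)) (S : I -> 'M[R]_p) (C : R).
Hypothesis mYown : forall a i, sub_measurable (H a) (Y a i).
Hypothesis mYother : forall a b i, b != a -> sub_measurable (G a) (Y b i).
Hypothesis product : forall a U V, sub_measurable (H a) U -> sub_measurable (G a) V ->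
  intg P U -> intg P V ->
  intg P (fun x => U x * V x) /\ Ex P (fun x => U x * V x) = Ex P U * Ex P V.
Hypothesis Y4 : forall a i, Lk P 2 (Y a i).
Hypothesis EY : forall a i, Ex P (Y a i) = 0.
Hypothesis EYY : forall a i j, Ex P (fun x => Y a i x * Y a j x) = S a i j.
Hypothesis EY4 : forall a (v : 'I_p -> R),
  Ex P (fun x => (\sum_i v i * Y a i x) ^+ 4) <=
  C * (\sum_i \sum_j S a i j * (v i * v j)) ^+ 2.
Hypothesis C0 : 0 <= C.
Let t a b := \tr (S a *m S b).
Hypothesis t_ge0 : forall a b, 0 <= t a b.
Hypothesis EYS : forall a b, Ex P (fun x => qf (S a) (Y b) x ^+ 2) <= C * t a b ^+ 2.
Variable eps : R.
Hypothesis eps0 : 0 <= eps.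
Hypothesis Seps : forall a b e, \tr (S a *m S b *m S a *m S e) <= eps * (t a b * t a e).

Variable c : I -> I -> R.
Hypothesis csym : forall a b, c a b = c b a.
Hypothesis cdiag : forall a, c a a = 0.

Local Notation E := (Ex P).

Definition gvec a i x := \sum_b c a b * Y b i x.
(** [off_form] runs over ordered pairs, while each unordered pair has weight [c a b] in [wform]:
    hence the half. *)
Let Mw a b : 'M[R]_p := (c a b / 2)%:M.
Definition wform x := 2^-1 * \sum_a dot Y a (gvec a) x.
(** The common value of E W_a^2 and E q_a; half the sum over a is the variance of [wform]. *)
Let v a := \sum_b c a b ^+ 2 * t a b.
Definition qform a := qf (S a) (gvec a).
(** Blocks of q_a as a quadratic form in the observations. Unlike [wform], it has diagonal blocks,
    those with b = e. *)
Let Nq a b e : 'M[R]_p := (c a b * c a e) *: S a.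

Lemma Ssym a : (S a)^T = S a.
Proof.
by apply/matrixP => i j; rewrite mxE -!EYY; apply: eq_Ex => x; rewrite mulrC.
Qed.

Lemma t_sym a b : t a b = t b a.
Proof. by rewrite /t mxtrace_mulC. Qed.

Lemma gvecE a i x : gvec a i x = \sum_(b | b != a) c a b * Y b i x.
Proof. by rewrite /gvec (bigD1 a)//= cdiag mul0r add0r. Qed.

Lemma gvec_partner a i x : gvec a i x = 2 * partner Y Mw a i x.
Proof.
rewrite gvecE /partner mulr_sumr; apply: eq_bigr => b _.
rewrite (bigD1 i)//= big1 ?addr0 => [|j ji].
  by rewrite /Mw mxE eqxx mulr1n; field.
by rewrite /Mw mxE eq_sym (negbTE ji) mulr0n mul0r.
Qed.

Lemma dot_gvec a x : dot Y a (gvec a) x = 2 * dot Y a (partner Y Mw a) x.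
Proof.
by rewrite /dot mulr_sumr; apply: eq_bigr => i _; rewrite gvec_partner mulrCA.
Qed.

Lemma wformE x : wform x = off_form Y Mw x.
Proof.
rewrite /wform /off_form mulr_sumr; apply: eq_bigr => a _.
by rewrite dot_gvec mulrA mulVf ?mul1r.
Qed.

Lemma gvec_sub a i : sub_measurable (G a) (gvec a i).
Proof.
rewrite (_ : gvec a i = fun x => \sum_(b | b != a) c a b * Y b i x); last first.
  by apply/funext => x; exact: gvecE.
by apply: sub_measurable_sum => b ba; apply: sub_measurableZ; exact: mYother.
Qed.

Lemma gvec_Lk2 a i : Lk P 2 (gvec a i).
Proof. by apply: Lk_sum => b _; exact: LkZ. Qed.

Lemma Mw_sym b e : Mw e b = (Mw b e)^T.
Proof. by rewrite /Mw tr_scalar_mx csym. Qed.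

Lemma wform_split a : exists2 r, sub_measurable (G a) r /\ Lk P 2 r &
  forall x, wform x = dot Y a (gvec a) x + r x.
Proof.
have [r rP offE] := off_split mYown mYother product Y4 Mw_sym a.
by exists r => // x; rewrite wformE offE dot_gvec.
Qed.

Lemma Lk2_wform : Lk P 2 wform.
Proof.
rewrite (funext wformE); exact: (Lk2_off_form mYown mYother product Y4).
Qed.

Lemma Lk2_dot_gvec a : Lk P 2 (dot Y a (gvec a)).
Proof. exact: (Lk2_dot mYown product Y4 (@gvec_sub a) (gvec_Lk2 a)). Qed.

Lemma Nq_sym a b e : Nq a e b = (Nq a b e)^T.
Proof. by rewrite /Nq linearZ /= Ssym mulrC. Qed.

Lemma qform_full a x : qform a x = full_form Y (Nq a) x.
Proof.
rewrite /full_form /off_form -big_split /= /qform /qf.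
transitivity (\sum_b \sum_e \sum_i \sum_j Nq a b e i j * (Y b i x * Y e j x)).
  transitivity (\sum_i \sum_j \sum_b \sum_e Nq a b e i j * (Y b i x * Y e j x)).
    apply: eq_bigr => i _; apply: eq_bigr => j _.
    rewrite /gvec big_distrlr /= mulr_sumr; apply: eq_bigr => b _.
    by rewrite mulr_sumr; apply: eq_bigr => e _; rewrite mxE; ring.
  under eq_bigr do rewrite exchange_big /=.
  rewrite exchange_big /=; apply: eq_bigr => b _.
  under eq_bigr do rewrite exchange_big /=.
  by rewrite exchange_big.
apply: eq_bigr => b _; rewrite (bigD1 b)//=; congr (_ + _).
rewrite /dot /partner exchange_big /=; apply: eq_bigr => i _.
rewrite mulr_sumr; apply: eq_bigr => e _.
by rewrite mulr_sumr; apply: eq_bigr => j _; rewrite mulrCA.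
Qed.

Lemma diag_NqE a b x : diag_form Y (Nq a) b x = c a b ^+ 2 * qf (S a) (Y b) x.
Proof.
rewrite /diag_form /qf mulr_sumr; apply: eq_bigr => i _.
by rewrite mulr_sumr; apply: eq_bigr => j _; rewrite mxE; ring.
Qed.

Lemma Lk1_qfY a b : Lk P 1 (qf (S a) (Y b)).
Proof. exact: (Lk1_qf (S a) (Y4 b)). Qed.

Lemma Ex_diag_Nq a b : E (diag_form Y (Nq a) b) = c a b ^+ 2 * t a b.
Proof.
rewrite (eq_Ex _ (diag_NqE a b)) ExZ; last by apply: Lk1_intg; exact: Lk1_qfY.
congr (_ * _); rewrite /qf.
rewrite Ex_sum => [|i _]; last by apply: intg_sum => j _; apply: intgZ; exact: Lk2_intgM.
rewrite /t /mxtrace; apply: eq_bigr => i _; rewrite mxE.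
rewrite Ex_sum => [|j _]; last by apply: intgZ; exact: Lk2_intgM.
apply: eq_bigr => j _; rewrite ExZ; last exact: Lk2_intgM.
by rewrite EYY -[in RHS](Ssym b) mxE.
Qed.

Lemma Ex_qform a : intg P (qform a) /\ E (qform a) = v a.
Proof.
rewrite (funext (qform_full a)).
have [? ->] := Ex_full_form mYown mYother product Y4 EY (Nq a).
by split => //; apply: eq_bigr => b _; exact: Ex_diag_Nq.
Qed.

Lemma Ex_diag_Nq_sq a b : E (fun x => diag_form Y (Nq a) b x ^+ 2) <= C * (c a b ^+ 2 * t a b) ^+ 2.
Proof.
rewrite (eq_Ex _ (g := fun x => (c a b ^+ 2) ^+ 2 * qf (S a) (Y b) x ^+ 2)); last first.
  by move=> x; rewrite diag_NqE exprMn.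
have [_ i2] := Lk1_qfY a b.
rewrite ExZ// [leRHS](_ : _ = (c a b ^+ 2) ^+ 2 * (C * t a b ^+ 2)); last by ring.
by rewrite ler_wpM2l ?sqr_ge0.
Qed.

(** [Ex_off_sq] expresses this through the traces of S_a S_b S_a S_e for e distinct from b, with
    weights c_ab^2 c_ae^2. After [Seps], the sum extended to all pairs (b, e) factors as v_a^2. *)
Lemma Ex_off_Nq_sq a : E (fun x => off_form Y (Nq a) x ^+ 2) <= 2 * eps * v a ^+ 2.
Proof.
rewrite (Ex_off_sq mYown mYother product Y4 EY EYY (Nq_sym a)) -mulrA ler_wpM2l//.
rewrite expr2 /v big_distrlr /= mulr_sumr; apply: ler_sum => b _.
rewrite (Ex_qf_partner mYown mYother product Y4 EY EYY) mulr_sumr.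
rewrite [leRHS](bigD1 b)//= ler_wpDl//.
  by rewrite mulr_ge0// mulr_ge0// mulr_ge0 ?sqr_ge0.
apply: ler_sum => e _.
have -> : Nq a b e *m S e *m (Nq a b e)^T = (c a b * c a e) ^+ 2 *: (S a *m S e *m S a).
  by rewrite /Nq linearZ /= Ssym -!scalemxAl -scalemxAr scalerA expr2.
rewrite linearZ /= !trmx_mul !Ssym -scalemxAr linearZ /= mxtrace_mulC.
rewrite !mulmxA (_ : eps * _ = (c a b * c a e) ^+ 2 * (eps * (t a e * t a b))); last by ring.
by rewrite ler_wpM2l ?sqr_ge0.
Qed.

Lemma sum_sqr_le (J : finType) (F : J -> R) : (forall j, 0 <= F j) ->
  \sum_j F j ^+ 2 <= (\sum_j F j) ^+ 2.
Proof.
move=> F0; rewrite [leRHS]expr2 big_distrlr /=; apply: ler_sum => i _.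
by rewrite (bigD1 i)//= -expr2 lerDl sumr_ge0// => j _; rewrite mulr_ge0.
Qed.

(** The three terms of the constant come from the squared mean, the diagonal part and the
    off-diagonal part of q_a. *)
Lemma Ex_qform_sq a : E (fun x => qform a x ^+ 2) <= (1 + C + 2 * eps) * v a ^+ 2.
Proof.
have [iq Eq] := Ex_qform a.
have Lq : Lk P 1 (qform a) by exact: (Lk1_qf (S a) (gvec_Lk2 a)).
have [_ iq2] := Lq.
have -> : E (fun x => qform a x ^+ 2) = E (fun x => (qform a x - v a) ^+ 2) + v a ^+ 2.
  rewrite (eq_Ex _ (g := fun x => qform a x ^+ 2 - (2 * v a * qform a x - v a ^+ 2))
    (f := fun x => (qform a x - v a) ^+ 2)).
    rewrite ExB//; last by apply: intgB; [exact: intgZ|exact: intg_cst].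
    rewrite (ExB (intgZ _ iq) (intg_cst P _)) ExZ// Ex_cst Eq; ring.
  by move=> x; ring.
have := full_variance mYown mYother product Y4 EY (Nq_sym a).
under eq_bigr do rewrite Ex_diag_Nq.
rewrite -/(v a) => V.
have -> : (1 + C + 2 * eps) * v a ^+ 2 = (C * v a ^+ 2 + 2 * eps * v a ^+ 2) + v a ^+ 2 by ring.
rewrite lerD2r; under eq_Ex do rewrite qform_full; apply: (le_trans V); apply: lerD; last exact: Ex_off_Nq_sq.
apply: (@le_trans _ _ (\sum_b C * (c a b ^+ 2 * t a b) ^+ 2)).
  by apply: ler_sum => b _; exact: Ex_diag_Nq_sq.
rewrite -mulr_sumr ler_wpM2l// sum_sqr_le// => b.
by rewrite mulr_ge0 ?sqr_ge0.
Qed.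

Lemma Ex_dot_gvec_sq a : E (fun x => dot Y a (gvec a) x ^+ 2) = v a.
Proof.
have [_ <-] := Ex_qform a.
exact: (Ex_dot_sq1 mYown product Y4 EYY (@gvec_sub a) (gvec_Lk2 a)).
Qed.

Lemma Ex_dot_gvec_4 a : E (fun x => dot Y a (gvec a) x ^+ 4) <= C * ((1 + C + 2 * eps) * v a ^+ 2).
Proof.
apply: (le_trans (Ex_dot_4 mYown product Y4 EY4 (@gvec_sub a) (gvec_Lk2 a))).
by rewrite ler_wpM2l// Ex_qform_sq.
Qed.

Lemma Ex_wform_sq : E (fun x => wform x ^+ 2) = (\sum_a v a) / 2.
Proof.
under eq_Ex do rewrite wformE.
rewrite (Ex_off_sq mYown mYother product Y4 EY EYY Mw_sym).
rewrite mulr_sumr mulr_suml; apply: eq_bigr => a _.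
have [_ <-] := Ex_qform a.
have -> : qform a = fun x => 4 * qf (S a) (partner Y Mw a) x.
  apply/funext => x; rewrite /qform /qf mulr_sumr; apply: eq_bigr => i _.
  by rewrite mulr_sumr; apply: eq_bigr => j _; rewrite !gvec_partner; ring.
rewrite ExZ; first by field.
by apply: Lk1_intg; apply: Lk1_qf => i; exact: partner_Lk2.
Qed.

Definition qsum x := \sum_a qform a x.
Let Ns b e := \sum_a Nq a b e.

Lemma Ns_sym b e : Ns e b = (Ns b e)^T.
Proof. by rewrite /Ns linear_sum; apply: eq_bigr => a _; exact: Nq_sym. Qed.

Lemma diag_Ns b x : diag_form Y Ns b x = \sum_a c a b ^+ 2 * qf (S a) (Y b) x.
Proof.
under [RHS]eq_bigr do rewrite -diag_NqE /diag_form /qf.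
rewrite exchange_big /=; apply: eq_bigr => i _.
rewrite exchange_big /=; apply: eq_bigr => j _.
by rewrite /Ns summxE mulr_suml.
Qed.

Lemma off_Ns x : off_form Y Ns x = \sum_a off_form Y (Nq a) x.
Proof.
rewrite /off_form [RHS]exchange_big /=; apply: eq_bigr => b _.
rewrite /dot [RHS]exchange_big /=; apply: eq_bigr => i _; rewrite -mulr_sumr; congr (_ * _).
rewrite /partner [RHS]exchange_big /=; apply: eq_bigr => e _.
rewrite [RHS]exchange_big /=; apply: eq_bigr => j _.
by rewrite /Ns summxE mulr_suml.
Qed.

Lemma qsum_full x : qsum x = full_form Y Ns x.
Proof.
rewrite /qsum /full_form off_Ns; under eq_bigr do rewrite qform_full.
rewrite big_split /=; congr (_ + _); rewrite exchange_big /=.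
by apply: eq_bigr => b _; rewrite diag_Ns; apply: eq_bigr => a _; rewrite diag_NqE.
Qed.

(** For the diagonal, the q_a are added before squaring: for fixed b, Minkowski's inequality gives C
    v_b^2, as c and t are symmetric. The off-diagonal parts are merely summed by Cauchy-Schwarz; the
    resulting factor [#|I|] comes with eps. *)
Lemma qsum_variance :
  E (fun x => (qsum x - \sum_a v a) ^+ 2) <= (C + 2 * eps * #|I|%:R) * \sum_a v a ^+ 2.
Proof.
have := full_variance mYown mYother product Y4 EY Ns_sym.
have -> : \sum_b E (diag_form Y Ns b) = \sum_a v a.
  rewrite [RHS]exchange_big /=; apply: eq_bigr => b _.
  rewrite (eq_Ex _ (diag_Ns b)) Ex_sum => [|a _].
    by apply: eq_bigr => a _; rewrite -Ex_diag_Nq (eq_Ex _ (diag_NqE a b)).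
  by apply: intgZ; apply: Lk1_intg; exact: Lk1_qfY.
under eq_Ex do rewrite -qsum_full; move/le_trans; apply.
rewrite mulrDl mulr_sumr; apply: lerD.
  apply: ler_sum => b _; under eq_Ex do rewrite diag_Ns.
  have -> : v b = \sum_a c a b ^+ 2 * t a b.
    by apply: eq_bigr => a _; rewrite csym t_sym.
  apply: Ex_sq_sum_le => // a; [exact: sqr_ge0|exact: Lk1_qfY].
have [_ iO] : Lk P 1 (off_form Y Ns) by apply: Lk1; exact: (Lk2_off_form mYown mYother product Y4).
have iOq a : intg P (fun x => off_form Y (Nq a) x ^+ 2).
  by have [] : Lk P 1 (off_form Y (Nq a)) by apply: Lk1; exact: (Lk2_off_form mYown mYother product Y4).
apply: (@le_trans _ _ (E (fun x => #|I|%:R * \sum_a off_form Y (Nq a) x ^+ 2))).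
  apply: Ex_le => //; first by apply: intgZ; apply: intg_sum.
  by move=> x; rewrite off_Ns; exact: sqr_sum_le.
rewrite ExZ; last by apply: intg_sum.
rewrite Ex_sum// (mulrC (2 * eps)) -mulrA ler_wpM2l// mulr_sumr.
by apply: ler_sum => a _; exact: Ex_off_Nq_sq.
Qed.

(** The three terms account for a variance different from 1, for the fluctuation of half of [qsum],
    and for the Taylor remainders. The weight [lam] of [Ex_amgm] stays free, to be balanced against
    the sum of the v_a^2. *)
Lemma stein_bound (f df : R -> R) (K lam : R) : 0 < lam ->
  (forall x : R, is_derive x 1 f (df x)) ->
  (forall x, `|f x| <= K) -> (forall x, `|df x| <= K) ->
  (forall x y, `|df x - df y| <= K * `|x - y|) ->
  `|E (fun x => df (wform x)) - E (fun x => wform x * f (wform x))| <=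
  K * (`|(\sum_a v a) / 2 - 1| +
       (lam + (C + 2 * eps * #|I|%:R) * (\sum_a v a ^+ 2) / lam) / 4 +
       (2 * lam * (\sum_a v a) + (C + 1) * (1 + C + 2 * eps) * (\sum_a v a ^+ 2) / lam) / 4).
Proof.
move=> lam0 fdf fK dfK dfL.
have K0 : 0 <= K by rewrite (le_trans _ (fK 0)).
have mf : measurable_fun setT f.
  apply: continuous_measurable_fun => x.
  by apply/differentiable_continuous/derivable1_diffP; have [] := fdf x.
have mdf : measurable_fun setT df.
  by apply: continuous_measurable_fun; exact: lipschitz_continuous dfL.
have bnd (h : R -> R) (U : T -> R) (V : T -> R) : measurable_fun setT h -> (forall x, `|h x| <= K) ->
    measurable_fun setT U -> intg P V -> intg P (fun x => V x * h (U x)).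
  move=> mh hK mU iV; apply: (@intg_le _ _ _ _ _ (fun x => K * `|V x|)).
  - by apply: measurable_funM; [exact: intg_measurable iV|exact: measurableT_comp mh mU].
  - by move=> x; rewrite normrM mulrC ler_wpM2r.
  - by apply: intgZ; exact: intg_norm.
have mW : measurable_fun setT wform by have [] := Lk2_wform.
have LD a := Lk2_dot_gvec a.
have Lq a : Lk P 1 (qform a) by exact: (Lk1_qf (S a) (gvec_Lk2 a)).
have LD2 a : Lk P 1 (fun x => dot Y a (gvec a) x ^+ 2).
  by under eq_fun do rewrite expr2; exact: Lk2M.
have part a : `|E (fun x => dot Y a (gvec a) x * f (wform x)) - E (fun x => qform a x * df (wform x))| <=
   K * ((2 * lam * v a + (C + 1) * (1 + C + 2 * eps) * v a ^+ 2 / lam) / 2).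
  have [r [mr Lr] wE] := wform_split a.
  have mr' : measurable_fun setT r by have [] := Lr.
  (* With r = W - W_a free of Y_a, E[W_a f(r)] vanishes, and in E[W_a^2 f'(r)] the square may be
     replaced by q_a. *)
  have [i1 E1] := @Ex_dot _ _ _ _ _ _ _ _ _ mYown product Y4 EY a (gvec a) (fun x => f (r x))
    (@gvec_sub a) (sub_measurable_comp mf mr) (fun i => bnd _ _ _ mf fK mr' (Lk1_intg (Lk1 (gvec_Lk2 a i)))).
  have [i2 E2] := @Ex_dot_sq _ _ _ _ _ _ _ _ _ _ mYown product Y4 EYY a (gvec a) (fun x => df (r x))
    (@gvec_sub a) (sub_measurable_comp mdf mr) (fun i j => bnd _ _ _ mdf dfK mr' (Lk2_intgM (gvec_Lk2 a i) (gvec_Lk2 a j))).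
  have iq := Lk1_intg (Lq a).
  have id := Lk1_intg (Lk1 (LD a)).
  have i3 := bnd _ _ _ mdf dfK mr' iq.
  have i4 := bnd _ _ _ mdf dfK mW iq.
  have i5 := bnd _ _ _ mf fK mW id.
  have dd2 : intg P (fun x => dot Y a (gvec a) x * dot Y a (gvec a) x ^+ 2).
    by apply: Lk1M; [exact: Lk1|exact: LD2].
  have dq : intg P (fun x => dot Y a (gvec a) x * qform a x).
    by apply: Lk1M; [exact: Lk1|exact: Lq].
  have st1 : `|E (fun x => dot Y a (gvec a) x * f (wform x)) - E (fun x => qform a x * df (r x))| <=
     K * E (fun x => `|dot Y a (gvec a) x * dot Y a (gvec a) x ^+ 2|).
    rewrite -/(qform a) in E2; rewrite -E2 -[X in `|X - _|]subr0 -E1 -ExB// -ExB//; last exact: intgB.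
    rewrite -ExZ; last exact: intg_norm.
    apply: (le_trans (Ex_norm (intgB (intgB i5 i1) i2))); apply: Ex_le.
    - by apply: intg_norm; apply: intgB => //; exact: intgB.
    - by apply: intgZ; exact: intg_norm.
    - move=> x; have := taylor_lipschitz fdf dfL (r x) (wform x).
      rewrite wE addrK => tl.
      rewrite (_ : _ - _ = dot Y a (gvec a) x * (f (dot Y a (gvec a) x + r x) - f (r x) - dot Y a (gvec a) x * df (r x))); last by ring.
      rewrite !normrM mulrCA ler_wpM2l//.
      by rewrite -normrM -expr2 (ger0_norm (sqr_ge0 _)).
  (* Putting f'(W) back in place of f'(r) costs the Lipschitz constant times |W_a|, hence a second
     term of third order. *)
  have st2 : `|E (fun x => qform a x * df (r x)) - E (fun x => qform a x * df (wform x))| <=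
     K * E (fun x => `|dot Y a (gvec a) x * qform a x|).
    rewrite -ExB// -ExZ; last exact: intg_norm.
    apply: (le_trans (Ex_norm (intgB i3 i4))); apply: Ex_le.
    - by apply: intg_norm; exact: intgB.
    - by apply: intgZ; exact: intg_norm.
    - move=> x; rewrite -mulrBr !normrM [leRHS]mulrA [leRHS]mulrC ler_wpM2l//.
      rewrite (le_trans (dfL _ _))// wE opprD addrCA subrr addr0 normrN.
      exact: lexx.
  (* Both third-order terms are paired as W_a against W_a^2 and W_a against q_a, which leaves only
     the moments bounded above. *)
  have am1 := Ex_amgm lam0 (Lk1 (LD a)) (LD2 a).
  have am2 := Ex_amgm lam0 (Lk1 (LD a)) (Lq a).
  have e4 : E (fun x => (dot Y a (gvec a) x ^+ 2) ^+ 2) <= C * ((1 + C + 2 * eps) * v a ^+ 2).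
    by under eq_Ex do rewrite -exprM; exact: Ex_dot_gvec_4.
  have eq2 := Ex_qform_sq a.
  rewrite Ex_dot_gvec_sq in am1; rewrite Ex_dot_gvec_sq in am2.
  rewrite (le_trans (ler_distD (E (fun x => qform a x * df (r x))) _ _))//.
  rewrite (le_trans (lerD st1 st2))// -mulrDr ler_wpM2l//.
  rewrite (le_trans (lerD am1 am2))//.
  have li : 0 <= lam^-1 by rewrite invr_ge0 ltW.
  have := ler_wpM2l li e4; have := ler_wpM2l li eq2; lra.
have iq a := Lk1_intg (Lq a).
have iqf a : intg P (fun x => qform a x * df (wform x)) by exact: bnd mdf dfK mW (iq a).
have idf a : intg P (fun x => dot Y a (gvec a) x * f (wform x)).
  by exact: bnd mf fK mW (Lk1_intg (Lk1 (LD a))).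
have iW : intg P (fun x => wform x * f (wform x)).
  exact: bnd mf fK mW (Lk1_intg (Lk1 Lk2_wform)).
have iQ : intg P (fun x => qsum x * df (wform x)).
  apply: bnd mdf dfK mW _; by apply: intg_sum.
have idW : intg P (fun x => df (wform x)).
  by have := bnd _ _ _ mdf dfK mW (intg_cst P 1); under eq_fun do rewrite mul1r.
have s1 : `|E (fun x => wform x * f (wform x)) - E (fun x => qsum x * df (wform x)) / 2| <=
   K * ((2 * lam * (\sum_a v a) + (C + 1) * (1 + C + 2 * eps) * (\sum_a v a ^+ 2) / lam) / 4).
  have -> : E (fun x => wform x * f (wform x)) = 2^-1 * \sum_a E (fun x => dot Y a (gvec a) x * f (wform x)).
    rewrite -Ex_sum// -ExZ; last by apply: intg_sum.
    by apply: eq_Ex => x; rewrite -mulr_suml mulrA.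
  have -> : E (fun x => qsum x * df (wform x)) / 2 = 2^-1 * \sum_a E (fun x => qform a x * df (wform x)).
    rewrite -Ex_sum// mulrC; congr (_ * _).
    by apply: eq_Ex => x; rewrite -mulr_suml.
  rewrite -mulrBr -sumrB normrM ger0_norm; last by rewrite invr_ge0.
  rewrite mulrC ler_pdivrMr// (le_trans (ler_norm_sum _ _ _))//.
  apply: (le_trans (ler_sum _ (fun a _ => part a))).
  rewrite -mulr_sumr -[leRHS]mulrA ler_wpM2l//.
  rewrite (eq_bigr (fun a => lam * v a + ((C + 1) * (1 + C + 2 * eps) / lam / 2) * v a ^+ 2)).
    rewrite big_split /= -!mulr_sumr le_eqVlt; apply/orP; left; apply/eqP; field.
    by rewrite gt_eqF.
  by move=> a _; field; rewrite gt_eqF.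
have Lqs : Lk P 1 qsum by apply: Lk_sum => a _; exact: Lq.
pose V := \sum_a v a.
have s2 : `|E (fun x => df (wform x)) - E (fun x => qsum x * df (wform x)) / 2| <=
    K * (`|V / 2 - 1| + (lam + (C + 2 * eps * #|I|%:R) * (\sum_a v a ^+ 2) / lam) / 4).
  have Lc : Lk P 1 (fun x => qsum x - V) by apply: LkB => //; exact: Lk_cst.
  have ic := Lk1_intg Lc.
  (* Paired with the constant 1, the weighted inequality bounds E|qsum - V| by a multiple of lam
     plus the variance divided by lam, without a square root. *)
  have am := Ex_amgm lam0 (Lk_cst P 1 1) Lc.
  rewrite expr1n Ex_cst in am.
  have qv := qsum_variance; rewrite -/V in qv.
  have hK : `|E (fun x => df (wform x)) - E (fun x => qsum x * df (wform x)) / 2| <=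
      K * (`|V / 2 - 1| + E (fun x => `|1 * (qsum x - V)|) / 2).
    have i1 : intg P (fun x => `|1 * (qsum x - V)|).
      by apply: intg_norm; apply: intgZ.
    rewrite mulrC -ExZ// -ExB//; last exact: intgZ.
    have -> : `|V / 2 - 1| + E (fun x => `|1 * (qsum x - V)|) / 2 =
        E (fun x => `|V / 2 - 1| + 2^-1 * `|1 * (qsum x - V)|).
      by rewrite (ExD (intg_cst P _) (intgZ _ i1)) (ExZ _ i1) Ex_cst [X in _ + X = _]mulrC.
    have i2 : intg P (fun x => `|V / 2 - 1| + 2^-1 * `|1 * (qsum x - V)|).
      by apply: intgD; [exact: intg_cst|exact: intgZ].
    rewrite -ExZ//; apply: (le_trans (Ex_norm (intgB idW (intgZ _ iQ)))); apply: Ex_le.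
    - by apply: intg_norm; apply: intgB => //; exact: intgZ.
    - exact: intgZ.
    - move=> x; rewrite mul1r.
      have -> : df (wform x) - 2^-1 * (qsum x * df (wform x)) = - df (wform x) * ((V / 2 - 1) + (qsum x - V) / 2).
        by field.
      rewrite normrM normrN ler_pM// (le_trans (ler_normD _ _))// lerD2l normrM mulrC.
      by rewrite (ger0_norm (_ : 0 <= 2^-1)) ?invr_ge0.
  apply: (le_trans hK); rewrite ler_wpM2l// lerD2l.
  have li : 0 <= lam^-1 by rewrite invr_ge0 ltW.
  by have := ler_wpM2l li qv; lra.
rewrite (le_trans (ler_distD (E (fun x => qsum x * df (wform x)) / 2) _ _))//.
rewrite (distrC _ (E (fun x => wform x * f (wform x)))).
by apply: (le_trans (lerD s2 s1)); rewrite -mulrDr.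
Qed.

End stein_bound.

(** * From Stein's bound to convergence in distribution *)

Section convergence_criterion.
Context {R : realType}.

Definition ramp (a b x : R) : R := Num.min 1 (Num.max 0 ((b - x) / (b - a))).

Lemma ramp01 a b x : 0 <= ramp a b x <= 1.
Proof. by rewrite /ramp le_min ge_min lexx ler01 le_max lexx. Qed.

Lemma ramp_left a b x : a < b -> x <= a -> ramp a b x = 1.
Proof.
move=> ab xa; apply/min_idPl; rewrite le_max; apply/orP; right.
by rewrite ler_pdivlMr ?subr_gt0// mul1r lerD2l lerN2.
Qed.

Lemma ramp_right a b x : a < b -> b <= x -> ramp a b x = 0.
Proof.
move=> ab bx; rewrite /ramp (max_idPl _).
  by apply/min_idPr.
by rewrite ler_pdivrMr ?subr_gt0// mul0r subr_le0.
Qed.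

Lemma ramp_lipschitz a b x y : a < b -> `|ramp a b x - ramp a b y| <= (b - a)^-1 * `|x - y|.
Proof.
move=> ab; have ba : 0 < (b - a)^-1 by rewrite invr_gt0 subr_gt0.
wlog xy : x y / x <= y.
  by move=> H; have [/H//|/ltW/H] := leP x y; rewrite distrC (distrC y).
rewrite (ler0_norm (_ : x - y <= 0)) ?subr_le0//.
have uv : (b - y) / (b - a) <= (b - x) / (b - a) by rewrite ler_pM2r// lerD2l lerN2.
have E : (b - a)^-1 * - (x - y) = (b - x) / (b - a) - (b - y) / (b - a) by ring.
rewrite E /ramp; move: (_ / _) (_ / _) uv => v u uv.
have [mn mnuv] : Num.max 0 u <= Num.max 0 v /\ Num.max 0 v - Num.max 0 u <= v - u.
  by case: (leP 0 u) => u0; case: (leP 0 v) => v0; lra.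
move: (Num.max 0 u) (Num.max 0 v) mn mnuv => m n mn mnuv.
by rewrite ler_norml; case: (leP 1 m) => m1; case: (leP 1 n) => n1; lra.
Qed.

(** Stein's equation turns E[f'(W)] - E[W f(W)] into E[ramp(W)] - c, with c between the two values
    of [std_cdf]. The constant K is that of the Stein solution, so it is chosen before the
    probability space and W. *)
Lemma stein_ramp (a b : R) : a < b -> exists K : R, 0 <= K /\
  forall d (T : measurableType d) (P : probability T R) (W : T -> R) (delta : R),
  Lk P 1 W ->
  (forall f df : R -> R, (forall x : R, is_derive x 1 f (df x)) ->
    (forall x, `|f x| <= K) -> (forall x, `|df x| <= K) ->
    (forall x y, `|df x - df y| <= K * `|x - y|) ->
    `|Ex P (fun x => df (W x)) - Ex P (fun x => W x * f (W x))| <= K * delta) ->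
  std_cdf a - K * delta <= Ex P (fun x => ramp a b (W x)) <= std_cdf b + K * delta.
Proof.
move=> ab.
have [f [c [K [K0 [cab dfE fK dfK dfL]]]]] := stein_solution (ltW ab) (ramp01 a b)
  (fun x y => ramp_lipschitz x y ab) (fun x => ramp_left ab) (fun x => ramp_right ab).
exists K; split => // d T P W delta LW /(_ f _ dfE fK dfK dfL).
have mW : measurable_fun setT W by have [] := LW.
have mf : measurable_fun setT f.
  apply: continuous_measurable_fun => x.
  by apply/differentiable_continuous/derivable1_diffP; have [] := dfE x.
have mh : measurable_fun setT (ramp a b).
  by apply: continuous_measurable_fun; apply: lipschitz_continuous => x y; exact: ramp_lipschitz.
have iWf : intg P (fun x => W x * f (W x)).
  apply: (@intg_le _ _ _ _ _ (fun x => K * `|W x|)).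
  - by apply: measurable_funM => //; exact: measurableT_comp mf mW.
  - by move=> x; rewrite normrM mulrC ler_wpM2r.
  - by apply: intgZ; apply: intg_norm; exact: Lk1_intg.
have ih : intg P (fun x => ramp a b (W x)).
  apply: (@intg_le _ _ _ _ _ (fun=> 1)); last exact: intg_cst.
  - exact: measurableT_comp mh mW.
  - by move=> x; have /andP[r0 r1] := ramp01 a b (W x); rewrite ger0_norm.
rewrite ExD//; last by apply: intgB => //; exact: intg_cst.
rewrite ExB//; last exact: intg_cst.
rewrite Ex_cst addrAC subrr add0r ler_norml => /andP[l u].
by have /andP[? ?] := cab; apply/andP; split; lra.
Qed.

Lemma Ex_indicator d (T : measurableType d) (P : probability T R) (A : set T) :
  measurable A -> intg P (\1_A) /\ Ex P (\1_A) = fine (P A).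
Proof.
move=> mA; split; first exact: integrable_indic.
by rewrite /Ex /Rintegral integral_indic// setIT.
Qed.

(** The indicator of the half-line lies between the ramps on [z - eps, z] and [z, z + eps]. A ramp
    is Lipschitz with constant 1 / eps, so passing from xi to W costs their L^1 distance divided by
    eps; K adds this to the two Stein constants. *)
Lemma cdf_sandwich (z eps : R) : 0 < eps -> exists K : R, 0 <= K /\
  forall d (T : measurableType d) (P : probability T R) (W xi : T -> R) (delta : R),
  Lk P 1 W -> Lk P 1 xi ->
  (forall (f df : R -> R) (L : R), 0 <= L -> (forall x : R, is_derive x 1 f (df x)) ->
    (forall x, `|f x| <= L) -> (forall x, `|df x| <= L) ->
    (forall x y, `|df x - df y| <= L * `|x - y|) ->
    `|Ex P (fun x => df (W x)) - Ex P (fun x => W x * f (W x))| <= L * delta) ->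
  Ex P (fun x => `|xi x - W x|) <= delta ->
  std_cdf (z - eps) - K * delta <= fine (P (xi @^-1` `]-oo, z])) <= std_cdf (z + eps) + K * delta.
Proof.
move=> e0; have za : z - eps < z by rewrite ltrBlDr ltrDl.
have zb : z < z + eps by rewrite ltrDl.
have [K1 [K10 H1]] := stein_ramp za; have [K2 [K20 H2]] := stein_ramp zb.
exists (K1 + K2 + eps^-1); split; first by rewrite !addr_ge0// invr_ge0 ltW.
move=> d T P W xi delta LW Lxi stein dist.
have mW : measurable_fun setT W by have [] := LW.
have mxi : measurable_fun setT xi by have [] := Lxi.
have delta0 : 0 <= delta by rewrite (le_trans _ dist)// Ex_ge0.
have mA : measurable (xi @^-1` `]-oo, z]) by rewrite -[X in measurable X]setTI; exact: mxi.
have [iA <-] := Ex_indicator P mA.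
have mr a b (U : T -> R) : a < b -> measurable_fun setT U -> intg P (fun x => ramp a b (U x)).
  move=> ab mU; apply: (@intg_le _ _ _ _ _ (fun=> 1)); last exact: intg_cst.
  - apply: measurableT_comp mU; apply: continuous_measurable_fun.
    by apply: lipschitz_continuous => x y; exact: ramp_lipschitz.
  - by move=> x; have /andP[r0 r1] := ramp01 a b (U x); rewrite ger0_norm.
have id : intg P (fun x => `|xi x - W x|) by apply: intg_norm; apply: intgB; exact: Lk1_intg.
have cmp a b : a < b -> b - a = eps -> `|Ex P (fun x => ramp a b (xi x)) - Ex P (fun x => ramp a b (W x))| <= eps^-1 * delta.
  move=> ab be; rewrite -ExB; [|exact: mr|exact: mr].
  apply: (le_trans (Ex_norm (intgB (mr _ _ _ ab mxi) (mr _ _ _ ab mW)))).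
  apply: (@le_trans _ _ (Ex P (fun x => eps^-1 * `|xi x - W x|))).
    apply: Ex_le.
    - by apply: intg_norm; apply: intgB; exact: mr.
    - exact: intgZ.
    - by move=> x; rewrite -be; exact: ramp_lipschitz.
  by rewrite ExZ// ler_wpM2l// invr_ge0 ltW.
have ei : 0 <= eps^-1 by rewrite invr_ge0 ltW.
have p1 := mulr_ge0 K10 delta0; have p2 := mulr_ge0 K20 delta0; have p3 := mulr_ge0 ei delta0.
rewrite !mulrDl; apply/andP; split.
  have /andP[l _] := H1 _ _ P W delta LW (fun f df => stein f df K1 K10).
  have := cmp _ _ za (subKr _ _); rewrite ler_norml => /andP[c1 c2].
  have : Ex P (fun x => ramp (z - eps) z (xi x)) <= Ex P (\1_(xi @^-1` `]-oo, z])).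
    apply: Ex_le => //; first exact: mr.
    move=> x; rewrite indicE; have [xz|zx] := leP (xi x) z.
      by rewrite mem_set ?in_itv//=; have /andP[] := ramp01 (z - eps) z (xi x).
    by rewrite ramp_right// ltW.
  lra.
have /andP[_ u] := H2 _ _ P W delta LW (fun f df => stein f df K2 K20).
have be : z + eps - z = eps by ring.
have := cmp _ _ zb be; rewrite ler_norml => /andP[c1 c2].
have : Ex P (\1_(xi @^-1` `]-oo, z])) <= Ex P (fun x => ramp z (z + eps) (xi x)).
  apply: Ex_le => //; first exact: mr.
  move=> x; rewrite indicE; have [xz|zx] := leP (xi x) z.
    by rewrite ramp_left// lern1 leq_b1.
  rewrite memNset /=; last by rewrite in_itv/= leNgt zx.
  by have /andP[] := ramp01 z (z + eps) (xi x).
lra.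
Qed.

Lemma cvg_in_distribution_stein (d : nat -> measure_display)
    (T : forall r, measurableType (d r)) (P : forall r, probability (T r) R)
    (xi : forall r, T r -> R) :
  (forall e : R, 0 < e -> \forall r \near \oo, exists W : T r -> R,
     [/\ Lk (P r) 1 W, Lk (P r) 1 (xi r),
     (forall (f df : R -> R) (L : R), 0 <= L -> (forall x : R, is_derive x 1 f (df x)) ->
      (forall x, `|f x| <= L) -> (forall x, `|df x| <= L) ->
      (forall x y, `|df x - df y| <= L * `|x - y|) ->
      `|Ex (P r) (fun x => df (W x)) - Ex (P r) (fun x => W x * f (W x))| <= L * e) &
      Ex (P r) (fun x => `|xi r x - W x|) <= e]) ->
  cvg_in_distribution P xi (normal_prob 0 1).
Proof.
move=> H z _; rewrite [X in _ --> X](_ : _ = (std_cdf z)%:E); last exact: std_cdf_prob.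
apply/fine_cvgP; split.
  have := H 1 ltr01; apply: filterS => r [W [_ [mxi _] _ _]].
  by rewrite fin_num_measure// -[X in measurable X]setTI; exact: mxi.
apply/cvgrPdist_lt => e e0.
have e2 : 0 < e / 2 by rewrite divr_gt0.
have /cvgrPdist_lt/(_ _ e2)/nbhs_ballP[eps /= eps0 He] := @continuous_std_cdf R z.
have eps2 : 0 < eps / 2 by rewrite divr_gt0.
have [K [K0 HK]] := cdf_sandwich z eps2.
(* Order of the choices: continuity of the normal distribution function at z fixes the ramp width,
   the width fixes K, and only then is the error required of the approximation chosen. *)
have d0 : 0 < e / 2 / (K + 1) by rewrite divr_gt0// ltr_wpDl.
have := H _ d0; apply: filterS => r [W [LW Lxi stein dist]].
have /andP[l u] := HK _ _ _ _ _ _ LW Lxi stein dist.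
have c1 : `|std_cdf z - std_cdf (z - eps / 2)| < e / 2.
  by apply: He; rewrite /ball /= subKr gtr0_norm// ltr_pdivrMr// ltr_pMr// ltr1n.
have c2 : `|std_cdf z - std_cdf (z + eps / 2)| < e / 2.
  by apply: He; rewrite /ball /= opprD addrA subrr sub0r normrN gtr0_norm// ltr_pdivrMr// ltr_pMr// ltr1n.
have Kd : K * (e / 2 / (K + 1)) <= e / 2.
  by rewrite mulrA ler_pdivrMr ?ltr_wpDl// mulrC ler_wpM2l ?(ltW e2)// lerDl.
move: c1 c2; rewrite !ltr_norml => /andP[c1 c1'] /andP[c2 c2'].
clear - l u c1' c2 Kd; move: (std_cdf _) (fine _) (K * _) l u c1' c2 Kd => *.
by apply/andP; split; lra.
Qed.

End convergence_criterion.

(** * The linear model *)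

Section linear_model_moments.
Context d (T : measurableType d) (R : realType) (P : probability T R).
Variables (m : nat) (Z : {RV P >-> m.-tuple R}) (C : R).
Hypothesis Zmean : has_mean P Z 0.
Hypothesis Zcov : has_covariance P Z 1%:M.
Hypothesis Zmom : product_moments P Z 8.
Hypothesis Z4 : forall l, ('E_P[fun w => (tnth (Z w) l ^+ 4)%R] <= C%:E)%E.

Local Notation E := (Ex P).
Let z l w := tnth (Z w) l.

Lemma measurable_coord l : measurable_fun setT (z l).
Proof. by apply: (measurableT_comp (measurable_tnth l)); exact: measurable_funP. Qed.

(** [Z4] bounds an extended real, so it contains the integrability of the fourth power. *)
Lemma Lk2_coord l : Lk P 2 (z l).
Proof.
split; first exact: measurable_coord.
have mz : measurable_fun setT (fun w => z l w ^+ 4) by apply: measurable_funX; exact: measurable_coord.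
apply/integrableP; split; first exact/measurable_EFinP.
have := Z4 l; rewrite unlock => zC.
apply: (le_lt_trans _ (ltry C)); apply: le_trans zC.
rewrite le_eqVlt; apply/orP; left; apply/eqP; apply: eq_integral => w _ /=.
by rewrite ger0_norm// (expr_double_ge0 2).
Qed.

Lemma intg_coord l : intg P (z l).
Proof. by apply: Lk1_intg; apply: Lk1; exact: Lk2_coord. Qed.

Lemma Ex_coord l : E (z l) = 0.
Proof. by have := Zmean l; rewrite unlock /Ex /Rintegral mxE => ->. Qed.

Lemma Ex_coordM l1 l2 : E (fun w => z l1 w * z l2 w) = (l1 == l2)%:R.
Proof.
have := Zcov l1 l2; rewrite covariance.unlock !expectation.unlock mxE.
have e l : fine (\int[P]_w (tnth (Z w) l)%:E) = 0 by exact: Ex_coord.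
rewrite !e /Ex /Rintegral => H.
rewrite -[RHS]/(fine ((l1 == l2)%:R)%:E) -H; congr fine; apply: eq_integral => w _ /=.
by rewrite !fctE /= !subr0.
Qed.

Lemma Ex_coord4_le l : E (fun w => z l w ^+ 4) <= C.
Proof.
have := Z4 l; rewrite unlock /Ex /Rintegral => zC.
have [_ i4] := Lk2_coord l.
by rewrite -lee_fin fineK//; exact: integrable_fin_num i4.
Qed.

(** An index that occurs only once contributes the factor E z_i = 0. The product rule wants distinct
    indices, so the factors are regrouped over the support A of the multiplicity function e. *)
Lemma Ex_single i j k l : i != j -> i != k -> i != l ->
  E (fun w => (z i w * z j w) * (z k w * z l w)) = 0.
Proof.
move=> ij ik il.
pose e (u : 'I_m) := ((i == u) + (j == u) + (k == u) + (l == u))%N.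
pose A := [set u | e u != 0%N]%SET.
have ei : e i = 1%N.
  by rewrite /e eqxx !(eq_sym _ i) (negbTE ij) (negbTE ik) (negbTE il).
have iA : i \in A by rewrite inE ei.
have prodE w : (z i w * z j w) * (z k w * z l w) = \prod_(u in A) z u w ^+ e u.
  have one (v : 'I_m) : \prod_u z u w ^+ (v == u) = z v w.
    rewrite (bigD1 v)//= eqxx expr1 big1 ?mulr1// => u uv.
    by rewrite eq_sym (negbTE uv) expr0.
  transitivity (\prod_u z u w ^+ e u).
    rewrite -(one i) -(one j) -(one k) -(one l) -!big_split /=.
    by apply: eq_bigr => u _; rewrite !exprD mulrA.
  rewrite [LHS](bigID (mem A)) /= [X in _ * X]big1 ?mulr1// => u.
  by rewrite inE negbK => /eqP ->; rewrite expr0.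
have esum : (\sum_u e u = 4)%N.
  have one (v : 'I_m) : (\sum_u (v == u) = 1)%N.
    by rewrite (bigD1 v)//= eqxx big1// => u uv; rewrite eq_sym (negbTE uv).
  by rewrite /e !big_split /= !one.
have eA : (\sum_(u in A) e u = 4)%N.
  rewrite -esum [RHS](bigID (mem A)) /= [X in (_ + X)%N]big1 ?addn0// => u.
  by rewrite inE negbK => /eqP.
have s0 : (0 < #|A|)%N by apply/card_gt0P; exists i.
have a0 (a : 'I_#|A|) : (0 < e (enum_val a))%N.
  by have := enum_valP a; rewrite inE lt0n.
have e4 u : (e u <= 4)%N by rewrite -esum (bigD1 u)//= leq_addr.
have iZ u n : (n <= 4)%N -> intg P (fun w => z u w ^+ n).
  have [mz i4] := Lk2_coord u.
  move=> n4; apply: (@intg_le _ _ _ _ _ (fun w => 1 + z u w ^+ 4)).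
  - exact: measurable_funX.
  - move=> w; rewrite normrX -(ger0_norm (expr_double_ge0 2 (z u w))) normrX.
    have := normr_ge0 (z u w); move: `|z u w| => t t0.
    have [t1|/ltW t1] := leP t 1.
      by rewrite (@le_trans _ _ 1) ?exprn_ile1// lerDl exprn_ge0.
    by rewrite (@le_trans _ _ (t ^+ 4)) ?ler_weXn2l// lerDr.
  - by apply: intgD => //; exact: intg_cst.
have := @Zmom #|A| enum_val (fun a => e (enum_val a)) s0 enum_val_inj a0.
have -> : (\sum_(a < #|A|) e (enum_val a) = 4)%N by rewrite -eA [RHS]big_enum_val.
move=> /(_ isT (fun a => iZ _ _ (e4 _))); rewrite expectation.unlock => H.
rewrite (eq_Ex _ prodE) /Ex /Rintegral.
under eq_integral do rewrite big_enum_val.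
rewrite H.
have ia : enum_rank_in iA i \in 'I_#|A| by [].
rewrite (bigD1 (enum_rank_in iA i))//= enum_rankK_in// ei.
under eq_integral do rewrite expr1.
have -> : (\int[P]_x (tnth (Z x) i)%:E = 0)%E by have := Zmean i; rewrite expectation.unlock mxE.
by rewrite mul0e.
Qed.

(** A fourth-order moment survives only if its indices match in pairs, and it is then at most C. The
    three ways of pairing four indices give the factor 3, and each contributes the square of the sum
    of the u_i^2. *)
Lemma Ex_lin4 (u : 'I_m -> R) :
  E (fun w => (\sum_i u i * z i w) ^+ 4) <= 3 * C * (\sum_i u i ^+ 2) ^+ 2.
Proof.
pose zz i j k l w := (z i w * z j w) * (z k w * z l w).
have izz i j k l : intg P (zz i j k l) by apply: Lk1M; apply: Lk2M; exact: Lk2_coord.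
pose dl (i j : 'I_m) : R := (i == j)%:R.
(* Where a pairing holds, the product of the u's is a square, so the bound on the moment keeps its
   direction; if all four indices agree the right side counts the term three times. *)
have bound i j k l : u i * u j * (u k * u l) * E (zz i j k l) <=
    C * ((dl i j * dl k l + (dl i k * dl j l + dl i l * dl j k)) * (u i * u j * (u k * u l))).
  have sq a b : E (fun w => z a w ^+ 2 * z b w ^+ 2) <= C.
    have [_ ia] := Lk2_coord a; have [_ ib] := Lk2_coord b.
    apply: (@le_trans _ _ (E (fun w => 2^-1 * (z a w ^+ 4 + z b w ^+ 4)))).
      apply: Ex_le; [|by apply: intgZ; exact: intgD|].
        have := izz a a b b; congr intg; apply/funext => w; rewrite /zz; ring.
      move=> w; have := sqr_ge0 (z a w ^+ 2 - z b w ^+ 2).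
      rewrite (exprM _ 2 2) (exprM (z b w) 2 2); move: (z a w ^+ 2) (z b w ^+ 2) => s t; nra.
    rewrite ExZ; last exact: intgD.
    by rewrite ExD//; have := Ex_coord4_le a; have := Ex_coord4_le b; lra.
  have C0 : 0 <= C by apply: le_trans (sq i i); apply: Ex_ge0 => w; rewrite mulr_ge0 ?sqr_ge0.
  have pair a b : E (zz i j k l) = E (fun w => z a w ^+ 2 * z b w ^+ 2) -> E (zz i j k l) <= C.
    by move=> ->.
  have fin (v e n : R) : 0 <= v -> e <= C -> 1 <= n -> v * e <= C * (n * v).
    move=> v0 eC n1; apply: (@le_trans _ _ (v * C)); first by rewrite ler_wpM2l.
    by rewrite mulrC ler_wpM2l// ler_peMl.
  rewrite /dl; have [ij|ij] := eqVneq i j.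
    subst j; have [kl|kl] := eqVneq k l.
      subst l; apply: fin.
      - by rewrite -!expr2 mulr_ge0 ?sqr_ge0.
      - by apply: (pair i k); apply: eq_Ex => w; rewrite /zz; ring.
      - by rewrite mulr1 lerDl addr_ge0// mulr_ge0 ?ler0n.
    have -> : E (zz i i k l) = 0.
      have [ki|ki] := eqVneq k i.
        subst k; rewrite -(@Ex_single l i i i) 1?eq_sym//.
        by apply: eq_Ex => w; rewrite /zz; ring.
      rewrite -(@Ex_single k i i l)//.
      by apply: eq_Ex => w; rewrite /zz; ring.
    rewrite mulr0 mulr0 add0r; have [ik|ik] := eqVneq i k.
      by subst k; rewrite (negbTE kl) mulr0 mul0r addr0 mul0r mulr0.
    by rewrite mul0r mulr0 addr0 mul0r mulr0.
  rewrite mul0r add0r; have [ik|ik] := eqVneq i k.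
    subst k; have [jl|jl] := eqVneq j l.
      subst l; rewrite (negbTE ij) mul0r addr0 mulr1; apply: fin => //.
      - by rewrite mulrCA -!mulrA mulrA -!expr2 (_ : _ * _ = (u i * u j) ^+ 2) ?sqr_ge0//; ring.
      - by apply: (pair i j); apply: eq_Ex => w; rewrite /zz; ring.
    have -> : E (zz i j i l) = 0.
      have ji : j != i by rewrite eq_sym.
      rewrite -(Ex_single ji ji jl).
      by apply: eq_Ex => w; rewrite /zz; ring.
    by rewrite !mulr0 (eq_sym j i) (negbTE ij) mulr0 addr0 mul0r mulr0.
  rewrite mul0r add0r; have [il|il] := eqVneq i l.
    subst l; have [jk|jk] := eqVneq j k.
      subst k; rewrite mulr1; apply: fin => //.
      - by rewrite (_ : _ * _ = (u i * u j) ^+ 2) ?sqr_ge0//; ring.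
      - by apply: (pair i j); apply: eq_Ex => w; rewrite /zz; ring.
    have -> : E (zz i j k i) = 0.
      have ji : j != i by rewrite eq_sym.
      rewrite -(Ex_single ji jk ji).
      by apply: eq_Ex => w; rewrite /zz; ring.
    by rewrite !mulr0 mul0r mulr0.
  have -> : E (zz i j k l) = 0 by exact: Ex_single.
  by rewrite !mulr0 !mul0r mulr0.
have -> : E (fun w => (\sum_i u i * z i w) ^+ 4) =
    \sum_i \sum_j \sum_k \sum_l u i * u j * (u k * u l) * E (zz i j k l).
  have iu i j k l : intg P (fun w => u i * u j * (u k * u l) * zz i j k l w) by exact: intgZ.
  rewrite (eq_Ex _ (g := fun w => \sum_i \sum_j \sum_k \sum_l u i * u j * (u k * u l) * zz i j k l w)).
    rewrite Ex_sum => [|i _]; last by do 3 (apply: intg_sum => ? _).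
    apply: eq_bigr => i _; rewrite Ex_sum => [|j _]; last by do 2 (apply: intg_sum => ? _).
    apply: eq_bigr => j _; rewrite Ex_sum => [|k _]; last by apply: intg_sum => ? _.
    apply: eq_bigr => k _; rewrite Ex_sum => [|l _//].
    by apply: eq_bigr => l _; rewrite ExZ.
  move=> w; rewrite (exprM _ 2 2) !expr2 [in X in X * _]big_distrlr /= [in X in _ * X]big_distrlr /=.
  rewrite mulr_suml; apply: eq_bigr => i _; rewrite mulr_suml; apply: eq_bigr => j _.
  rewrite mulr_sumr; apply: eq_bigr => k _; rewrite mulr_sumr; apply: eq_bigr => l _.
  by rewrite /zz; ring.
apply: (@le_trans _ _ (\sum_i \sum_j \sum_k \sum_l
  C * ((dl i j * dl k l + (dl i k * dl j l + dl i l * dl j k)) * (u i * u j * (u k * u l))))).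
  by do 4 (apply: ler_sum => ? _).
have collapse (i : 'I_m) (F : 'I_m -> R) : \sum_j dl i j * F j = F i.
  rewrite (bigD1 i)//= /dl eqxx mul1r big1 ?addr0// => j ji.
  by rewrite eq_sym (negbTE ji) mul0r.
rewrite le_eqVlt; apply/orP; left; apply/eqP.
rewrite expr2 big_distrlr /= mulr_sumr; apply: eq_bigr => i _.
rewrite (eq_bigr (fun j => dl i j * (\sum_k \sum_l dl k l * (C * (u i * u j * (u k * u l)))) +
   (\sum_k dl i k * (\sum_l dl j l * (C * (u i * u j * (u k * u l)))) +
    \sum_k dl j k * (\sum_l dl i l * (C * (u i * u j * (u k * u l))))))).
  rewrite !big_split /= collapse.
  under eq_bigr do rewrite collapse.
  under [X in _ + (X + _)]eq_bigr do rewrite collapse collapse.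
  under [X in _ + (_ + X)]eq_bigr do rewrite collapse collapse.
  rewrite -!big_split mulr_sumr /=; apply: eq_bigr => j _; ring.
move=> j _; rewrite mulr_sumr -!big_split /=; apply: eq_bigr => k _.
rewrite !mulr_sumr -!big_split /=; apply: eq_bigr => l _.
ring.
Qed.

End linear_model_moments.

(** The trace is the sum of the squared entries of [A^T *m B]. *)
Lemma mxtrace_gram_ge0 (R : realType) p q r (A : 'M[R]_(p, q)) (B : 'M[R]_(p, r)) :
  0 <= \tr (A *m A^T *m (B *m B^T)).
Proof.
rewrite mulmxA mxtrace_mulC !mulmxA -mulmxA.
rewrite -[A^T *m B]trmxK trmx_mul trmxK.
apply: sumr_ge0 => i _; rewrite mxE; apply: sumr_ge0 => j _.
by rewrite [X in _ * X]mxE -expr2 sqr_ge0.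
Qed.

Section gram_forms.
Context d (T : measurableType d) (R : realType) (P : probability T R).
Variables (p q : nat) (Y : 'I_p -> T -> R) (S : 'M[R]_p) (C : R) (Gam : 'M[R]_(p, q)).
Hypothesis Y4 : forall i, Lk P 2 (Y i).
Hypothesis EYY : forall i j, Ex P (fun x => Y i x * Y j x) = S i j.
Hypothesis EY4 : forall v : 'I_p -> R,
  Ex P (fun x => (\sum_i v i * Y i x) ^+ 4) <=
  C * (\sum_i \sum_j S i j * (v i * v j)) ^+ 2.
Hypothesis C0 : 0 <= C.

Local Notation E := (Ex P).

Lemma Ex_lin_sq (v : 'I_p -> R) :
  E (fun x => (\sum_i v i * Y i x) ^+ 2) = \sum_i \sum_j S i j * (v i * v j).
Proof.
have iY i j : intg P (fun x => v i * v j * (Y i x * Y j x)) by apply: intgZ; exact: Lk2_intgM.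
rewrite (eq_Ex _ (g := fun x => \sum_i \sum_j v i * v j * (Y i x * Y j x))); last first.
  move=> x; rewrite expr2 big_distrlr /=; apply: eq_bigr => i _; apply: eq_bigr => j _; ring.
rewrite Ex_sum => [|i _]; last by apply: intg_sum => j _.
apply: eq_bigr => i _; rewrite Ex_sum => [|j _//]; apply: eq_bigr => j _.
by rewrite ExZ ?EYY 1?mulrC//; exact: Lk2_intgM.
Qed.

Let col s i := Gam i s.

Let tr_cols : \tr (Gam *m Gam^T *m S) = \sum_s \sum_i \sum_j S i j * (col s i * col s j).
Proof.
rewrite /mxtrace [RHS]exchange_big /=; apply: eq_bigr => i _.
rewrite mxE [RHS]exchange_big /=; apply: eq_bigr => j _.
rewrite mxE mulr_suml; apply: eq_bigr => s _; rewrite mxE.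
by rewrite -!EYY /col; under eq_Ex do rewrite mulrC; ring.
Qed.

(** The quadratic form is a sum, over the columns of Gam, of squares of linear forms in Y. [EY4]
    bounds the L^2 norm of each square by its mean, Minkowski's inequality adds them up, and the
    means sum to the trace. *)
Lemma Ex_gram_qf_sq :
  E (fun x => qf (Gam *m Gam^T) Y x ^+ 2) <= C * \tr (Gam *m Gam^T *m S) ^+ 2.
Proof.
have qfE x : qf (Gam *m Gam^T) Y x = \sum_s 1 * (\sum_i col s i * Y i x) ^+ 2.
  rewrite /qf; transitivity (\sum_i \sum_j \sum_s col s i * Y i x * (col s j * Y j x)).
    apply: eq_bigr => i _; apply: eq_bigr => j _; rewrite mxE mulr_suml.
    by apply: eq_bigr => s _; rewrite mxE /col; ring.
  under eq_bigr do rewrite exchange_big /=.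
  rewrite exchange_big /=; apply: eq_bigr => s _.
  by rewrite mul1r expr2 big_distrlr.
have Llin s : Lk P 2 (fun x => \sum_i col s i * Y i x) by apply: Lk_sum => i _; exact: LkZ.
under eq_Ex do rewrite qfE.
rewrite tr_cols (eq_bigr (fun s => 1 * \sum_i \sum_j S i j * (col s i * col s j))); last by move=> s _; rewrite mul1r.
apply: Ex_sq_sum_le => // s.
- by rewrite -Ex_lin_sq; apply: Ex_ge0 => x; exact: sqr_ge0.
- by under eq_fun do rewrite expr2; exact: Lk2M.
- by under eq_Ex do rewrite -exprM; exact: EY4.
Qed.

End gram_forms.

Section linear_model.
Context d (T : measurableType d) (R : realType) (P : probability T R).
Variables (p m : nat) (Z : {RV P >-> m.-tuple R}) (C : R).
Variables (Gam : 'M[R]_(p, m)) (Y : 'I_p -> T -> R).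
Hypothesis Zmean : has_mean P Z 0.
Hypothesis Zcov : has_covariance P Z 1%:M.
Hypothesis Zmom : product_moments P Z 8.
Hypothesis Z4 : forall l, ('E_P[fun w => (tnth (Z w) l ^+ 4)%R] <= C%:E)%E.
Hypothesis YE : forall i w, Y i w = \sum_l Gam i l * tnth (Z w) l.

Local Notation E := (Ex P).

Lemma model_Lk2 i : Lk P 2 (Y i).
Proof.
rewrite (funext (YE i)); apply: Lk_sum => l _; apply: LkZ; exact: Lk2_coord Z4 l.
Qed.

Lemma model_mean i : E (Y i) = 0.
Proof.
have iz l := intg_coord Z4 l.
rewrite (eq_Ex _ (YE i)) Ex_sum => [|l _]; last exact: intgZ.
by rewrite big1// => l _; rewrite ExZ// Ex_coord// mulr0.
Qed.

Lemma model_cov i j : E (fun w => Y i w * Y j w) = (Gam *m Gam^T) i j.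
Proof.
have izz l k : intg P (fun w => tnth (Z w) l * tnth (Z w) k).
  by apply: Lk2_intgM; exact: Lk2_coord Z4 _.
rewrite (eq_Ex _ (g := fun w => \sum_l \sum_k Gam i l * Gam j k * (tnth (Z w) l * tnth (Z w) k))); last first.
  move=> w; rewrite !YE big_distrlr /=; apply: eq_bigr => l _; apply: eq_bigr => k _; ring.
rewrite Ex_sum => [|l _]; last by apply: intg_sum => k _; exact: intgZ.
rewrite mxE; apply: eq_bigr => l _; rewrite Ex_sum => [|k _]; last exact: intgZ.
rewrite (bigD1 l)//= ExZ// Ex_coordM// eqxx mulr1 mxE big1 ?addr0// => k kl.
by rewrite ExZ// Ex_coordM// eq_sym (negbTE kl) mulr0.
Qed.

(** A linear form in Y is one in Z with coefficients u = Gam' v, and the sum of the u_l^2 is the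
    quadratic form of Gam Gam' at v. *)
Lemma model_fourth (v : 'I_p -> R) : E (fun w => (\sum_i v i * Y i w) ^+ 4) <=
  3 * C * (\sum_i \sum_j (Gam *m Gam^T) i j * (v i * v j)) ^+ 2.
Proof.
pose u l := \sum_i v i * Gam i l.
have -> : \sum_i \sum_j (Gam *m Gam^T) i j * (v i * v j) = \sum_l u l ^+ 2.
  transitivity (\sum_i \sum_j \sum_l (v i * Gam i l) * (v j * Gam j l)).
    apply: eq_bigr => i _; apply: eq_bigr => j _; rewrite mxE mulr_suml.
    by apply: eq_bigr => l _; rewrite mxE; ring.
  under eq_bigr do rewrite exchange_big /=.
  rewrite exchange_big /=; apply: eq_bigr => l _.
  by rewrite expr2 big_distrlr.
apply: le_trans (Ex_lin4 Zmean Zmom Z4 u).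
rewrite le_eqVlt; apply/orP; left; apply/eqP; apply: eq_Ex => w; congr (_ ^+ 4).
transitivity (\sum_i \sum_l v i * Gam i l * tnth (Z w) l).
  by apply: eq_bigr => i _; rewrite YE mulr_sumr; apply: eq_bigr => l _; rewrite mulrA.
by rewrite exchange_big /=; apply: eq_bigr => l _; rewrite mulr_suml.
Qed.

End linear_model.

(** * The centered statistic as a quadratic form plus a linear form *)

Section statistic.
Variables (R : realType) (k : nat) (N : 'I_k -> nat).
Hypothesis N2 : forall i, (2 <= N i)%N.
Local Notation I := {i : 'I_k & 'I_(N i)}.
Implicit Types a b : I.

(* Coefficient in the statistic of Y_a . Y_b, for an unordered pair of
   observations; subtracting tr S_i is what cancels the diagonal. *)
Definition coef a b : R :=
  if tag a == tag b then
    if a == b then 0 else 2 * (k%:R - 1) / ((N (tag a))%:R * ((N (tag a))%:R - 1))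
  else - 2 / ((N (tag a))%:R * (N (tag b))%:R).

Lemma coef_sym a b : coef a b = coef b a.
Proof.
rewrite /coef (eq_sym (tag b)) (eq_sym b); case: eqP => [->//|_].
by rewrite [_%:R * _]mulrC.
Qed.

Lemma coef_diag a : coef a a = 0.
Proof. by rewrite /coef !eqxx. Qed.

Lemma big_group (F : forall i, 'I_(N i) -> R) :
  \sum_i \sum_(j < N i) F i j = \sum_(a : I) F (tag a) (tagged a).
Proof. by rewrite sig_big_dep. Qed.

Lemma sum_lt_sym (F : 'I_k -> 'I_k -> R) : (forall i j, F i j = F j i) -> (forall i, F i i = 0) ->
  \sum_(i < k) \sum_(j < k | (i < j)%N) F i j = (\sum_i \sum_j F i j) / 2.
Proof.
move=> Fs F0.
have -> : \sum_i \sum_j F i j =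
    \sum_(i < k) \sum_(j < k | (i < j)%N) F i j + \sum_(i < k) \sum_(j < k | (j < i)%N) F i j.
  rewrite -big_split /=; apply: eq_bigr => i _.
  rewrite (bigID (fun j : 'I_k => (i < j)%N)) /=; congr (_ + _).
  rewrite (bigD1 i) ?ltnn//= F0 add0r; apply: eq_bigl => j.
  by rewrite -leqNgt ltn_neqAle andbC.
have -> : \sum_(i < k) \sum_(j < k | (j < i)%N) F i j = \sum_(i < k) \sum_(j < k | (i < j)%N) F i j.
  rewrite (exchange_big_dep xpredT)//=; apply: eq_bigr => i _.
  by apply: eq_bigr => j _; exact: Fs.
by field.
Qed.

Let nz i : (N i)%:R != 0 :> R.
Proof. by rewrite pnatr_eq0 -lt0n ltnW. Qed.

Let n1z i : (N i)%:R - 1 != 0 :> R.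
Proof. by rewrite subr_eq0 pnatr_eq1 gtn_eqF. Qed.

(** Norms and traces are sums over coordinates, so the decomposition is an identity for one
    coordinate. Both sides are reduced to sums over groups of the means mu i, u i and of the
    within-group sums s i and Q i. *)
Lemma scalar_statistic (mu : 'I_k -> R) (y : forall i, 'I_(N i) -> R)
    (x := fun i j => y i j + mu i) (xb := fun i => (N i)%:R^-1 * \sum_(j < N i) x i j) :
  \sum_(i < k) \sum_(j < k | (i < j)%N) (xb i - xb j) ^+ 2
  - (k%:R - 1) * \sum_i (N i)%:R^-1 * (((N i)%:R - 1)^-1 * \sum_(j < N i) (x i j - xb i) ^+ 2)
  - \sum_(i < k) \sum_(j < k | (i < j)%N) (mu i - mu j) ^+ 2 =
  2^-1 * (\sum_(a : I) y (tag a) (tagged a) * \sum_(b : I) coef a b * y (tag b) (tagged b)) +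
  \sum_(a : I) y (tag a) (tagged a) * (2 / (N (tag a))%:R * \sum_j (mu (tag a) - mu j)).
Proof.
pose s i := \sum_(j < N i) y i j; pose Q i := \sum_(j < N i) y i j ^+ 2.
pose u i := s i / (N i)%:R.
have xbE i : xb i = u i + mu i.
  rewrite /xb /x big_split /= sumr_const card_ord -/(s i) -[mu i *+ _]mulr_natl /u.
  by field.
have varE i : \sum_(j < N i) (x i j - xb i) ^+ 2 = Q i - s i ^+ 2 / (N i)%:R.
  rewrite (eq_bigr (fun j => y i j ^+ 2 - (2 * u i * y i j - u i ^+ 2))); last first.
    by move=> j _; rewrite xbE /x; ring.
  rewrite sumrB sumrB -mulr_sumr sumr_const card_ord -mulr_natl -/(s i) -/(Q i) /u.
  by field.
have -> : \sum_(i < k) \sum_(j < k | (i < j)%N) (xb i - xb j) ^+ 2 -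
   (k%:R - 1) * \sum_i (N i)%:R^-1 * (((N i)%:R - 1)^-1 * \sum_(j < N i) (x i j - xb i) ^+ 2) -
   \sum_(i < k) \sum_(j < k | (i < j)%N) (mu i - mu j) ^+ 2 =
   \sum_(i < k) \sum_(j < k | (i < j)%N) (2 * (mu i - mu j) * (u i - u j) + (u i - u j) ^+ 2) -
   (k%:R - 1) * \sum_i (N i)%:R^-1 * (((N i)%:R - 1)^-1 * (Q i - s i ^+ 2 / (N i)%:R)).
  under [X in _ - _ * X - _]eq_bigr do rewrite varE.
  rewrite addrAC; congr (_ - _); rewrite -sumrB; apply: eq_bigr => i _.
  by rewrite -sumrB; apply: eq_bigr => j _; rewrite !xbE; ring.
rewrite sum_lt_sym => [|i j|i]; [|ring|ring].
pose U := \sum_i u i; pose U2 := \sum_i u i ^+ 2.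
pose M1 := \sum_i mu i; pose MU := \sum_i mu i * u i.
have A1 : \sum_i \sum_j (2 * (mu i - mu j) * (u i - u j) + (u i - u j) ^+ 2) =
    4 * (k%:R * MU - M1 * U) + 2 * (k%:R * U2 - U ^+ 2).
  rewrite (eq_bigr (fun i => (2 * k%:R) * (mu i * u i) - 2 * U * mu i - 2 * M1 * u i + 2 * MU +
     (k%:R * u i ^+ 2 - 2 * U * u i + U2))).
    rewrite !big_split /= !sumrN -!mulr_sumr !sumr_const !card_ord -/U -/U2 -/M1 -/MU.
    by rewrite -[MU *+ _]mulr_natl -[U2 *+ _]mulr_natl; ring.
  move=> i _; rewrite (eq_bigr (fun j => (2 * (mu i * u i) + u i ^+ 2) - 2 * (mu i + u i) * u j -
     2 * u i * mu j + 2 * (mu j * u j) + u j ^+ 2)); last by move=> j _; ring.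
  rewrite !big_split /= !sumrN -!mulr_sumr !sumr_const !card_ord -/U -/U2 -/M1 -/MU.
  by rewrite -[(N i)%:R^-1 *+ k]mulr_natl /u; ring.
pose al i : R := 2 * (k%:R - 1) / ((N i)%:R * ((N i)%:R - 1)).
(* The own group contributes its sum without y_a, because the diagonal coefficient is zero; every
   other group contributes a multiple of its mean u. *)
have rowE a : \sum_(b : I) coef a b * y (tag b) (tagged b) =
    al (tag a) * (s (tag a) - y (tag a) (tagged a)) - 2 / (N (tag a))%:R * (U - u (tag a)).
  rewrite -(big_group (fun i j => coef a (Tagged (fun i => 'I_(N i)) j) * y i j)).
  rewrite (bigD1 (tag a))//=; congr (_ + _).
    rewrite /s [in RHS](bigD1 (tagged a))//= [y _ _ + _]addrC addrK mulr_sumr.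
    rewrite (bigD1 (tagged a))//= {1}/coef /= eqxx.
    rewrite eq_Tagged eqxx mul0r add0r; apply: eq_bigr => j ja; rewrite /coef /= eqxx.
    by rewrite eq_Tagged eq_sym (negbTE ja).
  rewrite /U [in RHS](bigD1 (tag a))//= [u _ + _]addrC addrK -mulNr mulr_sumr; apply: eq_bigr => i ia.
  rewrite (eq_bigr (fun j => - 2 / ((N (tag a))%:R * (N i)%:R) * y i j)).
    by rewrite -mulr_sumr -/(s i) /u; field; rewrite !nz.
  by move=> j _; rewrite /coef /= eq_sym (negbTE ia).
have A2 : \sum_(a : I) y (tag a) (tagged a) * \sum_(b : I) coef a b * y (tag b) (tagged b) =
    \sum_i al i * (s i ^+ 2 - Q i) - 2 * (U ^+ 2 - U2).
  under eq_bigr do rewrite rowE.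
  rewrite -(big_group (fun i j => y i j * (al i * (s i - y i j) - 2 / (N i)%:R * (U - u i)))).
  rewrite (eq_bigr (fun i => al i * (s i ^+ 2 - Q i) - (2 * U * u i - 2 * u i ^+ 2))).
    by rewrite !sumrB -!mulr_sumr -/U -/U2; ring.
  move=> i _; rewrite (eq_bigr (fun j => (al i * s i - 2 / (N i)%:R * (U - u i)) * y i j - al i * y i j ^+ 2)).
    rewrite sumrB -!mulr_sumr -/(s i) -/(Q i) (_ : s i = u i * (N i)%:R); last by rewrite /u divfK.
    by field.
  by move=> j _; ring.
have A3 : \sum_(a : I) y (tag a) (tagged a) * (2 / (N (tag a))%:R * \sum_j (mu (tag a) - mu j)) =
    2 * (k%:R * MU - M1 * U).
  rewrite -(big_group (fun i j => y i j * (2 / (N i)%:R * \sum_j (mu i - mu j)))).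
  rewrite (eq_bigr (fun i => 2 * k%:R * (mu i * u i) - 2 * M1 * u i)).
    by rewrite sumrB -!mulr_sumr -/U -/MU; ring.
  move=> i _; rewrite -mulr_suml -/(s i) sumrB sumr_const card_ord -[mu i *+ _]mulr_natl -/M1 /u.
  by field.
(* Within a group, the squared mean minus the estimated variance of the mean is the sum over ordered
   pairs of distinct observations, divided by N (N - 1). *)
have A4 : \sum_i al i * (s i ^+ 2 - Q i) = 2 * (k%:R - 1) * U2 -
   2 * ((k%:R - 1) * \sum_i (N i)%:R^-1 * (((N i)%:R - 1)^-1 * (Q i - s i ^+ 2 / (N i)%:R))).
  rewrite mulrA /U2 !mulr_sumr -sumrB; apply: eq_bigr => i _; rewrite /al /u.
  by field; rewrite nz n1z.
by rewrite A1 A2 A3 A4; field.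
Qed.

Lemma T_stat_coordinates (p : nat) (x : forall i, 'I_(N i) -> 'cV[R]_p)
    (xb := fun i l => (N i)%:R^-1 * \sum_(j < N i) x i j l 0) :
  T_stat x = \sum_l (\sum_(i < k) \sum_(j < k | (i < j)%N) (xb i l - xb j l) ^+ 2
  - (k%:R - 1) * \sum_i (N i)%:R^-1 * (((N i)%:R - 1)^-1 * \sum_(j < N i) (x i j l 0 - xb i l) ^+ 2)).
Proof.
have meanE i l : sample_mean (x i) l 0 = xb i l by rewrite /sample_mean mxE summxE.
have subE (u v : 'cV[R]_p) l : (u - v) l 0 = u l 0 - v l 0 by rewrite !mxE.
have dotE (v : 'cV[R]_p) : (v^T *m v) 0 0 = \sum_l v l 0 ^+ 2.
  by rewrite mxE; apply: eq_bigr => l _; rewrite mxE.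
rewrite sumrB; congr (_ - _).
  rewrite [RHS]exchange_big /=; apply: eq_bigr => i _.
  rewrite [RHS]exchange_big /=; apply: eq_bigr => j _.
  by rewrite dotE; apply: eq_bigr => l _; rewrite subE !meanE.
rewrite -mulr_sumr; congr (_ * _); rewrite [RHS]exchange_big /=; apply: eq_bigr => i _.
rewrite -mulr_sumr; congr (_ * _); rewrite /sample_cov linearZ /= -mulr_sumr; congr (_ * _).
rewrite linear_sum /= [RHS]exchange_big /=; apply: eq_bigr => j _.
rewrite mxtrace_mulC trace_mx11 dotE; apply: eq_bigr => l _.
by rewrite subE meanE.
Qed.

Lemma T_stat_decomposition (p : nat) (mu : 'I_k -> 'cV[R]_p) (x : forall i, 'I_(N i) -> 'cV[R]_p)
    (y := fun (a : I) l => x (tag a) (tagged a) l 0 - mu (tag a) l 0) :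
  T_stat x - \sum_(i < k) \sum_(j < k | (i < j)%N) euclidean_norm (mu i - mu j) ^+ 2 =
  2^-1 * (\sum_a \sum_l y a l * \sum_b coef a b * y b l) +
  \sum_a \sum_l y a l * (2 / (N (tag a))%:R * \sum_j (mu (tag a) l 0 - mu j l 0)).
Proof.
have -> : \sum_(i < k) \sum_(j < k | (i < j)%N) euclidean_norm (mu i - mu j) ^+ 2 =
    \sum_l \sum_(i < k) \sum_(j < k | (i < j)%N) (mu i l 0 - mu j l 0) ^+ 2.
  rewrite [RHS]exchange_big /=; apply: eq_bigr => i _.
  rewrite [RHS]exchange_big /=; apply: eq_bigr => j _.
  rewrite sqr_sqrtr; first by apply: eq_bigr => l _; rewrite !mxE.
  by apply: sumr_ge0 => l _; exact: sqr_ge0.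
rewrite T_stat_coordinates -sumrB [X in _ = 2^-1 * X + _]exchange_big /= mulr_sumr.
rewrite [X in _ = _ + X]exchange_big /= -big_split /=.
apply: eq_bigr => l _.
pose z i (j : 'I_(N i)) := x i j l 0 - mu i l 0.
have zE i j : z i j + mu i l 0 = x i j l 0 by rewrite /z subrK.
have sE i : \sum_(j < N i) (z i j + mu i l 0) = \sum_(j < N i) x i j l 0.
  by apply: eq_bigr => j _.
rewrite -(scalar_statistic (fun i => mu i l 0) z); congr (_ - _ * _ - _).
  by apply: eq_bigr => i _; apply: eq_bigr => j _; rewrite !sE.
apply: eq_bigr => i _; congr (_ * (_ * _)); apply: eq_bigr => j _.
by rewrite zE sE.
Qed.

End statistic.

(** * Orders of magnitude of the coefficients and of the row sums *)

Section coef_bounds.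
Variables (R : realType) (k : nat) (N : 'I_k -> nat) (delta : R).
Local Notation I := {i : 'I_k & 'I_(N i)}.
Let n : R := (\sum_i N i)%N%:R.
Hypothesis k2 : (2 <= k)%N.
Hypothesis N2 : forall i, (2 <= N i)%N.
Hypothesis delta0 : 0 < delta.
Hypothesis Ndelta : forall i, delta * n <= (N i)%:R.
Implicit Types a b : I.

Local Notation c a b := (coef R a b).

Let N_gt0 i : 0 < (N i)%:R :> R.
Proof. by rewrite ltr0n ltnW. Qed.

Let N_le i : (N i)%:R <= n.
Proof. by rewrite /n ler_nat (bigD1 i)//= leq_addr. Qed.

Let n_gt0 : 0 < n.
Proof. exact: lt_le_trans (N_gt0 (Ordinal (ltnW k2))) (N_le _). Qed.

Let k2R : 2 <= k%:R :> R.
Proof. by rewrite ler_nat. Qed.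

Let N2R i : 2 <= (N i)%:R :> R.
Proof. by rewrite ler_nat. Qed.

Let dn_gt0 : 0 < delta * n.
Proof. by rewrite mulr_gt0. Qed.

(** The factor 4 k covers both cases: between groups the numerator is 2, and within a group [N >= 2]
    gives 2 (k - 1) / (N (N - 1)) <= 4 (k - 1) / N^2. *)
Lemma coef_sqr_le a b : c a b ^+ 2 <= (4 * k%:R / delta ^+ 2) ^+ 2 / n ^+ 4.
Proof.
have H : `|c a b| <= 4 * k%:R / delta ^+ 2 / n ^+ 2.
  have NN i j : (delta * n) ^+ 2 <= (N i)%:R * (N j)%:R.
    by rewrite expr2 ler_pM// ltW.
  have -> : 4 * k%:R / delta ^+ 2 / n ^+ 2 = 4 * k%:R / (delta * n) ^+ 2.
    by field; rewrite !gt_eqF.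
  rewrite /coef; case: ifP => [ab|_]; last first.
    rewrite normrM normrN normfV !gtr0_norm ?mulr_gt0//.
    apply: ler_pM => //.
    - by move: k2R; lra.
        by rewrite lef_pV2 ?posrE ?mulr_gt0 ?exprn_gt0.
  case: ifP => _; first by rewrite normr0 divr_ge0 ?sqr_ge0// mulr_ge0.
  have n1 : 1 <= (N (tag a))%:R - 1 :> R by have := N2R (tag a); lra.
  rewrite ger0_norm; last by rewrite divr_ge0 ?mulr_ge0 ?subr_ge0//; move: k2R; lra.
  rewrite ler_pdivrMr ?mulr_gt0//; last by lra.
  rewrite mulrAC ler_pdivlMr ?exprn_gt0//.
  have h1 : (delta * n) ^+ 2 <= 2 * ((N (tag a))%:R * ((N (tag a))%:R - 1)).
    apply: (le_trans (NN (tag a) (tag a))); have := N2R (tag a); nra.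
  have D0 : 0 <= (delta * n) ^+ 2 by exact: sqr_ge0.
  have k0 : 0 <= k%:R :> R by [].
  have := ler_wpM2l k0 h1; move: D0; lra.
rewrite (_ : (4 * _ / _) ^+ 2 / n ^+ 4 = (4 * k%:R / delta ^+ 2 / n ^+ 2) ^+ 2).
  by rewrite -[leLHS]real_normK ?num_real// lerXn2r ?nnegrE// (le_trans _ H).
by field; rewrite !gt_eqF.
Qed.

Lemma coef_sqr_ge a b : a != b -> 4 / n ^+ 4 <= c a b ^+ 2.
Proof.
move=> ab.
have NN i j : (N i)%:R * (N j)%:R <= n ^+ 2 by rewrite expr2 ler_pM// ltW.
have H : 2 / n ^+ 2 <= `|c a b|.
  rewrite /coef (negbTE ab); case: ifP => _; last first.
    rewrite normrM normrN normfV !gtr0_norm ?mulr_gt0//.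
    by rewrite ler_pM2l// lef_pV2 ?posrE ?mulr_gt0 ?exprn_gt0.
  have n1 : 1 <= (N (tag a))%:R - 1 :> R by have := N2R (tag a); lra.
  rewrite ger0_norm; last by rewrite divr_ge0 ?mulr_ge0 ?subr_ge0//; move: k2R; lra.
  apply: ler_pM => //; first by rewrite invr_ge0 exprn_ge0// ltW.
    by move: k2R; lra.
  rewrite lef_pV2 ?posrE ?mulr_gt0 ?exprn_gt0//; last by lra.
  apply: le_trans (NN (tag a) (tag a)); have := N_gt0 (tag a); nra.
have -> : 4 / n ^+ 4 = (2 / n ^+ 2) ^+ 2 by field; rewrite !gt_eqF.
rewrite -[leRHS]real_normK ?num_real// lerXn2r ?nnegrE//.
by rewrite divr_ge0// sqr_ge0.
Qed.

Variable t : 'I_k -> 'I_k -> R.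
Hypothesis t_ge0 : forall i j, 0 <= t i j.
Let tau := \sum_i \sum_j t i j.

Definition row_sq a := \sum_b c a b ^+ 2 * t (tag a) (tag b).

Lemma row_sq_ge0 a : 0 <= row_sq a.
Proof. by apply: sumr_ge0 => b _; rewrite (mulr_ge0 (sqr_ge0 _)). Qed.

Let row_t i : \sum_(b : I) t i (tag b) = \sum_j (N j)%:R * t i j.
Proof.
rewrite -(big_group (fun j _ => t i j)); apply: eq_bigr => j _.
by rewrite sumr_const card_ord mulr_natl.
Qed.

Let row_t_le i : \sum_(b : I) t i (tag b) <= n * tau.
Proof.
rewrite row_t /tau [X in n * X](bigD1 i)//= mulrDr ler_wpDr//.
  by rewrite (mulr_ge0 (ltW n_gt0))// sumr_ge0// => j _; rewrite sumr_ge0.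
by rewrite mulr_sumr; apply: ler_sum => j _; rewrite ler_wpM2r.
Qed.

Lemma card_groups : #|{: I}|%:R = n.
Proof.
by rewrite card_tagged sumnE big_map big_enum /=; under eq_bigr do rewrite card_ord.
Qed.

(** No observation dominates: every row sum is at most a constant times tau / n^3, and there are n
    of them. *)
Lemma sum_row_sq_sqr :
  \sum_a row_sq a ^+ 2 <= (4 * k%:R / delta ^+ 2) ^+ 4 * (tau / n ^+ 2) ^+ 2 / n.
Proof.
set K := 4 * k%:R / delta ^+ 2.
have K0 : 0 <= K by rewrite divr_ge0 ?sqr_ge0 ?mulr_ge0.
have rle a : row_sq a <= K ^+ 2 * tau / n ^+ 3.
  apply: (@le_trans _ _ (K ^+ 2 / n ^+ 4 * \sum_b t (tag a) (tag b))).
    rewrite mulr_sumr; apply: ler_sum => b _; rewrite ler_wpM2r//; exact: coef_sqr_le.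
  rewrite (_ : K ^+ 2 * tau / n ^+ 3 = K ^+ 2 / n ^+ 4 * (n * tau)).
    by rewrite ler_wpM2l ?row_t_le// divr_ge0 ?sqr_ge0// (expr_double_ge0 2).
  by field; rewrite gt_eqF.
apply: (@le_trans _ _ (\sum_(a : I) (K ^+ 2 * tau / n ^+ 3) ^+ 2)).
  apply: ler_sum => a _; rewrite lerXn2r ?nnegrE ?row_sq_ge0//.
  exact: le_trans (row_sq_ge0 a) (rle a).
rewrite sumr_const -mulr_natl card_groups le_eqVlt; apply/orP; left; apply/eqP.
by field; rewrite gt_eqF.
Qed.

Lemma sum_row_sq_ge : 2 * delta ^+ 2 * (tau / n ^+ 2) <= \sum_a row_sq a.
Proof.
have rge a : 4 / n ^+ 4 * (2^-1 * (delta * n) * \sum_j t (tag a) j) <= row_sq a.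
  apply: (@le_trans _ _ (\sum_(b | b != a) 4 / n ^+ 4 * t (tag a) (tag b))); last first.
    rewrite /row_sq [leRHS](bigD1 a)//= ler_wpDl ?(mulr_ge0 (sqr_ge0 _))//.
    apply: ler_sum => b ba; rewrite ler_wpM2r//; apply: coef_sqr_ge.
    by rewrite eq_sym.
  rewrite -mulr_sumr ler_wpM2l//; first by rewrite divr_ge0// (expr_double_ge0 2).
  have : \sum_(b : I) t (tag a) (tag b) = t (tag a) (tag a) + \sum_(b | b != a) t (tag a) (tag b).
    by rewrite (bigD1 a).
  rewrite row_t => e.
  (* Leaving out a itself loses at most half of the row, because its group has at least two
     observations; hence the factor [2^-1] above. *)
  have e1 : 2 * t (tag a) (tag a) <= \sum_j (N j)%:R * t (tag a) j.
    rewrite (bigD1 (tag a))//= ler_wpDr//; last by rewrite ler_wpM2r.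
    by apply: sumr_ge0 => j _; rewrite mulr_ge0// ltW.
  have e2 : delta * n * \sum_j t (tag a) j <= \sum_j (N j)%:R * t (tag a) j.
    by rewrite mulr_sumr; apply: ler_sum => j _; rewrite ler_wpM2r.
  by lra.
apply: le_trans (ler_sum _ (fun a _ => rge a)).
rewrite -(big_group (fun i _ => 4 / n ^+ 4 * (2^-1 * (delta * n) * \sum_j t i j))).
rewrite (_ : 2 * delta ^+ 2 * (tau / n ^+ 2) = \sum_i delta * n * (4 / n ^+ 4 * (2^-1 * (delta * n) * \sum_j t i j))).
  apply: ler_sum => i _; rewrite [leRHS]sumr_const card_ord -[leRHS]mulr_natl ler_wpM2r//.
  by rewrite !mulr_ge0 ?invr_ge0 ?(expr_double_ge0 2) ?(ltW delta0) ?(ltW n_gt0)// sumr_ge0.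
by rewrite -!mulr_sumr -/tau; field; rewrite gt_eqF.
Qed.

End coef_bounds.

(** * Asymptotics of the standardized statistic *)

Section linear_form.
Context d (T : measurableType d) (R : realType) (P : probability T R).
Variables (I : finType) (p : nat) (Y : I -> 'I_p -> T -> R).
Variables (H G : I -> set (set T)) (S : I -> 'M[R]_p).
Hypothesis mYown : forall a i, sub_measurable (H a) (Y a i).
Hypothesis mYother : forall a b i, b != a -> sub_measurable (G a) (Y b i).
Hypothesis product : forall a U V, sub_measurable (H a) U -> sub_measurable (G a) V ->
  intg P U -> intg P V ->
  intg P (fun x => U x * V x) /\ Ex P (fun x => U x * V x) = Ex P U * Ex P V.
Hypothesis Y4 : forall a i, Lk P 2 (Y a i).
Hypothesis EY : forall a i, Ex P (Y a i) = 0.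
Hypothesis EYY : forall a i j, Ex P (fun x => Y a i x * Y a j x) = S a i j.

Local Notation E := (Ex P).

Variable m : I -> 'I_p -> R.

Definition lform x := \sum_a \sum_i m a i * Y a i x.

Let iY a i : intg P (fun x => m a i * Y a i x).
Proof. by apply: intgZ; apply: Lk1_intg; exact: Lk1. Qed.

Let LA a : Lk P 2 (fun x => \sum_i m a i * Y a i x).
Proof. by apply: Lk_sum => i _; exact: LkZ. Qed.

Let EA a : E (fun x => \sum_i m a i * Y a i x) = 0.
Proof.
rewrite Ex_sum => [|i _//]; rewrite big1// => i _.
by rewrite ExZ ?EY ?mulr0//; apply: Lk1_intg; exact: Lk1.
Qed.

Lemma Lk2_lform : Lk P 2 lform.
Proof. by apply: Lk_sum => a _; exact: LA. Qed.

Lemma Ex_lform : E lform = 0.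
Proof. by rewrite Ex_sum => [|a _]; [rewrite big1|apply: Lk1_intg; exact: Lk1]. Qed.

Lemma Ex_lform_sq : E (fun x => lform x ^+ 2) = \sum_a \sum_i \sum_j S a i j * (m a i * m a j).
Proof.
have iAA a b : intg P (fun x => (\sum_i m a i * Y a i x) * (\sum_i m b i * Y b i x)).
  exact: Lk2_intgM.
rewrite (eq_Ex _ (g := fun x => \sum_a \sum_b (\sum_i m a i * Y a i x) * (\sum_i m b i * Y b i x))); last first.
  by move=> x; rewrite expr2 big_distrlr.
rewrite Ex_sum => [|a _]; last exact: intg_sum.
apply: eq_bigr => a _; rewrite Ex_sum => [|b _//]; rewrite (bigD1 a)//= big1 ?addr0 => [|b ba].
  by rewrite -(Ex_lin_sq (Y4 a) (EYY a)); apply: eq_Ex => x; rewrite expr2.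
have [_ ->] := @product a (fun x => \sum_i m a i * Y a i x) (fun x => \sum_i m b i * Y b i x)
  (sub_measurable_sum (fun i _ => sub_measurableZ _ (@mYown a i)))
  (sub_measurable_sum (fun i _ => sub_measurableZ _ (mYother _ ba)))
  (Lk1_intg (Lk1 (LA a))) (Lk1_intg (Lk1 (LA b))).
by rewrite EA mul0r.
Qed.

Lemma Ex_wform (c : I -> I -> R) : (forall a, c a a = 0) -> E (wform Y c) = 0.
Proof.
move=> c0.
have H1 a : intg P (dot Y a (gvec Y c a)) /\ E (dot Y a (gvec Y c a)) = 0.
  have g4 i : Lk P 2 (gvec Y c a i) by apply: Lk_sum => b _; exact: LkZ.
  have mc : sub_measurable (G a) (fun=> 1 : R) by exact: sub_measurable_cst.
  have := @Ex_dot _ _ _ _ _ _ _ _ _ mYown product Y4 EY a (gvec Y c a) (fun=> 1)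
    (fun i => gvec_sub mYother c0 i) mc.
  have e (f : T -> R) : (fun x => f x * 1) = f by apply/funext => x; rewrite mulr1.
  by rewrite e; apply=> i; rewrite e; apply: Lk1_intg; exact: Lk1.
rewrite /wform ExZ; last by apply: intg_sum => a _; have [] := H1 a.
rewrite Ex_sum => [|a _]; last by have [] := H1 a.
by rewrite big1 ?mulr0// => a _; have [] := H1 a.
Qed.

End linear_form.

Section single_index.
Context d (T : measurableType d) (R : realType) (P : probability T R).
Variables (k : nat) (N : 'I_k -> nat) (delta : R) (p : nat).
Local Notation I := {i : 'I_k & 'I_(N i)}.
Variables (Y : I -> 'I_p -> T -> R) (H G : I -> set (set T)) (S : 'I_k -> 'M[R]_p) (C : R).
Hypothesis k2 : (2 <= k)%N.
Hypothesis N2 : forall i, (2 <= N i)%N.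
Hypothesis delta0 : 0 < delta.
Let n : R := (\sum_i N i)%N%:R.
Hypothesis Ndelta : forall i, delta * n <= (N i)%:R.
Hypothesis mYown : forall a i, sub_measurable (H a) (Y a i).
Hypothesis mYother : forall a b i, b != a -> sub_measurable (G a) (Y b i).
Hypothesis product : forall a U V, sub_measurable (H a) U -> sub_measurable (G a) V ->
  intg P U -> intg P V ->
  intg P (fun x => U x * V x) /\ Ex P (fun x => U x * V x) = Ex P U * Ex P V.
Hypothesis Y4 : forall a i, Lk P 2 (Y a i).
Hypothesis EY : forall a i, Ex P (Y a i) = 0.
Hypothesis EYY : forall a i j, Ex P (fun x => Y a i x * Y a j x) = S (tag a) i j.
Hypothesis EY4 : forall a (v : 'I_p -> R),
  Ex P (fun x => (\sum_i v i * Y a i x) ^+ 4) <=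
  C * (\sum_i \sum_j S (tag a) i j * (v i * v j)) ^+ 2.
Hypothesis C0 : 0 <= C.
Let t i j := \tr (S i *m S j).
Hypothesis t_ge0 : forall i j, 0 <= t i j.
Hypothesis EYS : forall i b, Ex P (fun x => qf (S i) (Y b) x ^+ 2) <= C * t i (tag b) ^+ 2.
(** A single small parameter: (d) is used with the factor eta^2, the second moment of the linear
    part is at most eta^2 V0, and n is at least eta^-2. *)
Variable eta : R.
Hypothesis eta0 : 0 < eta.
Hypothesis eta_le : eta <= 1 / 12.
Hypothesis n_large : 1 <= eta ^+ 2 * n.
Hypothesis Seps : forall l e h,
  \tr (S l *m S e *m S l *m S h) <= eta ^+ 2 * (t l e * t l h).
Variable m : I -> 'I_p -> R.

Local Notation E := (Ex P).
Let c (a b : I) : R := coef R a b.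
Let T0 := wform Y c.
Let V0 := \sum_(a : I) row_sq t a.
Hypothesis m_small : \sum_a \sum_i \sum_j S (tag a) i j * (m a i * m a j) <= eta ^+ 2 * V0.
Variable s : R.
Hypothesis s_gt0 : 0 < s.
Hypothesis sE : s ^+ 2 = E (fun x => (T0 x + lform Y m x) ^+ 2).

Let c_sym a b : c a b = c b a. Proof. exact: coef_sym. Qed.
Let c_diag a : c a a = 0. Proof. exact: coef_diag. Qed.

Let Lk2_T0 : Lk P 2 T0.
Proof. exact: (Lk2_wform mYown mYother product Y4 c_diag). Qed.

Let ET0_sq : E (fun x => T0 x ^+ 2) = V0 / 2.
Proof. exact: (Ex_wform_sq mYown mYother product Y4 EY EYY c_sym c_diag). Qed.

Let LL : Lk P 2 (lform Y m). Proof. exact: Lk2_lform. Qed.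

Let EL_sq : E (fun x => lform Y m x ^+ 2) <= eta ^+ 2 * V0.
Proof. by rewrite (Ex_lform_sq mYown mYother product Y4 EY EYY). Qed.

Let V0_ge0 : 0 <= V0.
Proof. by apply: sumr_ge0 => a _; exact: row_sq_ge0. Qed.

(** With weight eta in [Ex_amgm], the cross term costs at most 3/2 eta V0; the second moment of the
    linear part costs at most eta V0. *)
Lemma variance_close : `|s ^+ 2 - V0 / 2| <= 3 * eta * V0.
Proof.
have am := Ex_amgm eta0 (Lk1 Lk2_T0) (Lk1 LL).
have iM := Lk1M (Lk1 Lk2_T0) (Lk1 LL).
have [_ iT] := Lk1 Lk2_T0; have [_ iL] := Lk1 LL.
have e : s ^+ 2 = V0 / 2 + (2 * E (fun x => T0 x * lform Y m x) + E (fun x => lform Y m x ^+ 2)).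
  rewrite sE -ET0_sq -ExZ// -ExD//; last by apply: intgZ.
  rewrite -ExD//; last by apply: intgD => //; exact: intgZ.
  by apply: eq_Ex => x; ring.
have L0 : 0 <= E (fun x => lform Y m x ^+ 2) by apply: Ex_ge0 => x; exact: sqr_ge0.
have nM := Ex_norm iM.
have h1 : eta^-1 * E (fun x => lform Y m x ^+ 2) <= eta * V0.
  by rewrite mulrC ler_pdivrMr// mulrAC -expr2.
have h2 : eta ^+ 2 * V0 <= eta * V0 by rewrite ler_wpM2r//; move: eta0 eta_le; nra.
rewrite e [_ - _]addrAC subrr add0r; rewrite ET0_sq in am.
have h3 : 0 <= eta * V0 by rewrite mulr_ge0// ltW.
rewrite (le_trans (ler_normD _ _))// normrM (ger0_norm L0) (@ger0_norm _ 2)//.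
move: nM am h1 h2 h3 EL_sq; lra.
Qed.

(** The bound 1 / 12 on eta gives [3 * eta <= 1 / 4], so that s^2 is at least V0 / 4. *)
Let V0_le : V0 <= 4 * s ^+ 2.
Proof. by have := variance_close; rewrite ler_norml => /andP[+ _]; move: eta_le V0_ge0; nra. Qed.

(** T0 is divided by the standard deviation of the whole statistic, so its variance is only close to
    1; this feeds the first error term of [stein_bound]. *)
Lemma standardized_variance : `|V0 / s ^+ 2 / 2 - 1| <= 12 * eta.
Proof.
have s20 : 0 < s ^+ 2 by rewrite exprn_gt0.
have -> : V0 / s ^+ 2 / 2 - 1 = - (s ^+ 2 - V0 / 2) / s ^+ 2 by field; rewrite gt_eqF.
rewrite normrM normrN normfV (gtr0_norm s20) ler_pdivrMr//.
have := variance_close; have := ler_wpM2l (ltW eta0) V0_le; lra.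
Qed.

Lemma linear_part_small : E (fun x => `|(T0 x + lform Y m x) / s - T0 x / s|) <= 2 * eta.
Proof.
(* This weight balances the two terms, as the second moment of the scaled linear part is at most 4
   eta^2. *)
have l0 : 0 < (2 * eta) ^-1 by rewrite invr_gt0 mulr_gt0.
have Ls : Lk P 1 (fun x => s^-1 * lform Y m x) by apply: LkZ; exact: Lk1.
have am := Ex_amgm l0 Ls (Lk_cst P 1 1).
rewrite expr1n Ex_cst in am.
have [_ iL] := Lk1 LL.
have e : E (fun x => (s^-1 * lform Y m x) ^+ 2) <= 4 * eta ^+ 2.
  under eq_Ex do rewrite exprMn; rewrite ExZ// exprVn mulrC ler_pdivrMr ?exprn_gt0//.
  by apply: (le_trans EL_sq); have := ler_wpM2l (sqr_ge0 eta) V0_le; lra.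
rewrite (eq_Ex _ (g := fun x => `|s^-1 * lform Y m x * 1|)); last first.
  by move=> x; congr `|_|; field; rewrite gt_eqF.
apply: (le_trans am); rewrite invrK.
have : (2 * eta)^-1 * E (fun x => (s^-1 * lform Y m x) ^+ 2) <= 2 * eta.
  rewrite mulrC ler_pdivrMr ?mulr_gt0//; apply: le_trans e _; move: eta0; nra.
by lra.
Qed.

Let K1 : R := (4 * k%:R / delta ^+ 2) ^+ 4.

(** The traces are eliminated between the upper bound on the squared row sums and the lower bound on
    V0, itself at most 4 s^2: what remains depends on k and delta only. *)
Lemma standardized_row_sq :
  n * \sum_(a : I) (row_sq t a / s ^+ 2) ^+ 2 <= 4 * K1 / delta ^+ 4.
Proof.
have := sum_row_sq_sqr k2 N2 delta0 Ndelta t_ge0.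
have := sum_row_sq_ge k2 N2 delta0 Ndelta t_ge0.
rewrite -/n -/V0 -/K1; set tau := _ / n ^+ 2 => h1 h2.
have tau0 : 0 <= tau.
  by rewrite divr_ge0 ?sqr_ge0// sumr_ge0// => i _; rewrite sumr_ge0.
have s20 : 0 < s ^+ 2 by rewrite exprn_gt0.
have d20 : 0 < delta ^+ 2 by rewrite exprn_gt0.
have h3 : delta ^+ 2 * tau <= 2 * s ^+ 2 by move: h1 V0_le; lra.
have h4 : (delta ^+ 2 * tau) ^+ 2 <= (2 * s ^+ 2) ^+ 2.
  by rewrite lerXn2r ?nnegrE// ?(mulr_ge0 (ltW d20))// mulr_ge0// ltW.
have n0 : 0 < n.
  rewrite lt_neqAle ler0n andbT; apply/eqP => n00; move: n_large.
  by rewrite -n00 mulr0 ler10.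
have -> : n * \sum_(a : I) (row_sq t a / s ^+ 2) ^+ 2 = n * (\sum_(a : I) row_sq t a ^+ 2) / s ^+ 4.
  rewrite -mulrA mulr_suml; congr (_ * _); apply: eq_bigr => a _.
  by field; rewrite gt_eqF.
have s40 : 0 < s ^+ 4 by rewrite exprn_gt0.
have d40 : 0 < delta ^+ 4 by rewrite exprn_gt0.
have K10 : 0 <= K1 by exact: (expr_double_ge0 2).
rewrite ler_pdivrMr// mulrAC ler_pdivlMr//.
have h5 : n * \sum_(a : I) row_sq t a ^+ 2 <= K1 * tau ^+ 2.
  by rewrite mulrC -ler_pdivlMr.
have := ler_wpM2r (ltW d40) h5; have := ler_wpM2l K10 h4.
rewrite (_ : K1 * (delta ^+ 2 * tau) ^+ 2 = K1 * tau ^+ 2 * delta ^+ 4); last by ring.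
rewrite (_ : K1 * (2 * s ^+ 2) ^+ 2 = 4 * K1 * s ^+ 4); last by ring.
by move=> /[swap]; exact: le_trans.
Qed.

Lemma wform_scaled x : wform Y (fun a b => c a b / s) x = T0 x / s.
Proof.
rewrite /T0 /wform -mulrA mulr_suml; congr (_ * _); apply: eq_bigr => a _.
rewrite /dot mulr_suml; apply: eq_bigr => i _; rewrite -mulrA mulr_suml; congr (_ * _).
by apply: eq_bigr => b _; rewrite mulrAC.
Qed.

Let B := 4 * K1 / delta ^+ 4.

Lemma stein_standardized (f df : R -> R) (L : R) : 0 <= L ->
  (forall x : R, is_derive x 1 f (df x)) ->
  (forall x, `|f x| <= L) -> (forall x, `|df x| <= L) ->
  (forall x y, `|df x - df y| <= L * `|x - y|) ->
  `|E (fun x => df (T0 x / s)) - E (fun x => T0 x / s * f (T0 x / s))| <=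
  L * ((12 + (1 + C * B + 2 * B) / 4 + (8 + (C + 1) * (C + 3) * B) / 4) * eta).
Proof.
move=> L0 fdf fL dfL dfl.
have cs a b : c a b / s = c b a / s by rewrite c_sym.
have cd a : c a a / s = 0 by rewrite c_diag mul0r.
have := stein_bound mYown mYother product Y4 EY EYY EY4 C0 (fun a b => t_ge0 _ _) (fun a b => EYS _ _)
  (sqr_ge0 eta) (fun a b e => Seps _ _ _) cs cd eta0 fdf fL dfL dfl.
under eq_Ex do rewrite wform_scaled.
under [X in _ - X]eq_Ex do rewrite wform_scaled.
move/le_trans; apply; rewrite ler_wpM2l//.
have vE a : \sum_(b : I) (c a b / s) ^+ 2 * \tr (S (tag a) *m S (tag b)) = row_sq t a / s ^+ 2.
  by rewrite mulr_suml; apply: eq_bigr => b _; rewrite exprMn exprVn mulrAC.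
pose Q := \sum_(a : I) (row_sq t a / s ^+ 2) ^+ 2.
have -> : \sum_(a : I) \sum_(b : I) (c a b / s) ^+ 2 * \tr (S (tag a) *m S (tag b)) = V0 / s ^+ 2.
  by rewrite /V0 mulr_suml; apply: eq_bigr => a _.
have -> : \sum_(a : I) (\sum_(b : I) (c a b / s) ^+ 2 * \tr (S (tag a) *m S (tag b))) ^+ 2 = Q.
  by apply: eq_bigr => a _; rewrite vE.
rewrite card_groups -/n.
have nQ : n * Q <= B by exact: standardized_row_sq.
have Q0 : 0 <= Q by apply: sumr_ge0 => a _; exact: sqr_ge0.
(* Q is of order 1 / n, so [n_large] keeps it of order eta even after division by [lam = eta]. *)
have QB : Q / eta <= B * eta.
  rewrite ler_pdivrMr// -mulrA -expr2 mulrC.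
  have := ler_wpM2l (sqr_ge0 eta) nQ; have := ler_wpM2r Q0 n_large; lra.
have Qe0 : 0 <= Q / eta by rewrite divr_ge0// ltW.
have s20 : 0 < s ^+ 2 by rewrite exprn_gt0.
have V4 : V0 / s ^+ 2 <= 4 by rewrite ler_pdivrMr.
have e1 : eta ^+ 2 <= 1 by rewrite expr_le1 ?ltW//; move: eta_le; lra.
have -> : (12 + (1 + C * B + 2 * B) / 4 + (8 + (C + 1) * (C + 3) * B) / 4) * eta =
  12 * eta + (eta + C * (B * eta) + 2 * eta * B) / 4 + (2 * eta * 4 + (C + 1) * (C + 3) * (B * eta)) / 4.
  by field.
have e0 := ltW eta0.
rewrite !lerD// ?standardized_variance// ler_pM2r ?invr_gt0//.
  rewrite -addrA lerD2l [(C + _) * _]mulrDl mulrDl lerD//.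
    by rewrite -mulrA ler_wpM2l.
  rewrite (_ : _ / eta = 2 * eta * (n * Q)); last by field; rewrite gt_eqF.
  by rewrite ler_wpM2l// mulr_ge0.
rewrite lerD//; first by rewrite ler_wpM2l// mulr_ge0.
rewrite -[leLHS]mulrA; apply: ler_pM => //.
  by rewrite mulr_ge0 ?addr_ge0// mulr_ge0// sqr_ge0.
by rewrite ler_wpM2l ?addr_ge0//; move: e1; lra.
Qed.
End single_index.

Section mean_form.
Variables (R : realType) (k : nat) (N : 'I_k -> nat) (delta : R) (p : nat).
Local Notation I := {i : 'I_k & 'I_(N i)}.
Variables (S : 'I_k -> 'M[R]_p) (mu : 'I_k -> 'cV[R]_p) (eta : R).
Hypothesis k2 : (2 <= k)%N.
Hypothesis N2 : forall i, (2 <= N i)%N.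
Hypothesis delta0 : 0 < delta.
Let n : R := (\sum_i N i)%N%:R.
Hypothesis Ndelta : forall i, delta * n <= (N i)%:R.
Let t i j := \tr (S i *m S j).
Hypothesis t_ge0 : forall i j, 0 <= t i j.
Let tau := \sum_i \sum_j t i j.
Hypothesis mu_small : forall e l h, ((mu e - mu l)^T *m S e *m (mu e - mu h)) 0 0 <=
  eta ^+ 2 * delta ^+ 3 / (2 * k%:R ^+ 3) * (n^-1 * tau).

Definition mean_vec (a : I) l : R := 2 / (N (tag a))%:R * \sum_j (mu (tag a) l 0 - mu j l 0).

Let n_gt0 : 0 < n.
Proof.
apply: (@lt_le_trans _ _ (N (Ordinal (ltnW k2)))%:R); first by rewrite ltr0n ltnW.
by rewrite /n ler_nat [leqRHS](bigD1 (Ordinal (ltnW k2)))//= leq_addr.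
Qed.

(** Group i contributes N_i terms of weight 4 / N_i^2, at most 4 / (delta n) in all; the sums over l
    and h give k^2, and the groups another k. The factor in [mu_small] is the one that turns this
    into eta^2 times the lower bound of [sum_row_sq_ge]. *)
Lemma mean_form_small : \sum_(a : I) \sum_i \sum_j S (tag a) i j * (mean_vec a i * mean_vec a j) <=
  eta ^+ 2 * \sum_(a : I) row_sq t a.
Proof.
pose D i j l := mu i l 0 - mu j l 0 : R.
have NE i : (N i)%:R != 0 :> R by rewrite pnatr_eq0 -lt0n ltnW.
have N0 i : 0 < (N i)%:R :> R by rewrite lt_neqAle eq_sym NE ler0n.
have k0 : 0 < k%:R :> R by rewrite ltr0n ltnW.
have formE (a : I) : \sum_i \sum_j S (tag a) i j * (mean_vec a i * mean_vec a j) =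
   4 / (N (tag a))%:R ^+ 2 * \sum_l \sum_h ((mu (tag a) - mu l)^T *m S (tag a) *m (mu (tag a) - mu h)) 0 0.
  have e l h : ((mu (tag a) - mu l)^T *m S (tag a) *m (mu (tag a) - mu h)) 0 0 =
      \sum_i \sum_j S (tag a) i j * (D (tag a) l i * D (tag a) h j).
    rewrite mxE [RHS]exchange_big /=; apply: eq_bigr => j _; rewrite mxE mulr_suml.
    by apply: eq_bigr => i _; rewrite !mxE /D; ring.
  under [X in _ = _ * X]eq_bigr do under eq_bigr do rewrite e.
  under [X in _ = _ * X]eq_bigr do rewrite exchange_big /=.
  rewrite [X in _ = _ * X]exchange_big /= mulr_sumr; apply: eq_bigr => i _.
  under [X in _ = _ * X]eq_bigr do rewrite exchange_big /=.
  rewrite [X in _ = _ * X]exchange_big /= mulr_sumr; apply: eq_bigr => j _.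
  under [X in _ = _ * X]eq_bigr do rewrite -mulr_sumr -mulr_sumr.
  rewrite -mulr_sumr -mulr_suml /mean_vec -/(D (tag a)).
  by field.
move: (mu_small); set eps := eta ^+ 2 * delta ^+ 3 / (2 * k%:R ^+ 3) => mu_small'.
have eps0 : 0 <= eps.
  apply: divr_ge0; first exact: mulr_ge0 (sqr_ge0 _) (exprn_ge0 3 (ltW delta0)).
  by apply: mulr_ge0 => //; exact: exprn_ge0.
have tau0 : 0 <= tau by apply: sumr_ge0 => i _; apply: sumr_ge0.
apply: (@le_trans _ _ (\sum_(a : I) 4 / (N (tag a))%:R ^+ 2 * (k%:R ^+ 2 * (eps * (n^-1 * tau))))).
  apply: ler_sum => a _; rewrite formE ler_wpM2l ?divr_ge0 ?sqr_ge0//.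
  apply: (@le_trans _ _ (\sum_(l < k) \sum_(h < k) eps * (n^-1 * tau))).
    by apply: ler_sum => l _; apply: ler_sum => h _; exact: mu_small'.
  by rewrite !sumr_const !card_ord -mulrnA -[leLHS]mulr_natl natrM expr2.
have := sum_row_sq_ge k2 N2 delta0 Ndelta t_ge0; rewrite -/n -/tau => V0ge.
apply: le_trans (ler_wpM2l (sqr_ge0 eta) V0ge).
rewrite -(big_group (fun i _ => 4 / (N i)%:R ^+ 2 * (k%:R ^+ 2 * (eps * (n^-1 * tau))))).
apply: (@le_trans _ _ (\sum_(i < k) 4 / (delta * n) * (k%:R ^+ 2 * (eps * (n^-1 * tau))))).
  apply: ler_sum => i _; rewrite [leLHS]sumr_const card_ord -[leLHS]mulr_natl.
  rewrite [leLHS](_ : _ = 4 / (N i)%:R * (k%:R ^+ 2 * (eps * (n^-1 * tau)))); last first.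
    by field; rewrite (NE i) gt_eqF.
  rewrite ler_wpM2r//.
    rewrite mulr_ge0 ?sqr_ge0// mulr_ge0// mulr_ge0// invr_ge0 ltW//.
  by rewrite ler_wpM2l// lef_pV2 ?posrE ?mulr_gt0.
rewrite [leLHS]sumr_const card_ord -[leLHS]mulr_natl /eps le_eqVlt; apply/orP; left; apply/eqP.
by field; rewrite !gt_eqF.
Qed.

End mean_form.

Lemma variance_recentered d (T : measurableType d) (R : realType) (P : probability T R)
    (U : T -> R) (c : R) : Lk P 1 (fun x => U x - c) -> Ex P (fun x => U x - c) = 0 ->
  'V_P[U]%E = (Ex P (fun x => (U x - c) ^+ 2))%:E.
Proof.
move=> LU EU; have iU := Lk1_intg LU; have [_ i2] := LU.
have e : fine 'E_P[U]%E = c.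
  rewrite unlock -/(Ex P U) -[RHS](Ex_cst P) -[RHS]add0r -EU -ExD//; last exact: intg_cst.
  by apply: eq_Ex => x; rewrite subrK.
rewrite /variance covariance.unlock e unlock /Ex /Rintegral fineK; last exact: integrable_fin_num i2.
by apply: eq_integral.
Qed.

(** * The statistic in the linear model, at a fixed index *)

Section model.
Context d (T : measurableType d) (R : realType) (P : probability T R).
Variables (k p m : nat) (N : 'I_k -> nat) (mu : 'I_k -> 'cV[R]_p).
Variables (S : 'I_k -> 'M[R]_p) (Gamma : 'I_k -> 'M[R]_(p, m)).
Variables (X : forall i, 'I_(N i) -> {RV P >-> p.-tuple R}).
Variables (Z : forall i, 'I_(N i) -> {RV P >-> m.-tuple R}).
Local Notation I := {i : 'I_k & 'I_(N i)}.
Hypothesis within : forall i, mutually_independent P (fun j => X j : T -> p.-tuple R) (I := 'I_(N i)).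
Hypothesis between : mutually_independent P
  (fun (i : 'I_k) (w : T) => [tuple (X j w) | j < N i]).
Hypothesis X_model : forall i (j : 'I_(N i)) w, colv (X j w) = Gamma i *m colv (Z j w) + mu i.
Hypothesis Gamma_S : forall i, Gamma i *m (Gamma i)^T = S i.
Hypothesis Z_mean : forall i (j : 'I_(N i)), has_mean P (Z j) 0.
Hypothesis Z_cov : forall i (j : 'I_(N i)), has_covariance P (Z j) 1%:M.
Hypothesis Z_moments : forall i (j : 'I_(N i)), product_moments P (Z j) 8.
Variable C : R.
Hypothesis C0 : 0 <= C.
Hypothesis Z_fourth : forall i (j : 'I_(N i)) l, ('E_P[fun w => (tnth (Z j w) l ^+ 4)%R] <= C%:E)%E.
Hypothesis N2 : forall i, (2 <= N i)%N.

Local Notation E := (Ex P).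
Let XI (a : I) : T -> p.-tuple R := X (tagged a).
Let Y (a : I) l w := tnth (XI a w) l - mu (tag a) l 0.
Let H := own_events XI.
Let G := other_events XI.

Let mXI a : measurable_fun setT (XI a).
Proof. exact: measurable_funP. Qed.

Let mcoord (a : I) l : measurable_fun setT (fun x : p.-tuple R => tnth x l - mu (tag a) l 0).
Proof. by apply: measurable_funB => //; exact: measurable_tnth. Qed.

Let mYown a l : sub_measurable (H a) (Y a l).
Proof. exact: own_sub_measurable (mcoord a l). Qed.

Let mYother a b l : b != a -> sub_measurable (G a) (Y b l).
Proof. by move=> ba; exact: other_sub_measurable ba (mcoord b l). Qed.

Let product a U V : sub_measurable (H a) U -> sub_measurable (G a) V ->
  intg P U -> intg P V ->
  intg P (fun x => U x * V x) /\ E (fun x => U x * V x) = E U * E V.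
Proof.
by apply: own_other_product => [|A mA]; [exact: mXI|exact: (grouped_independent within between)].
Qed.

Let YE (a : I) l w : Y a l w = \sum_j Gamma (tag a) l j * tnth (Z (tagged a) w) j.
Proof.
have /matrixP/(_ l 0) := X_model (tagged a) w.
rewrite !mxE /Y /XI => ->; rewrite addrK.
by apply: eq_bigr => j _; rewrite mxE.
Qed.

Let Y4 a l : Lk P 2 (Y a l).
Proof. exact: (model_Lk2 (@Z_fourth _ (tagged a)) (YE a)). Qed.

Let EY a l : E (Y a l) = 0.
Proof. exact: (model_mean (@Z_mean _ (tagged a)) (@Z_fourth _ (tagged a)) (YE a)). Qed.

Let EYY a i j : E (fun x => Y a i x * Y a j x) = S (tag a) i j.
Proof.
rewrite -Gamma_S.
exact: (model_cov (@Z_mean _ (tagged a)) (@Z_cov _ (tagged a)) (@Z_fourth _ (tagged a)) (YE a)).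
Qed.

Let EY4 a (v : 'I_p -> R) : E (fun x => (\sum_i v i * Y a i x) ^+ 4) <=
  3 * C * (\sum_i \sum_j S (tag a) i j * (v i * v j)) ^+ 2.
Proof.
rewrite -Gamma_S.
exact: (model_fourth (@Z_mean _ (tagged a)) (@Z_moments _ (tagged a)) (@Z_fourth _ (tagged a)) (YE a)).
Qed.

Let t i j := \tr (S i *m S j).

Let t_ge0 i j : 0 <= t i j.
Proof.
by rewrite /t -!Gamma_S; exact: mxtrace_gram_ge0.
Qed.

Let EYS i b : E (fun x => qf (S i) (Y b) x ^+ 2) <= 3 * C * t i (tag b) ^+ 2.
Proof.
rewrite /t -[S i]Gamma_S; apply: (Ex_gram_qf_sq _ (@Y4 b) (@EYY b) (@EY4 b)).
by rewrite mulr_ge0.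
Qed.

Let Tn w := T_stat (fun i (j : 'I_(N i)) => colv (X j w)).
Let D := \sum_(i < k) \sum_(j < k | (i < j)%N) euclidean_norm (mu i - mu j) ^+ 2.
Let T0 := wform Y (fun a b => coef R a b).
Let L := lform Y (@mean_vec _ _ N _ mu).

Let statE w : Tn w - D = T0 w + L w.
Proof.
rewrite /Tn /D (T_stat_decomposition N2 mu); congr (_ * _ + _).
  apply: eq_bigr => a _; apply: eq_bigr => l _; rewrite mxE; congr (_ * _).
  by apply: eq_bigr => b _; rewrite mxE.
by apply: eq_bigr => a _; apply: eq_bigr => l _; rewrite mxE mulrC.
Qed.

Variables (delta eta : R).
Hypothesis k2 : (2 <= k)%N.
Hypothesis delta0 : 0 < delta.
Let n : R := (\sum_i N i)%N%:R.
Hypothesis Ndelta : forall i, delta * n <= (N i)%:R.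
Hypothesis eta0 : 0 < eta.
Hypothesis eta_le : eta <= 1 / 12.
Hypothesis n_large : 1 <= eta ^+ 2 * n.
Hypothesis Seps : forall l e h,
  \tr (S l *m S e *m S l *m S h) <= eta ^+ 2 * (t l e * t l h).
Hypothesis mu_small : forall e l h, ((mu e - mu l)^T *m S e *m (mu e - mu h)) 0 0 <=
  eta ^+ 2 * delta ^+ 3 / (2 * k%:R ^+ 3) * (n^-1 * \sum_i \sum_j t i j).
Hypothesis Var_gt0 : (0 < 'V_P[Tn])%E.

(* Only its independence of the sample size and of the dimension matters. *)
Definition stein_const : R :=
  let C' := 3 * C in let B := 4 * (4 * k%:R / delta ^+ 2) ^+ 4 / delta ^+ 4 in
  12 + (1 + C' * B + 2 * B) / 4 + (8 + (C' + 1) * (C' + 3) * B) / 4.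

Lemma statistic_stein (xi := fun w => (Tn w - D) / Num.sqrt (fine 'V_P[Tn])) :
  exists W : T -> R,
     [/\ Lk P 1 W, Lk P 1 xi,
     (forall (f df : R -> R) (L : R), 0 <= L -> (forall x : R, is_derive x 1 f (df x)) ->
      (forall x, `|f x| <= L) -> (forall x, `|df x| <= L) ->
      (forall x y, `|df x - df y| <= L * `|x - y|) ->
      `|E (fun x => df (W x)) - E (fun x => W x * f (W x))| <= L * (stein_const * eta)) &
      E (fun x => `|xi x - W x|) <= 2 * eta].
Proof.
have c_diag (a : I) : coef R a a = 0 by exact: coef_diag.
have LT0 : Lk P 1 T0 := Lk1 (Lk2_wform mYown mYother product Y4 c_diag).
have LL : Lk P 1 L := Lk1 (Lk2_lform Y4 _).
have LTL : Lk P 1 (fun w => T0 w + L w) by exact: LkD.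
have var : 'V_P[Tn]%E = (E (fun w => (T0 w + L w) ^+ 2))%:E.
  rewrite (@variance_recentered _ _ _ _ _ D).
  - by congr EFin; apply: eq_Ex => w; rewrite statE.
  - by under eq_fun do rewrite statE.
  - rewrite (eq_Ex _ statE) ExD; [|exact: Lk1_intg|exact: Lk1_intg].
    by rewrite (Ex_wform mYown mYother product Y4 EY c_diag) (Ex_lform Y4 EY) addr0.
move: Var_gt0; rewrite var lte_fin => v0.
set s := Num.sqrt (fine 'V_P[Tn]%E).
have s0 : 0 < s by rewrite /s var sqrtr_gt0.
have sE : s ^+ 2 = E (fun w => (T0 w + L w) ^+ 2) by rewrite /s var sqr_sqrtr// ltW.
have m_small := mean_form_small k2 N2 delta0 Ndelta t_ge0 mu_small.
have C30 : 0 <= 3 * C by rewrite mulr_ge0.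
exists (fun w => T0 w / s); split.
- by under eq_fun do rewrite mulrC; exact: LkZ.
- by rewrite /xi; under eq_fun do rewrite statE mulrC; exact: LkZ.
- move=> f df M M0 fdf fM dfM dfl.
  exact: (stein_standardized k2 N2 delta0 Ndelta mYown mYother product Y4 EY EYY EY4 C30
    t_ge0 EYS eta0 eta_le n_large Seps m_small s0 sE M0 fdf fM dfM dfl).
- rewrite (eq_Ex _ (g := fun x => `|(T0 x + L x) / s - T0 x / s|)).
    exact: (linear_part_small mYown mYother product Y4 EY EYY t_ge0 eta0 eta_le m_small s0 sE).
  by move=> w; rewrite /xi statE.
Qed.

End model.

(* [r] is the index along which the limit is taken: every object depends on it,
   and the dimension [p r] and the total sample size [n r] tend to infinity. *)
Theorem theorem1p1 (R : realType) (k : nat) (k_ge3 : (3 <= k)%N)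
    (d : nat -> measure_display) (T : forall r, measurableType (d r))
    (P : forall r, probability (T r) R)
    (p m : nat -> nat) (N : nat -> 'I_k -> nat) (kappa : 'I_k -> R)
    (mu : forall r, 'I_k -> 'cV[R]_(p r))
    (Sigma : forall r, 'I_k -> 'M[R]_(p r))
    (Gamma : forall r, 'I_k -> 'M[R]_(p r, m r))
    (X : forall r (i : 'I_k), 'I_(N r i) -> {RV P r >-> (p r).-tuple R})
    (Z : forall r (i : 'I_k), 'I_(N r i) -> {RV P r >-> (m r).-tuple R})
    (n := fun r => (\sum_(i < k) N r i)%N)
    (Tn := fun r (w : T r) =>
       T_stat (fun (i : 'I_k) (j : 'I_(N r i)) => colv (X r i j w)))
    (p_infty : p @ \oo --> \oo) (n_infty : n @ \oo --> \oo)
    (X_iid : forall r i, iid (X r i))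
    (X_mean : forall r i j, has_mean (P r) (X r i j) (mu r i))
    (X_cov : forall r i j, has_covariance (P r) (X r i j) (Sigma r i))
    (groups_independent : forall r,
       mutually_independent (P r)
         (fun (i : 'I_k) (w : T r) => [tuple (X r i j w) | j < N r i]))
    (* (a) *)
    (m_ge_p : forall r, (p r <= m r)%N)
    (X_model : forall r i j w,
       colv (X r i j w) = Gamma r i *m colv (Z r i j w) + mu r i)
    (Gamma_Sigma : forall r i, Gamma r i *m (Gamma r i)^T = Sigma r i)
    (Z_iid : forall r i, iid (Z r i))
    (Z_mean : forall r i j, has_mean (P r) (Z r i j) 0)
    (Z_cov : forall r i j, has_covariance (P r) (Z r i j) 1%:M)
    (* (b) *)
    (Z_moments : forall r i j, product_moments (P r) (Z r i j) 8)
    (Z_fourth : exists C : R, forall r i j (l : 'I_(m r)),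
       ('E_(P r)[fun w => (tnth (Z r i j w) l ^+ 4)%R] <= C%:E)%E)
    (* (c) *)
    (kappa_in01 : forall i, 0 < kappa i < 1)
    (N_ratio : forall i, (N r i)%:R / (n r)%:R @[r --> \oo] --> kappa i)
    (* (d) *)
    (Sigma_o : forall e l h : 'I_k,
       (fun r => \tr (Sigma r l *m Sigma r e *m Sigma r l *m Sigma r h))
       =o_\oo
       (fun r => \tr (Sigma r l *m Sigma r e) * \tr (Sigma r l *m Sigma r h)))
    (* (e) *)
    (mu_o : forall e l h : 'I_k,
       (fun r => ((mu r e - mu r l)^T *m Sigma r e *m (mu r e - mu r h)) 0 0)
       =o_\oo
       (fun r => (n r)%:R^-1
          * \tr ((\sum_(i < k) Sigma r i) *m (\sum_(i < k) Sigma r i))))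
    (Var_gt0 : \forall r \near \oo, (0 < 'V_(P r)[Tn r])%E) :
  cvg_in_distribution P
    (fun r w =>
       (Tn r w
        - \sum_(i < k) \sum_(j < k | (i < j)%N)
            euclidean_norm (mu r i - mu r j) ^+ 2)
       / Num.sqrt (fine 'V_(P r)[Tn r]))
    (normal_prob 0 1).
Proof.
have [C HC] := Z_fourth.
have C_ge0 : 0 <= `|C| by exact: normr_ge0.
have HC' r i (j : 'I_(N r i)) l : ('E_(P r)[fun w => (tnth (Z r i j w) l ^+ 4)%R] <= `|C|%:E)%E.
  by apply: le_trans (HC r i j l) _; rewrite lee_fin ler_norm.
(* All kappa i are below 1, so their product is at most each of them; halving makes the inequality
   strict, which the convergence of the ratios requires. *)
pose delta : R := (\prod_i kappa i) / 2.
have prod_gt0 : 0 < \prod_i kappa i by apply: prodr_gt0 => i _; have /andP[] := kappa_in01 i.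
have delta0 : 0 < delta by rewrite divr_gt0.
have delta_lt i : delta < kappa i.
  have /andP[ki0 ki1] := kappa_in01 i.
  rewrite /delta (bigD1 i)//= ltr_pdivrMr// ltr_pM2l//.
  apply: (@le_lt_trans _ _ 1); last by rewrite ltr1n.
  by apply: prodr_ile1 => j _; have /andP[/ltW-> /ltW->] := kappa_in01 j.
have k2 : (2 <= k)%N by exact: ltnW.
apply: cvg_in_distribution_stein => e e0.
pose K := `|stein_const k `|C| delta|.
have K2 : 0 < K + 2 by rewrite ltr_wpDl// normr_ge0.
(* Stein's bound costs at most [K * eta] and the distance to W at most [2 * eta]; [K + 2] covers
   both. *)
pose eta : R := Num.min (1 / 12) (e / (K + 2)).
have eta0 : 0 < eta by rewrite lt_min !divr_gt0.
have eta1 : eta <= 1 / 12 by rewrite ge_min lexx.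
have etaK : eta * (K + 2) <= e by rewrite -ler_pdivlMr// ge_min lexx orbT.
pose t r i j := \tr (Sigma r i *m Sigma r j).
have t_ge0 r i j : 0 <= t r i j by rewrite /t -!Gamma_Sigma; exact: mxtrace_gram_ge0.
have tauE r : \tr ((\sum_(i < k) Sigma r i) *m (\sum_(i < k) Sigma r i)) = \sum_i \sum_j t r i j.
  rewrite mulmx_suml linear_sum; apply: eq_bigr => i _.
  by rewrite mulmx_sumr linear_sum.
(* The tolerance in (e) that [mean_form_small] asks for. *)
pose mu_eps := eta ^+ 2 * delta ^+ 3 / (2 * k%:R ^+ 3).
have mu_eps0 : 0 < mu_eps.
  have k0 : 0 < k%:R :> R by rewrite ltr0n ltnW.
  by rewrite /mu_eps divr_gt0// mulr_gt0// exprn_gt0.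
have near_ratio : \forall r \near \oo, forall i, delta < (N r i)%:R / (n r)%:R.
  by apply: filter_forall => i; exact: (cvgr_gt _ (N_ratio i)).
have near_n (M : R) : \forall r \near \oo, M <= (n r)%:R.
  have [A MA] : exists A, M <= A%:R.
    by exists (Num.truncn `|M|).+1; rewrite (le_trans (ler_norm M))// ltW// truncnS_gt.
  move/cvgnyPge : n_infty => /(_ A); apply: filterS => r An.
  by rewrite (le_trans MA)// ler_nat.
have near_Sigma : \forall r \near \oo, forall l e h,
    \tr (Sigma r l *m Sigma r e *m Sigma r l *m Sigma r h) <= eta ^+ 2 * (t r l e * t r l h).
  apply: filter_forall => l; apply: filter_forall => e'; apply: filter_forall => h.
  have /eqoP/(_ (eta ^+ 2)) := Sigma_o e' l h; rewrite exprn_gt0// => /(_ isT).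
  apply: filterS => r; rewrite (ger0_norm (mulr_ge0 (t_ge0 _ _ _) (t_ge0 _ _ _))).
  by apply: le_trans; exact: ler_norm.
have near_mu : \forall r \near \oo, forall e l h,
    ((mu r e - mu r l)^T *m Sigma r e *m (mu r e - mu r h)) 0 0 <=
    mu_eps * ((n r)%:R^-1 * \sum_i \sum_j t r i j).
  apply: filter_forall => e'; apply: filter_forall => l; apply: filter_forall => h.
  have /eqoP/(_ mu_eps mu_eps0) := mu_o e' l h.
  apply: filterS => r; rewrite tauE [X in _ <= _ * X]ger0_norm.
    by apply: le_trans; exact: ler_norm.
  by rewrite mulr_ge0// sumr_ge0// => i _; exact: sumr_ge0.
near=> r.
have n_gt0 : 0 < (n r)%:R :> R.
  by apply: lt_le_trans ltr01 _; near: r; exact: near_n.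
have Ndelta i : delta * (n r)%:R <= (N r i)%:R.
  by rewrite -ler_pdivlMr// ltW//; move: i; near: r.
(* For a large index every group has at least two observations, so the sample covariances involve no
   division by zero. *)
have N2 i : (2 <= N r i)%N.
  rewrite -(ler_nat R); apply: le_trans (Ndelta i).
  by rewrite mulrC -ler_pdivrMr//; near: r; exact: near_n.
have n_large : 1 <= eta ^+ 2 * (n r)%:R.
  by rewrite mulrC -ler_pdivrMr ?exprn_gt0//; near: r; exact: near_n.
have Sigma_small : forall l e h,
    \tr (Sigma r l *m Sigma r e *m Sigma r l *m Sigma r h) <= eta ^+ 2 * (t r l e * t r l h).
  by near: r.
have mu_small : forall e l h, ((mu r e - mu r l)^T *m Sigma r e *m (mu r e - mu r h)) 0 0 <=
    mu_eps * ((n r)%:R^-1 * \sum_i \sum_j t r i j).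
  by near: r.
have var_gt0 : (0 < 'V_(P r)[Tn r])%E by near: r.
have [W [LW Lxi stein dist]] := statistic_stein (fun i => (X_iid r i).1)
  (groups_independent r) (X_model r) (Gamma_Sigma r) (Z_mean r) (Z_cov r) (Z_moments r)
  C_ge0 (HC' r) N2 k2 delta0 Ndelta eta0 eta1 n_large
  Sigma_small mu_small var_gt0.
have etae : stein_const k `|C| delta * eta <= e.
  apply: le_trans etaK; rewrite mulrC ler_pM2l//.
  by rewrite (le_trans (ler_norm _))// lerDl.
exists W; split => //.
  move=> f df L L0 fdf fL dfL dfl; apply: (le_trans (stein f df L L0 fdf fL dfL dfl)).
  by rewrite ler_wpM2l.
apply: (le_trans dist); apply: le_trans etaK; rewrite mulrC ler_pM2l//.
by rewrite lerDr normr_ge0.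
Unshelve. all: by end_near.
Qed.
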